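(* Let $X=[0,1]$, $0<c<1$, $\xi=\{(0,c),(c,1)\}$, and let $T:X\to X$ be such that each restriction $T|_{(0,c)}$, $T|_{(c,1)}$ is an increasing homeomorphism onto $(0,1)$. Assume that $T|_{(c,1)}$ admits a uniformly expanding $\mathcal{C}^2$ extension to $[c,1]$, while $T|_{(0,c)}$ extends to a $\mathcal{C}^2$ map on $(0,c]$ with: $T0=0$; for every $\varepsilon>0$ there is $\rho(\varepsilon)>1$ with $T'\geq\rho(\varepsilon)$ on $[\varepsilon,c]$; $\lim_{x\searrow0}T'x=1$; and $T'$ increasing on some interval $(0,\delta)$. Suppose further that there is a continuous decreasing function $g$ on $(0,c]$ with $\int_0^c g(x)\,dx<\infty$ and $|T''|\leq g$ on $(0,c]$. Let $\mu\ll\lambda$ be the unique $T$-invariant probability measure absolutely continuous with respect to Lebesgue measure $\lambda$, and $h$ the continuous version of its density $d\mu/d\lambda$. Let $(E_k)_{k\geq1}$ be a sequence of intervals each containing the fixed point $0$, with $\lambda(E_k)\to0$. Then: (1) $\mu(E_k)\,\varphi_{E_k}\to\infty$ in $\mu$-measure as $k\to\infty$ (i.e. $\mu(\mu(E_k)\varphi_{E_k}\leq t)\to0$ for every $t>0$); (2) $\frac{h(c)}{T'(c^+)}\,\lambda(E_k)\,\varphi_{E_k}$, regarded as a random variable on $(X,\mu)$, converges in law to a standard exponential random variable $\mathcal{E}$ (with $\Pr[\mathcal{E}>t]=e^{-t}$, $t\geq0$) as $k\to\infty$.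
   Context: The hitting time of a set $E$ is $\varphi_E(x):=\min\{n\geq1:T^nx\in E\}$. $T'(c^+)$ denotes the derivative at $c$ of the $\mathcal{C}^2$ extension of $T|_{(c,1)}$ to $[c,1]$. *)

(* Defs.v *)
From HB Require Import structures.
From mathcomp Require Import all_boot all_order all_algebra.
From mathcomp Require Import all_classical all_reals all_analysis.
Set Implicit Arguments. Unset Strict Implicit. Unset Printing Implicit Defensive.
Import Order.TTheory GRing.Theory Num.Theory.
Import numFieldNormedType.Exports.
Local Open Scope classical_set_scope.
Local Open Scope ring_scope.

(* hitting time  phi_E(x) = min { n >= 1 : T^n x \in E }, = +oo if no such n
   (the infimum of a nonempty set of naturals is its minimum). *)
Definition hitting_time {R : realType} (T : R -> R) (E : set R) (x : R) : \bar R :=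
  ereal_inf [set ((n%:R : R)%:E) | n in [set n : nat | (0 < n)%N /\ E (iter n T x)]].

Definition dens_measure {R : realType} (h : R -> R) (A : set R) : \bar R :=
  (\int[@lebesgue_measure R]_(x in A `&` `[0%R, 1%R]%classic) (h x)%:E)%E.

Definition C2_on {R : realType} (F : R -> R) (U : set R) : Prop :=
  forall x, U x ->
    [/\ derivable F x 1, derivable (derive1 F) x 1 & {for x, continuous (derive1 (derive1 F))}].

(* Main.v *)
Require Import Defs.
From HB Require Import structures.
From mathcomp Require Import all_boot all_order all_algebra.
From mathcomp Require Import all_classical all_reals all_analysis.
From mathcomp Require Import measurable_realfun ring lra zify.
Set Implicit Arguments. Unset Strict Implicit. Unset Printing Implicit Defensive.
Import Order.TTheory GRing.Theory Num.Theory.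
Import numFieldNormedType.Exports.
Local Open Scope ring_scope.
Local Open Scope classical_set_scope.

(** Write psiL, psiR for the inverse branches of T and b_n := psiL^n(1), so that b_0 = 1, b_1 = c
    and b_n decreases to 0.  Squeezing E_k between [0, b_{N+1}] and [0, b_N] reduces everything to
    E = [0, b_N], because b_{N+1} / b_N -> 1 (T'(0) = 1).

    The first-return map to Y = [c, 1] has the full inverse branches psi_j = psiR o psiL^j, which
    contract uniformly and have bounded distortion (the integrable bound on T'' is summed along
    the b_j).  A point of Y avoids E up to time n iff its itinerary under these branches does, so
    the survival probability of a measure on Y is a linear functional of its distribution function,
    given by a renewal-type recursion.  Splitting off a fraction of Lebesgue measure from a regular
    measure and pushing the rest forward (a Doeblin coupling) shows that all regular measures
    have asymptotically the same survival probabilities, up to a bounded time shift.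

    The distribution function H of mu is a fixed point of the same pull-back, and thereby regular
    although its density is only assumed continuous.  Points leave E at rate
    th_N = H(b_N) - H(b_{N+1}) = mu([c, psiR b_N]) ~ h(c) b_N / T'(c+), and come back to Y exactly
    N steps later with a regular distribution.  Hence F(n) = mu(phi_E > n) satisfies
    F(n) - F(n+1) = th_N (F(n) + o(1)) and F(n) = (1 - th_N)^n + o(1), uniformly in n, once
    N th_N -> 0; the latter holds because the decreasing th_N have finite sum.  As
    th_N = o(mu [0, b_N]), the normalisation by mu(E_k) instead gives escape to infinity. *)

(** * Regular distribution functions *)

(** Measures on [[c, 1]] are handled through their distribution functions: pushing forward along a
    return branch is then composition with [psi j], with no derivative, and regularity is an
    inequality between increments, stable under sums and limits. This matters for mu, whose density
    is only continuous on [(0, 1)], with no bound given at the ends: [H] is approximated by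
    functions regular up to a factor [expR a], and pulling these back improves the constant to
    [Kreg] while leaving [H] almost unchanged.

    The target [[0, b_N]] is a union of levels, so an excursion through the branch [psi j] avoids it
    exactly when [j < N], and survival becomes an exact recursion. The coupling constants do not
    depend on [N], which makes the estimates uniform in the shrinking target. The common survival
    probability [wref N n] is never computed: F and, divided by th_N, its decrements are both close
    to it, and eliminating it leaves a difference equation for F alone. *)

Section Regular.
Variables (R : realType) (c : R).
Hypotheses (c_ge0 : 0 <= c) (c_lt1 : c < 1).
Implicit Types (V W : R -> R) (K q : R).

Definition increasing_on V := forall x y, c <= x -> x <= y -> y <= 1 -> V x <= V y.

Local Notation incr := increasing_on.

Definition mass_on V := V 1 - V c.

Local Notation mass := mass_on.

(* For smooth [V] and [q = 1]: [ln V'] is [K]-Lipschitz.  The slack [q] is needed for densities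
   that are only known to be uniformly continuous. *)
Definition regular_on q K V := forall p r x1 x2 y1 y2,
  c <= p -> p <= x1 -> x1 <= x2 -> x2 <= r ->
  p <= y1 -> y1 <= y2 -> y2 <= r -> r <= 1 ->
  (V x2 - V x1) * (y2 - y1) <=
  q * expR (K * (r - p)) * ((V y2 - V y1) * (x2 - x1)).

Local Notation reg := regular_on.

Lemma mass_ge0 V : incr V -> 0 <= mass V.
Proof. by move=> iV; rewrite subr_ge0 iV // ltW. Qed.

Lemma incr_id : incr id. Proof. by []. Qed.

Lemma reg_le q q' K K' V : 0 <= q -> q <= q' -> K <= K' -> incr V -> reg q K V -> reg q' K' V.
Proof.
move=> q0 qq' KK' iV rV p r x1 x2 y1 y2 cp px1 x12 x2r py1 y12 y2r r1.
have pr : p <= r by rewrite (le_trans px1)// (le_trans x12).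
apply: le_trans (rV _ _ _ _ _ _ cp px1 x12 x2r py1 y12 y2r r1) _.
apply: ler_wpM2r.
  apply: mulr_ge0; rewrite subr_ge0 //.
  apply: iV => //; [exact: le_trans py1|exact: le_trans r1].
apply: ler_pM; rewrite ?expR_ge0 //.
by rewrite ler_expR ler_wpM2r // subr_ge0.
Qed.

Lemma reg_add q K V W : reg q K V -> reg q K W -> reg q K (fun x => V x + W x).
Proof.
move=> rV rW p r x1 x2 y1 y2 h1 h2 h3 h4 h5 h6 h7 h8.
have := rV _ _ _ _ _ _ h1 h2 h3 h4 h5 h6 h7 h8.
have := rW _ _ _ _ _ _ h1 h2 h3 h4 h5 h6 h7 h8.
move: (q * _) => e; lra.
Qed.

Lemma incr_add V W : incr V -> incr W -> incr (fun x => V x + W x).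
Proof. by move=> iV iW x y *; rewrite lerD ?iV ?iW. Qed.

Lemma incr_scale a V : 0 <= a -> incr V -> incr (fun x => a * V x).
Proof. by move=> a0 iV x y *; rewrite ler_wpM2l ?iV. Qed.

(** Comparing an interval with all of [[c, 1]] in the definition of regularity keeps the density of
    [V] within a factor [expR K] of its mean [mass V / (1 - c)]. This is the lower half;
    [reg_le_mass] is the upper one. *)
Lemma reg_ge K V x y : 0 <= K -> incr V -> reg 1 K V -> c <= x -> x <= y -> y <= 1 ->
  expR (- K) * (mass V * (y - x)) <= (V y - V x) * (1 - c).
Proof.
move=> K0 iV rV cx xy y1.
have := rV c 1 c 1 x y (lexx _) (lexx _) (ltW c_lt1) (lexx _) cx xy y1 (lexx _).
rewrite mul1r => h.
rewrite -(@ler_pM2l _ (expR K)) ?expR_gt0 // [leLHS]mulrA -expRD subrr expR0 mul1r.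
apply: (le_trans h); apply: ler_wpM2r.
  by rewrite mulr_ge0 // subr_ge0 ?iV// ltW.
by rewrite ler_expR; have := mulr_ge0 K0 c_ge0; lra.
Qed.

Lemma reg_le_mass K V x y : 0 <= K -> incr V -> reg 1 K V -> c <= x -> x <= y -> y <= 1 ->
  (V y - V x) * (1 - c) <= expR K * (mass V * (y - x)).
Proof.
move=> K0 iV rV cx xy y1.
have := rV c 1 x y c 1 (lexx _) cx xy y1 (lexx _) (ltW c_lt1) (lexx _) (lexx _).
rewrite mul1r => h; apply: (le_trans h); apply: ler_wpM2r.
  by rewrite mulr_ge0 ?mass_ge0 // subr_ge0.
by rewrite ler_expR; have := mulr_ge0 K0 c_ge0; lra.
Qed.

(** Fraction of the mass split off as a multiple of Lebesgue measure. By [reg_ge] the factor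
    [expR (- K)] keeps this multiple below [expR (- (K + 1)) / (K + 1)] times [V], a proportion
    small enough for the remainder to be regular with constant [K + 1]. *)
Definition split_rate K : R := expR (- (K + 1)) / (K + 1) * expR (- K).

Lemma split_rate_gt0 K : 0 <= K -> 0 < split_rate K.
Proof. by move=> K0; apply: mulr_gt0; rewrite ?expR_gt0 // divr_gt0 ?expR_gt0 //; lra. Qed.

Lemma split_rate_lt1 K : 0 <= K -> split_rate K < 1.
Proof.
move=> K0; rewrite /split_rate.
have e1 : expR (- K) <= 1 by rewrite -[leRHS]expR0 ler_expR; lra.
have e2 : expR (- (K + 1)) < 1 by rewrite -[ltRHS]expR0 ltr_expR; lra.
have e3 := expR_gt0 (- K).
have e4 := expR_gt0 (- (K+1)).
have : expR (- (K + 1)) / (K + 1) < 1.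
  by rewrite ltr_pdivrMr ?mul1r; lra.
move: (_ / _) => u hu; nra.
Qed.

Definition split_rem K V x := V x - split_rate K / (1 - c) * mass V * x.

Lemma mass_split_rem K V : mass (split_rem K V) = (1 - split_rate K) * mass V.
Proof.
rewrite /split_rem /mass; have : 1 - c != 0 by rewrite subr_eq0 gt_eqF.
by move=> ?; field.
Qed.

Lemma split_rem_lb K V x y : 0 <= K -> incr V -> reg 1 K V -> c <= x -> x <= y -> y <= 1 ->
  split_rate K / (1 - c) * mass V * (y - x) <= expR (- (K + 1)) / (K + 1) * (V y - V x).
Proof.
move=> K0 iV rV cx xy y1.
have h := reg_ge K0 iV rV cx xy y1.
have c1 : 0 < 1 - c by rewrite subr_gt0.
rewrite /split_rate.
have a0 : 0 <= expR (- (K + 1)) / (K + 1) by rewrite divr_ge0 ?expR_ge0//; lra.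
move: (_ / (K+1)) a0 => a a0.
rewrite -(ler_pM2r c1).
have -> : a * expR (- K) / (1 - c) * mass V * (y - x) * (1 - c) =
   a * (expR (- K) * (mass V * (y - x))) by field; rewrite gt_eqF.
by rewrite -mulrA ler_wpM2l.
Qed.

Lemma incr_split_rem K V : 0 <= K -> incr V -> reg 1 K V -> incr (split_rem K V).
Proof.
move=> K0 iV rV x y cx xy y1; rewrite /split_rem.
have := split_rem_lb K0 iV rV cx xy y1.
have e2 : expR (- (K + 1)) <= 1 by rewrite -[leRHS]expR0 ler_expR; lra.
have e4 := expR_gt0 (- (K+1)).
have : expR (- (K + 1)) / (K + 1) <= 1 by rewrite ler_pdivrMr ?mul1r; lra.
have := iV _ _ cx xy y1.
move: (_ / (K+1)) => u; move: (_ / _ * mass V) => b; nra.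
Qed.

Lemma reg_split_rem K V : 0 <= K -> incr V -> reg 1 K V -> reg 1 (K + 1) (split_rem K V).
Proof.
move=> K0 iV rV p r x1 x2 y1 y2 h1 h2 h3 h4 h5 h6 h7 h8.
have := rV _ _ _ _ _ _ h1 h2 h3 h4 h5 h6 h7 h8.
have hb := split_rem_lb K0 iV rV (le_trans h1 h5) h6 (le_trans h7 h8).
have B0 : 0 <= V y2 - V y1.
  by rewrite subr_ge0 iV ?(le_trans h1 h5) ?(le_trans h7 h8).
rewrite /split_rem !mul1r => hV.
have d0 : 0 <= r - p by rewrite subr_ge0 (le_trans h2) // (le_trans h3).
have d1 : r - p <= 1 by have := c_ge0; lra.
move: hb; set al := _ / (K + 1); set be := (_ / _ * mass V) => hb.
set d := r - p in d0 d1 hV *.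
(* Subtracting a constant density costs the left-hand side; raising the constant to [K + 1] gains
   the right-hand side. They are separated by [d]: the left is at most [d] by the choice of [al] and
   [d <= 1], the right at least [d]. *)
have key : al * (expR ((K + 1) * d) - 1) <= expR ((K + 1) * d) - expR (K * d).
  have E1 : expR ((K + 1) * d) = expR (K * d) * expR d by rewrite -expRD; congr expR; ring.
  have e0 : 1 <= expR (K * d) by rewrite -[leLHS]expR0 ler_expR mulr_ge0.
  have e1 : 1 + d <= expR d by exact: expR_ge1Dx.
  have l1 : d <= expR ((K + 1) * d) - expR (K * d).
    rewrite E1; have : 0 <= (expR (K * d) - 1) * (expR d - 1) by rewrite mulr_ge0 //; lra.
    lra.
  apply: le_trans l1.
  have l2 : expR ((K + 1) * d) - 1 <= (K + 1) * d * expR ((K + 1) * d).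
    have := expR_ge1Dx (- ((K + 1) * d)); rewrite -(ler_pM2r (expR_gt0 ((K + 1) * d))).
    by rewrite -expRD addNr expR0; lra.
  have al0 : 0 <= al by rewrite /al divr_ge0 ?expR_ge0//; lra.
  apply: le_trans (ler_wpM2l al0 l2) _.
  have -> : al * ((K + 1) * d * expR ((K + 1) * d)) = d * (expR (- (K + 1)) * expR ((K+1) * d)).
    by rewrite /al; field; lra.
  rewrite -expRD -[leRHS]mulr1 ler_wpM2l // -[leRHS]expR0 ler_expR; nra.
have L0 : 0 <= x2 - x1 by rewrite subr_ge0.
have M0 : 0 <= y2 - y1 by rewrite subr_ge0.
have -> : V x2 - be * x2 - (V x1 - be * x1) = (V x2 - V x1) - be * (x2 - x1) by ring.
have -> : V y2 - be * y2 - (V y1 - be * y1) = (V y2 - V y1) - be * (y2 - y1) by ring.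
have e1 : 1 <= expR ((K + 1) * d) by rewrite -[leLHS]expR0 ler_expR mulr_ge0 //; lra.
move: hV hb key e1 B0 L0 M0.
move: (V x2 - V x1) (V y2 - V y1) (x2 - x1) (y2 - y1) (expR (K * d)) (expR ((K+1) * d)).
move=> A B L M E E1 hV hb key e1 B0 L0 M0.
have k1 : (E1 - 1) * (be * M) <= (E1 - E) * B.
  apply: le_trans (_ : (E1 - 1) * (al * B) <= _); first by rewrite ler_wpM2l //; lra.
  by rewrite mulrA [_ * al]mulrC ler_wpM2r.
have := ler_wpM2r L0 k1; nra.
Qed.

End Regular.

(** * Coupling for full branches *)

Section Survival.
Variables (R : realType) (c : R) (psi : nat -> R -> R) (N : nat).
Implicit Types (V W : R -> R).
Local Notation mass := (mass_on c).
Local Notation incr := (increasing_on c).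

(** [k] is fuel, as the remaining time [n' - j] is not a structural subterm; by [surv_rec_fuel] any
    [k >= n] gives the same value. *)
Fixpoint surv_rec (k n : nat) V : R :=
  match k, n with
  | k'.+1, n'.+1 => \sum_(j < N) surv_rec k' (n' - j) (V \o psi j)
  | _, _ => mass V
  end.

(* For [V] the distribution function of a measure on [[c, 1]], this is the measure of the points
   that avoid [[0, b_N]] up to time [n]: the branch [psi j] takes time [j + 1], and the truncated
   subtraction [n - j] is right because no constraint is left once the time is used up. *)
Definition survival n V := surv_rec n n V.
Local Notation surv := survival.

Lemma surv_rec_fuel k m n V : (n <= k)%N -> (n <= m)%N -> surv_rec k n V = surv_rec m n V.
Proof.
elim: k m n V => [|k IH] [|m] [|n] V //= nk nm.
by apply: eq_bigr => j _; apply: IH; apply: leq_trans (leq_subr _ _) _.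
Qed.

Lemma surv0 V : surv 0 V = mass V. Proof. by []. Qed.

Lemma survS n V : surv n.+1 V = \sum_(j < N) surv (n - j) (V \o psi j).
Proof. by apply: eq_bigr => j _; apply: surv_rec_fuel; rewrite ?leq_subr. Qed.

Lemma surv_lin n a b V W :
  surv n (fun x => a * V x + b * W x) = a * surv n V + b * surv n W.
Proof.
elim/ltn_ind: n V W => -[|n] IH V W; first by rewrite !surv0 /mass; ring.
rewrite !survS !mulr_sumr -big_split /=; apply: eq_bigr => j _.
by rewrite -IH // ltnS leq_subr.
Qed.

Lemma surv_add n V W : surv n (fun x => V x + W x) = surv n V + surv n W.
Proof.
have := surv_lin n 1 1 V W; rewrite !mul1r => <-; congr surv.
by apply/funext => x; rewrite !mul1r.
Qed.

Lemma surv_scale n a V : surv n (fun x => a * V x) = a * surv n V.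
Proof.
have := surv_lin n a 0 V V; rewrite mul0r addr0 => <-; congr surv.
by apply/funext => x; rewrite mul0r addr0.
Qed.

Lemma surv_const n a : surv n (fun=> a) = 0.
Proof.
elim/ltn_ind: n => -[|n] IH; first by rewrite surv0 /mass subrr.
by rewrite survS big1 // => j _; apply: IH; rewrite ltnS leq_subr.
Qed.

(** Transfer operator of the first-return map cut down to its first [J] branches, read on
    distribution functions: [V \o psi j] is, up to a constant, that of the image of the part of the
    measure carried by branch [j]. *)
Definition pullback (J : nat) V x := \sum_(j < J) V (psi j x).
Local Notation pull := pullback.

Lemma surv_pull n J V : surv n (pull J V) = \sum_(j < J) surv n (V \o psi j).
Proof.
elim: J => [|J IH].
  rewrite big_ord0 -[RHS](surv_const n 0); congr surv; apply/funext => x.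
  by rewrite /pull big_ord0.
rewrite big_ord_recr /= -IH -surv_add; congr surv; apply/funext => x.
by rewrite /pull big_ord_recr.
Qed.

Lemma pull_lin J a b V W : pull J (fun x => a * V x + b * W x) =
  (fun x => a * pull J V x + b * pull J W x).
Proof.
by apply/funext => x; rewrite /pull !mulr_sumr -big_split.
Qed.

End Survival.

(* [psi j] are the inverse branches of the first-return map to [[c, 1]], numbered from right to left. *)
Record full_branches (R : realType) (c : R) (psi : nat -> R -> R) (kappa D : R) : Prop := {
  fb_c_ge0 : 0 <= c;
  fb_c_lt1 : c < 1;
  fb_lt : forall j x y, c <= x -> x < y -> y <= 1 -> psi j x < psi j y;
  fb_range : forall j x, c <= x <= 1 -> c <= psi j x <= 1;
  fb_tile : forall j, psi j c = psi j.+1 1;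
  fb_first : psi 0%N 1 = 1;
  fb_shrink : forall eps, 0 < eps -> exists J, forall j, (J <= j)%N -> psi j 1 - c < eps;
  fb_kappa_ge0 : 0 <= kappa;
  fb_kappa_lt1 : kappa < 1;
  fb_contr : forall j x y, c <= x -> x <= y -> y <= 1 -> psi j y - psi j x <= kappa * (y - x);
  fb_D_ge0 : 0 <= D;
  fb_reg : forall j, regular_on c 1 D (psi j) }.

(** * Coupling of regular measures, uniformly in [N] *)

Section Coupling.
Variables (R : realType) (c : R) (psi : nat -> R -> R).
Implicit Types (V W : R -> R).
Local Notation mass := (mass_on c).
Local Notation incr := (increasing_on c).
Local Notation reg := (regular_on c).
Local Notation surv := (survival c psi).
Local Notation pull := (pullback psi).

Variables (kappa D : R).
Hypothesis fb : full_branches c psi kappa D.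
Let c_ge0 := fb_c_ge0 fb.
Let c_lt1 := fb_c_lt1 fb.
Let psi_lt := fb_lt fb.
Let psi_range := fb_range fb.
Let psi_tile := fb_tile fb.
Let psi01 := fb_first fb.
Let psi_shrink := fb_shrink fb.
Let kappa_ge0 := fb_kappa_ge0 fb.
Let kappa_lt1 := fb_kappa_lt1 fb.
Let psi_contr := fb_contr fb.
Let D_ge0 := fb_D_ge0 fb.
Let psi_reg := fb_reg fb.

Lemma psi_le j x y : c <= x -> x <= y -> y <= 1 -> psi j x <= psi j y.
Proof.
move=> cx; rewrite le_eqVlt => /orP[/eqP ->//|xy] y1.
by apply: ltW; exact: psi_lt.
Qed.

Lemma incr_comp j V : incr V -> incr (V \o psi j).
Proof.
move=> iV x y cx xy y1 /=.
have /andP[a _] : c <= psi j x <= 1 by apply: psi_range; rewrite cx (le_trans xy).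
have /andP[_ b] : c <= psi j y <= 1 by apply: psi_range; rewrite y1 (le_trans cx).
by apply: iV => //; exact: psi_le.
Qed.

Lemma incr_pull J V : incr V -> incr (pull J V).
Proof.
move=> iV x y cx xy y1; apply: ler_sum => j _; exact: (incr_comp _ iV).
Qed.

Lemma mass_pull J V : mass (pull J V) = V 1 - V (psi J 1).
Proof.
rewrite /mass /pull; elim: J => [|J IH]; first by rewrite !big_ord0 psi01 !subrr.
by rewrite !big_ord_recr /= psi_tile; lra.
Qed.

Lemma mass_comp_sum N V : \sum_(j < N) mass (V \o psi j) = mass (pull N V).
Proof. by rewrite /mass /pull sumrB. Qed.

Lemma psi1_ge J : c <= psi J 1.
Proof. by have /andP[] := @psi_range J 1 (introT andP (conj (ltW c_lt1) (lexx 1))). Qed.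

Lemma psi1_le J : psi J 1 <= 1.
Proof. by have /andP[] := @psi_range J 1 (introT andP (conj (ltW c_lt1) (lexx 1))). Qed.

Lemma mass_pull_le J V : incr V -> mass (pull J V) <= mass V.
Proof. by move=> iV; rewrite mass_pull lerD2l lerN2 iV // ?psi1_ge ?psi1_le. Qed.

Lemma surv_ge0 N n V : incr V -> 0 <= surv N n V.
Proof.
elim/ltn_ind: n V => -[|n] IH V iV; first by rewrite surv0 mass_ge0.
rewrite survS sumr_ge0 // => j _; apply: IH; last exact: incr_comp.
by rewrite ltnS leq_subr.
Qed.

Lemma surv_le N n V W : incr (fun x => W x - V x) -> surv N n V <= surv N n W.
Proof.
move=> iWV; rewrite -subr_ge0.
have -> : surv N n W - surv N n V = surv N n (fun x => W x - V x).
  transitivity (1 * surv N n W + (-1) * surv N n V); first by ring.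
  by rewrite -surv_lin; congr survival; apply/funext => x; ring.
exact: surv_ge0.
Qed.

Lemma surv_leS N n V : incr V -> surv N n.+1 V <= surv N n V.
Proof.
elim/ltn_ind: n V => -[|n] IH V iV.
  rewrite survS surv0 (le_trans _ (mass_pull_le N iV)) // -mass_comp_sum.
  by apply: ler_sum => j _; rewrite sub0n.
rewrite !survS; apply: ler_sum => j _.
have [jn|nj] := leqP j n.
  by rewrite subSn //; apply: IH; [rewrite ltnS leq_subr|exact: incr_comp].
have -> : (n.+1 - j = 0)%N by apply/eqP; rewrite subn_eq0.
by have -> : (n - j = 0)%N by apply/eqP; rewrite subn_eq0 ltnW.
Qed.

Lemma surv_anti N m n V : incr V -> (m <= n)%N -> surv N n V <= surv N m V.
Proof.
move=> iV /subnK <-; elim: (n - m)%N => [|k IH] //.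
by rewrite addSn; apply: le_trans IH; exact: surv_leS.
Qed.

(** The left-hand side forgets the time spent in the first excursion and asks for [n] further steps
    of avoidance, which can only be harder. *)
Lemma surv_pull_le N n V : incr V -> surv N n (pull N V) <= surv N n V.
Proof.
case: n => [|n] iV; first by rewrite !surv0 mass_pull_le.
rewrite [leRHS]survS surv_pull; apply: ler_sum => j _.
by apply: surv_anti; [exact: incr_comp|rewrite (leq_trans (leq_subr _ _))].
Qed.

Lemma surv_le_mass N n V : incr V -> surv N n V <= mass V.
Proof. by move=> iV; rewrite -(surv0 c psi N); exact: surv_anti. Qed.

(** The first [J] branches use up at most [J] units of time, so at least [n] remain; the mass of all
    later branches sits in [[c, psi J 1]] and is counted as surviving. *)
Lemma surv_addn_le N J n V : incr V -> (0 < J <= N)%N ->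
  surv N (n + J) V <= surv N n (pull J V) + (V (psi J 1) - V c).
Proof.
move=> iV /andP[J0 JN].
rewrite -(prednK J0) addnS survS surv_pull (prednK J0).
rewrite -(subnKC JN) big_split_ord /=; apply: lerD.
  apply: ler_sum => j _; apply: surv_anti; first exact: incr_comp.
  by have := ltn_ord j; lia.
apply: (@le_trans _ _ (\sum_(i < N - J) mass (V \o psi (J + i)))).
  by apply: ler_sum => j _; apply: surv_le_mass; exact: incr_comp.
have -> : \sum_(i < N - J) mass (V \o psi (J + i)) = V (psi J 1) - V (psi (J + (N - J))%N 1).
  elim: (N - J)%N => [|k IH]; first by rewrite big_ord0 addn0 subrr.
  by rewrite big_ord_recr /= IH /mass /= psi_tile addnS; lra.
by rewrite lerD2l lerN2 iV // ?psi1_ge ?psi1_le.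
Qed.

(** Distortion of the branch contributes [D], and its contraction multiplies the old exponent by
    [kappa]. The slack [q] is not multiplied, so it stays the same through arbitrarily many
    pull-backs. *)
Lemma reg_comp q K j V : 0 <= q -> 0 <= K -> incr V -> reg q K V ->
  reg q (kappa * K + D) (V \o psi j).
Proof.
move=> q0 K0 iV rV p r x1 x2 y1 y2 cp px1 x12 x2r py1 y12 y2r r1 /=.
have cx1 := le_trans cp px1; have cy1 := le_trans cp py1.
have x21 := le_trans x2r r1; have y21 := le_trans y2r r1.
have pr : p <= r by rewrite (le_trans px1)// (le_trans x12).
move: (y12); rewrite le_eqVlt => /orP[/eqP y12e|y12s].
  by rewrite y12e !subrr !(mulr0, mul0r).
have h := psi_reg j cp px1 x12 x2r py1 y12 y2r r1; rewrite mul1r in h.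
have /andP[h1 _] : c <= psi j p <= 1 by apply: psi_range; rewrite cp (le_trans pr).
have /andP[_ h2] : c <= psi j r <= 1 by apply: psi_range; rewrite r1 (le_trans cp).
have hV := rV _ _ _ _ _ _ h1 (psi_le j cp px1 (le_trans x12 x21))
  (psi_le j cx1 x12 x21) (psi_le j (le_trans cx1 x12) x2r r1)
  (psi_le j cp py1 (le_trans y12 y21))
  (psi_le j cy1 y12 y21) (psi_le j (le_trans cy1 y12) y2r r1) h2.
have Y : 0 < psi j y2 - psi j y1 by rewrite subr_gt0; exact: psi_lt.
have X : 0 <= psi j x2 - psi j x1 by rewrite subr_ge0; exact: psi_le.
have VY : 0 <= V (psi j y2) - V (psi j y1) by rewrite subr_ge0; exact: (incr_comp _ iV).
have VX : 0 <= V (psi j x2) - V (psi j x1) by rewrite subr_ge0; exact: (incr_comp _ iV).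
have e1 : expR (K * (psi j r - psi j p)) <= expR (kappa * K * (r - p)).
  rewrite ler_expR -mulrA mulrCA ler_wpM2l //; exact: psi_contr.
have e3 : 0 <= expR (D * (r - p)) by exact: expR_ge0.
have e2 : 0 <= expR (kappa * K * (r - p)) by exact: expR_ge0.
have -> : expR ((kappa * K + D) * (r - p)) = expR (kappa * K * (r - p)) * expR (D * (r - p)).
  by rewrite -expRD; congr expR; ring.
have L0 : 0 <= x2 - x1 by rewrite subr_ge0.
have M0 : 0 <= y2 - y1 by rewrite subr_ge0.
rewrite -(ler_pM2r Y).
move: hV h e1 e2 e3 Y X VY VX L0 M0.
move: (V (psi j y2) - _) (V (psi j x2) - _) (psi j y2 - _) (psi j x2 - _) (x2 - _) (y2 - _).
move: (expR (K * _)) (expR (kappa * _ * _)) (expR (D * _)).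
move=> E E1 E2 B A Y X L M hV h e1 E10 e3 Y0 X0 B0 A0 L0 M0.
have s1 : A * Y * M <= q * E * (B * X) * M by rewrite ler_wpM2r.
have s2 : q * E * (B * X) * M <= q * E1 * (B * X) * M.
  by do 2 (apply: ler_wpM2r; rewrite ?mulr_ge0 //); rewrite ler_wpM2l.
have s3 : q * E1 * B * (X * M) <= q * E1 * B * (E2 * (Y * L)).
  by rewrite ler_wpM2l // !mulr_ge0.
lra.
Qed.

Lemma incr_pull_sub J N V : (J <= N)%N -> incr V -> incr (fun x => pull N V x - pull J V x).
Proof.
move=> JN iV; move: (N - J)%N (subnKC JN) => k <-.
have -> : (fun x => pull (J + k) V x - pull J V x) = (fun x => \sum_(i < k) V (psi (J + i)%N x)).
  by apply/funext => x; rewrite /pull big_split_ord /= addrAC subrr add0r.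
by move=> x y cx xy y1; apply: ler_sum => j _; exact: (incr_comp _ iV).
Qed.

Lemma reg_pull q K J V : 0 <= q -> 0 <= K -> incr V -> reg q K V ->
  reg q (kappa * K + D) (pull J V).
Proof.
move=> q0 K0 iV rV; elim: J => [|J IH].
  by move=> *; rewrite /pull !big_ord0 !subrr !(mul0r, mulr0).
have -> : pull J.+1 V = (fun x => pull J V x + (V \o psi J) x).
  by apply/funext => x; rewrite /pull big_ord_recr.
by apply: reg_add => //; exact: reg_comp.
Qed.

(* A fixed point of the coupling step: splitting raises the constant to [Kreg + 1], and pulling back
   lowers it to [kappa * (Kreg + 1) + D <= Kreg]. *)
Definition Kreg : R := (kappa + D) / (1 - kappa) + 1.

Lemma Kreg_ge1 : 1 <= Kreg.
Proof.
rewrite /Kreg lerDr; apply: divr_ge0; first exact: addr_ge0.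
by rewrite subr_ge0 ltW.
Qed.

(** A pull-back shrinks the excess over [Kreg] by the factor [kappa]. The additional [- kappa] makes
    an excess of [1], the price of one splitting, vanish entirely. *)
Lemma Kreg_contr K : 0 <= K -> kappa * (Kreg + K) + D <= Kreg + kappa * K - kappa.
Proof.
move=> K0; rewrite /Kreg; set t := _ / (1 - kappa).
have : t * (1 - kappa) = kappa + D by rewrite /t divfK // subr_eq0 gt_eqF.
have := kappa_lt1; lra.
Qed.

Lemma Kreg_ge0 : 0 <= Kreg. Proof. exact: le_trans Kreg_ge1. Qed.

(** Bound, by regularity, for the fraction of a measure lying in [[c, psi J 1]], that is, outside
    the first [J] branches. *)
Definition loss J : R := expR Kreg * (psi J 1 - c) / (1 - c).

Lemma loss_ge0 J : 0 <= loss J.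
Proof. by rewrite /loss !mulr_ge0 ?expR_ge0 ?invr_ge0 ?subr_ge0 ?psi1_ge // ltW. Qed.

Lemma mass_loss J V : incr V -> reg 1 Kreg V -> V (psi J 1) - V c <= loss J * mass V.
Proof.
move=> iV rV; have c1 : 0 < 1 - c by rewrite subr_gt0.
have h := reg_le_mass c_ge0 c_lt1 Kreg_ge0 iV rV (lexx c) (psi1_ge J) (psi1_le J).
rewrite -(ler_pM2r c1); apply: (le_trans h).
by rewrite /loss le_eqVlt; apply/orP; left; apply/eqP; field; lra.
Qed.

Local Notation al := (split_rate Kreg).
Local Notation rem := (split_rem c Kreg).

Lemma reg_pull_rem J V : incr V -> reg 1 Kreg V -> reg 1 Kreg (pull J (rem V)).
Proof.
move=> iV rV; apply: (@reg_le _ _ 1 1 (kappa * (Kreg + 1) + D)) => //.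
- have := @Kreg_contr 1 ler01; lra.
- by apply: incr_pull; apply: incr_split_rem => //; exact: Kreg_ge0.
apply: reg_pull => //.
- by have := Kreg_ge1; lra.
- by apply: incr_split_rem => //; exact: Kreg_ge0.
by apply: reg_split_rem => //; exact: Kreg_ge0.
Qed.

Lemma pull_split J V : pull J V =
  (fun x => al / (1 - c) * mass V * pull J id x + pull J (rem V) x).
Proof.
have {1}-> : V = (fun x => (al / (1 - c) * mass V) * id x + 1 * rem V x).
  by apply/funext => x; rewrite /split_rem /=; ring.
by rewrite pull_lin; apply/funext => x; rewrite mul1r.
Qed.

Lemma mass_rem V : mass (rem V) = (1 - al) * mass V.
Proof. exact: mass_split_rem. Qed.

(* The reference survival probability with which all regular measures are compared. *)
Definition wref N n : R := surv N n (pull N id) / (1 - c).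

Lemma surv_id N n : surv N n (pull N id) = (1 - c) * wref N n.
Proof. by rewrite /wref mulrCA divff ?mulr1 // subr_eq0 gt_eqF. Qed.

Lemma wref_ge0 N n : 0 <= wref N n.
Proof.
by rewrite divr_ge0 ?surv_ge0 // ?subr_ge0 ?(ltW c_lt1) //; exact: incr_pull.
Qed.

Lemma wref_le1 N n : wref N n <= 1.
Proof.
rewrite ler_pdivrMr ?subr_gt0 // mul1r.
apply: le_trans (surv_le_mass _ _ _) _; first exact: incr_pull.
exact: mass_pull_le.
Qed.

(** Each round splits off the fraction [al] as Lebesgue measure, whose pull-back survives as [wref]
    says, and applies induction to the pulled-back rest; after [m] rounds only [(1 - al) ^+ m] is
    uncoupled. There is no time shift, since a lower bound may discard the time of the excursions,
    and a round loses at most [loss N]. *)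
Lemma surv_lower N n m V : incr V -> reg 1 Kreg V ->
  mass V * (wref N n * (1 - (1 - al) ^+ m) - m%:R * loss N) <= surv N n V.
Proof.
have al0 : 0 < al by exact: split_rate_gt0 Kreg_ge0.
have al1 : al < 1 by exact: split_rate_lt1 Kreg_ge0.
have c1 : 0 < 1 - c by rewrite subr_gt0.
elim: m V => [|m IH] V iV rV.
  by rewrite expr0 subrr mulr0 mul0r subr0 mulr0 surv_ge0.
apply: le_trans (surv_pull_le _ _ iV).
have iR : incr (rem V) by apply: incr_split_rem => //; exact: Kreg_ge0.
have iPR : incr (pull N (rem V)) by exact: incr_pull.
have := IH _ iPR (reg_pull_rem N iV rV).
have sPR := surv_ge0 N n iPR.
rewrite [X in _ -> _ <= survival _ _ _ _ X]pull_split surv_add surv_scale surv_id.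
have mV := mass_ge0 c_lt1 iV.
have mR1 : mass (pull N (rem V)) <= (1 - al) * mass V by rewrite -mass_rem; exact: mass_pull_le.
have mR2 : (1 - al) * mass V - loss N * mass V <= mass (pull N (rem V)).
  rewrite mass_pull -mass_rem /mass_on.
  have := mass_loss N iV rV.
  suff : rem V (psi N 1) - rem V c <= V (psi N 1) - V c by rewrite /mass_on; lra.
  rewrite /split_rem.
  suff : 0 <= split_rate Kreg / (1 - c) * mass V * (psi N 1 - c) by lra.
  apply: mulr_ge0; last by rewrite subr_ge0 psi1_ge.
  by apply: mulr_ge0 => //; rewrite divr_ge0 // ltW.
have w0 := wref_ge0 N n; have w1 := wref_le1 N n.
have l0 := loss_ge0 N.
have p0 : 0 <= (1 - al) ^+ m by rewrite exprn_ge0 //; lra.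
have -> : al / (1 - c) * mass V * ((1 - c) * wref N n) = al * mass V * wref N n by field; lra.
rewrite exprS -natr1.
set x := wref N n * (1 - (1 - al) ^+ m) - m%:R * loss N.
have x1 : x <= 1.
  have : 0 <= m%:R * loss N by rewrite mulr_ge0.
  by rewrite /x; nra.
have hle : mass V * (wref N n * (1 - (1 - al) * (1 - al) ^+ m) - (m%:R + 1) * loss N) <=
  al * mass V * wref N n + ((1 - al) * mass V * x - loss N * mass V).
  have : 0 <= mass V * al * (m%:R * loss N) by do 2 (apply: mulr_ge0 => //); rewrite ?ltW ?mulr_ge0.
  by rewrite /x; lra.
move=> h; apply: (le_trans hle); rewrite lerD2l; apply: le_trans h.
move: (mass (pull N (rem V))) mR1 mR2 => Mr mR1 mR2.
have lm : 0 <= loss N * mass V by rewrite mulr_ge0.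
(* The sign of [x] decides which bound on the remaining mass applies: [mR2] if it is nonnegative,
   [mR1] if it is negative. *)
have [x0|x0] := leP 0 x; nra.
Qed.

(** In this direction time must be paid for, so a round uses only the first [J] branches and costs
    at most [J] steps. Keeping [J] independent of [N] keeps the total shift [m * J] bounded as [N]
    grows. *)
Lemma surv_upper N J n m V : (0 < J <= N)%N -> incr V -> reg 1 Kreg V ->
  surv N (n + m * J) V <= mass V * (wref N n + (1 - al) ^+ m + m%:R * loss J).
Proof.
move=> JN.
have al0 : 0 < al by exact: split_rate_gt0 Kreg_ge0.
have al1 : al < 1 by exact: split_rate_lt1 Kreg_ge0.
have c1 : 0 < 1 - c by rewrite subr_gt0.
elim: m V => [|m IH] V iV rV.
  rewrite mul0n addn0 expr0 mul0r addr0; apply: le_trans (surv_le_mass _ _ iV) _.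
  have := mass_ge0 c_lt1 iV; have := wref_ge0 N n; nra.
have -> : (n + m.+1 * J = (n + m * J) + J)%N by lia.
apply: le_trans (surv_addn_le _ iV JN) _.
have iR : incr (rem V) by apply: incr_split_rem => //; exact: Kreg_ge0.
have iPR : incr (pull J (rem V)) by exact: incr_pull.
have := IH _ iPR (reg_pull_rem J iV rV).
rewrite [X in _ -> survival _ _ _ _ X + _ <= _]pull_split surv_add surv_scale.
have ub : surv N (n + m * J) (pull J id) <= (1 - c) * wref N n.
  rewrite -surv_id; apply: (@le_trans _ _ (surv N (n + m * J) (pull N id))).
    by apply: surv_le; apply: incr_pull_sub => //; case/andP: JN.
  by apply: surv_anti; [exact: incr_pull|exact: leq_addr].
have mV := mass_ge0 c_lt1 iV.
have mR1 : mass (pull J (rem V)) <= (1 - al) * mass V by rewrite -mass_rem; exact: mass_pull_le.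
have ml := mass_loss J iV rV.
have w0 := wref_ge0 N n; have w1 := wref_le1 N n.
have l0 := loss_ge0 J.
have p0 : 0 <= (1 - al) ^+ m by rewrite exprn_ge0 //; lra.
have {}ub : al / (1 - c) * mass V * surv N (n + m * J) (pull J id) <= al * mass V * wref N n.
  have -> : al * mass V * wref N n = al / (1 - c) * mass V * ((1 - c) * wref N n) by field; lra.
  by apply: ler_wpM2l ub; apply: mulr_ge0 => //; apply: divr_ge0; exact: ltW.
rewrite exprS -natr1.
set x := wref N n + _ + _ => h.
have x0 : 0 <= x by rewrite /x !addr_ge0 // mulr_ge0.
have : mass (pull J (rem V)) * x <= (1 - al) * mass V * x by rewrite ler_wpM2r.
have a0 : 0 <= mass V * al * (m%:R * loss J).
  by do 2 (apply: mulr_ge0 => //); rewrite ?ltW ?mulr_ge0.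
rewrite {2}/x; move: h; lra.
Qed.

Lemma loss_cvg eps : 0 < eps -> exists2 J, (0 < J)%N & forall j, (J <= j)%N -> loss j <= eps.
Proof.
move=> e0; have c1 : 0 < 1 - c by rewrite subr_gt0.
have [|J HJ] := psi_shrink (_ : 0 < eps * (1 - c) / expR Kreg).
  by rewrite divr_gt0 ?expR_gt0 ?mulr_gt0.
exists J.+1 => // j Jj; have /ltW := HJ _ (ltnW Jj).
rewrite ler_pdivlMr ?expR_gt0 // => h.
by rewrite /loss ler_pdivrMr // mulrC.
Qed.

(** The number of rounds [m] is chosen first, from [al] alone, then [J] so that [m] losses stay
    small; the shift [m * J] is thereby fixed before [N]. *)
Theorem surv_equidistribution (eta : R) : 0 < eta ->
  exists M N0, forall N, (N0 <= N)%N -> forall n V, incr V -> reg 1 Kreg V ->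
    mass V * (wref N n - eta) <= surv N n V /\ surv N (n + M) V <= mass V * (wref N n + eta).
Proof.
move=> e0.
have al0 : 0 < al by exact: split_rate_gt0 Kreg_ge0.
have al1 : al < 1 by exact: split_rate_lt1 Kreg_ge0.
have [m Hm] : exists m, (1 - al) ^+ m <= eta / 2.
  have : (1 - al) ^+ n @[n --> \oo] --> 0.
    by apply: cvg_expr; rewrite ger0_norm; lra.
  move/cvgrPdist_le => /(_ (eta / 2)); case; first by lra.
  move=> k _ /(_ k (leqnn k)) /=; rewrite sub0r normrN => h.
  by exists k; apply: le_trans h; exact: ler_norm.
have [|J J0 HJ] := @loss_cvg (eta / 2 / m.+1%:R).
  by rewrite !divr_gt0.
have HJ' j : (J <= j)%N -> m%:R * loss j <= eta / 2.
  move=> /HJ; rewrite ler_pdivlMr ?ltr0n // mulrC => h; apply: le_trans h.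
  by rewrite ler_wpM2r ?loss_ge0 // ler_nat.
exists (m * J)%N, J => N JN n V iV rV; split.
  apply: le_trans (surv_lower N n m iV rV).
  apply: ler_wpM2l; first exact: mass_ge0.
  have := HJ' _ JN; have := wref_ge0 N n; have := wref_le1 N n.
  have : 0 <= (1 - al) ^+ m by rewrite exprn_ge0 //; lra.
  nra.
apply: le_trans (surv_upper n m (introT andP (conj J0 JN)) iV rV) _.
apply: ler_wpM2l; first exact: mass_ge0.
by have := HJ' _ (leqnn J); lra.
Qed.

End Coupling.

(** * Regularity of the invariant density *)

Section InvariantRegular.
Variables (R : realType) (c : R) (psi : nat -> R -> R).
Implicit Types (V W : R -> R).
Local Notation mass := (mass_on c).
Local Notation incr := (increasing_on c).
Local Notation reg := (regular_on c).
Local Notation pull := (pullback psi).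
Variables (kappa D : R).
Hypothesis fb : full_branches c psi kappa D.
Let c_ge0 := fb_c_ge0 fb.
Let c_lt1 := fb_c_lt1 fb.
Let psi_lt := fb_lt fb.
Let psi_range := fb_range fb.
Let psi_tile := fb_tile fb.
Let psi01 := fb_first fb.
Let psi_shrink := fb_shrink fb.
Let kappa_ge0 := fb_kappa_ge0 fb.
Let kappa_lt1 := fb_kappa_lt1 fb.
Let psi_contr := fb_contr fb.
Let D_ge0 := fb_D_ge0 fb.
Let psi_reg := fb_reg fb.

Lemma iter_pull_lin m J a b V W : iter m (pull J) (fun x => a * V x + b * W x) =
  (fun x => a * iter m (pull J) V x + b * iter m (pull J) W x).
Proof. by elim: m => [|m IH] //=; rewrite IH pull_lin. Qed.

Lemma incr_iter_pull m J V : incr V -> incr (iter m (pull J) V).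
Proof. by move=> iV; elim: m => [|m IH] //=; exact: (incr_pull fb). Qed.

Lemma mass_iter_pull_le m J V : incr V -> mass (iter m (pull J) V) <= mass V.
Proof.
move=> iV; elim: m => [|m IH] //=; apply: le_trans IH.
by apply: (mass_pull_le fb) => //; exact: incr_iter_pull.
Qed.

Lemma incr_increment V x y : incr V -> c <= x -> x <= y -> y <= 1 ->
  0 <= V y - V x <= mass V.
Proof.
move=> iV cx xy y1; rewrite subr_ge0 iV //=.
have := iV _ _ (lexx c) cx (le_trans xy y1); have := iV _ _ (le_trans cx xy) y1 (lexx 1).
rewrite /mass_on; lra.
Qed.

Local Notation Kreg := (Kreg kappa D).

Lemma reg_iter_pull q Z m J V : 0 <= q -> 0 <= Z -> incr V -> reg q (Kreg + Z) V ->
  reg q (Kreg + kappa ^+ m * Z) (iter m (pull J) V).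
Proof.
move=> q0 Z0 iV rV; elim: m => [|m IH]; first by rewrite expr0 mul1r.
have z0 : 0 <= kappa ^+ m * Z by rewrite mulr_ge0 // exprn_ge0.
have k0 : 0 <= Kreg := Kreg_ge0 fb.
have iI := incr_iter_pull m J iV.
apply: (@reg_le _ _ q q (kappa * (Kreg + kappa ^+ m * Z) + D)) => //=.
- have := Kreg_contr fb z0; rewrite exprS; have := kappa_ge0; lra.
- exact: (incr_pull fb).
by apply: (reg_pull fb) => //; rewrite addr_ge0.
Qed.

(** The number [m] of pull-backs depends on [Z] but not on the number [J] of branches, so [J] can be
    chosen afterwards to make the mass lost in [m] truncated pull-backs negligible. *)
Lemma reg_iter_pull_Kreg q Z V : 0 <= q -> 0 <= Z -> incr V -> reg q Z V ->
  exists m, forall J, reg q Kreg (iter m (pull J) V).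
Proof.
move=> q0 Z0 iV rV.
have k0 : 0 <= Kreg := Kreg_ge0 fb.
have [m Hm] : exists m, kappa ^+ m * Z <= 1.
  have : kappa ^+ n * Z @[n --> \oo] --> 0 * Z.
    by apply: cvgM; [apply: cvg_expr; rewrite ger0_norm|exact: cvg_cst].
  rewrite mul0r => /cvgrPdist_le => /(_ 1 ltr01) [k _] /(_ k (leqnn k)) /=.
  rewrite sub0r normrN => h.
  by exists k; apply: le_trans h; exact: ler_norm.
exists m.+1 => J.
have rV' : reg q (Kreg + Z) V by apply: (reg_le q0 (lexx q) _ iV rV); rewrite lerDr.
have h := reg_iter_pull m J q0 Z0 iV rV'.
have iI := incr_iter_pull m J iV.
have h1 : reg q (Kreg + 1) (iter m (pull J) V).
  by apply: (reg_le q0 (lexx q) _ iI h); rewrite lerD2l.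
apply: (@reg_le _ _ q q (kappa * (Kreg + 1) + D)) => //=.
- by have := Kreg_contr fb ler01; lra.
- exact: (incr_pull fb).
by apply: (reg_pull fb) => //; rewrite addr_ge0.
Qed.

Variables (H h : R -> R).
Hypothesis incrH : incr H.
Hypothesis H_inv : forall J, incr (fun x => H x - pull J H x).
Hypothesis H_c : forall eps : R, 0 < eps -> exists J, H (psi J 1) - H c <= eps.
Hypothesis H_1 : forall eps : R, 0 < eps -> exists b, c < b < 1 /\ H 1 - H b <= eps.
Hypothesis h_ge0 : forall x, c <= x -> x < 1 -> 0 <= h x.
Hypothesis H_ub : forall x y M, c <= x -> x <= y -> y <= 1 ->
  (forall z, x <= z -> z <= y -> h z <= M) -> H y - H x <= M * (y - x).
Hypothesis H_lb : forall x y M, c <= x -> x <= y -> y <= 1 ->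
  (forall z, x <= z -> z <= y -> M <= h z) -> M * (y - x) <= H y - H x.
(** Uniform continuity on [[c, b]], written as a Lipschitz bound up to [eta]: in this form it
    becomes regularity with slack once the density is bounded below. *)
Hypothesis h_mod : forall b eta, b < 1 -> 0 < eta -> exists2 K, 0 <= K &
  forall x y, c <= x <= b -> c <= y <= b -> h x <= h y + eta + K * `|x - y|.

(** Each pull-back drops the mass of [[c, psi J 1]], and later ones do not increase what was
    dropped. Since the difference is increasing, the bound on its mass bounds every increment. *)
Lemma iter_pull_defect m J : incr (fun x => H x - iter m (pull J) H x) /\
  mass (fun x => H x - iter m (pull J) H x) <= m%:R * (H (psi J 1) - H c).
Proof.
elim: m => [|m [IH1 IH2]].
  by split; [move=> x y; rewrite !subrr|rewrite /mass_on mul0r !subrr].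
have E : (fun x => H x - iter m.+1 (pull J) H x) =
   (fun x => (H x - pull J H x) + pull J (fun x => H x - iter m (pull J) H x) x).
  apply/funext => x /=.
  have := congr1 (fun f => f x) (pull_lin psi J 1 (-1) H (iter m (pull J) H)).
  rewrite /= mul1r => E.
  have -> : pull J (fun x0 => H x0 - iter m (pull J) H x0) x =
     pull J (fun x => 1 * H x + -1 * iter m (pull J) H x) x.
    by congr (pullback _ _ _ x); apply/funext => y; ring.
  rewrite E; ring.
rewrite E; split.
  by apply: incr_add; [exact: H_inv|exact: (incr_pull fb)].
have := mass_pull_le fb J IH1.
have := mass_pull fb J H.
rewrite /mass_on -natr1; move: IH2; rewrite /mass_on; lra.
Qed.

(** On the left half [[b0, b1]] of [[b0, 1]] the density cannot exceed [2 * e / (b1 - b0)]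
    everywhere, and [1 - b] is at most twice the length of that half. Continuing the density beyond
    [b] by the constant [h b] thus adds little mass. *)
Lemma flat_point e : 0 < e -> exists b, [/\ c < b < 1, H 1 - H b <= e & h b * (1 - b) <= 4 * e].
Proof.
move=> e0; have [b0 [/andP[cb0 b01] Hb0]] := H_1 e0.
set b1 := (b0 + 1) / 2.
have [b [bb0 bb1 hb]] : exists b, [/\ b0 <= b, b <= b1 & h b * (b1 - b0) <= 2 * e].
  apply: contrapT => Hn.
  have lb : forall z, b0 <= z -> z <= b1 -> 2 * e / (b1 - b0) <= h z.
    move=> z z0 z1; rewrite ler_pdivrMr; last by rewrite /b1; lra.
    by apply/ltW; rewrite ltNge; apply/negP => hz; apply: Hn; exists z.
  have b1b0 : b0 < b1 by rewrite /b1; lra.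
  have b11 : b1 <= 1 by rewrite /b1; lra.
  have := H_lb (ltW cb0) (ltW b1b0) b11 lb.
  rewrite divfK; last by rewrite subr_eq0 gt_eqF.
  have := incrH (le_trans (ltW cb0) (ltW b1b0)) b11 (lexx 1).
  lra.
exists b; split; first by apply/andP; split; rewrite /b1 in bb1; lra.
  have := incrH (ltW cb0) bb0 (_ : b <= 1); rewrite /b1 in bb1; move=> /(_ ltac:(lra)); lra.
have := h_ge0 (_ : c <= b) (_ : b < 1); rewrite /b1 in bb1 hb; move=> /(_ ltac:(lra) ltac:(lra)).
nra.
Qed.

(* The density is frozen beyond [b] because it is not known to be bounded near [1]. *)
Lemma regular_approx a : 0 < a < 1 -> exists U : R -> R, reg (expR a) Kreg U /\
  forall x y, c <= x -> x <= y -> y <= 1 ->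
    H y - H x - 2 * a <= U y - U x <= H y - H x + 5 * a.
Proof.
move=> /andP[a0 a1].
have [b [/andP[cb b1] Hb hb]] := flat_point a0.
pose Ht x := if x <= b then H x else H b + h b * (x - b).
pose ht x := if x <= b then h x else h b.
pose A x := if x <= b then 0 else h b * (x - b).
pose B x := if x <= b then 0 else H x - H b.
have hb0 : 0 <= h b by apply: h_ge0 => //; exact: ltW.
have ub x y M : c <= x -> x <= y -> y <= 1 ->
    (forall z, x <= z -> z <= y -> ht z <= M) -> Ht y - Ht x <= M * (y - x).
  move=> cx xy y1 hM; rewrite /Ht; case: (leP y b) => yb.
    rewrite (le_trans xy yb); apply: H_ub => // z xz zy.
    by have := hM z xz zy; rewrite /ht (le_trans zy yb).
  have My : h b <= M by have := hM y xy (lexx y); rewrite /ht (lt_geF yb).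
  case: (leP x b) => xb; last by nra.
  have : H b - H x <= M * (b - x).
    apply: H_ub => //; first exact: ltW.
    by move=> z xz zb; have := hM z xz (le_trans zb (ltW yb)); rewrite /ht zb.
  nra.
have lb x y M : c <= x -> x <= y -> y <= 1 ->
    (forall z, x <= z -> z <= y -> M <= ht z) -> M * (y - x) <= Ht y - Ht x.
  move=> cx xy y1 hM; rewrite /Ht; case: (leP y b) => yb.
    rewrite (le_trans xy yb); apply: H_lb => // z xz zy.
    by have := hM z xz zy; rewrite /ht (le_trans zy yb).
  have My : M <= h b by have := hM y xy (lexx y); rewrite /ht (lt_geF yb).
  case: (leP x b) => xb; last by nra.
  have : M * (b - x) <= H b - H x.
    apply: H_lb => //; first exact: ltW.
    by move=> z xz zb; have := hM z xz (le_trans zb (ltW yb)); rewrite /ht zb.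
  nra.
have ht0 x : c <= x -> x <= 1 -> 0 <= ht x.
  move=> cx x1; rewrite /ht; case: (leP x b) => // xb.
  by apply: h_ge0 => //; exact: le_lt_trans b1.
have iHt : incr Ht.
  move=> x y cx xy y1; rewrite -subr_ge0 -[leLHS](mul0r (y - x)).
  apply: lb => // z xz zy; apply: ht0; [exact: le_trans xz|exact: le_trans y1].
have aa : 0 < a * a / 2 by rewrite divr_gt0 // mulr_gt0.
have [K K0 hK] := h_mod b1 aa.
have htK x y : c <= x -> x <= 1 -> c <= y -> y <= 1 -> ht x <= ht y + a * a / 2 + K * `|x - y|.
  move=> cx x1 cy y1; rewrite /ht.
  have cbb : c <= b <= b by rewrite lexx (ltW cb).
  case: (leP x b) => xb; case: (leP y b) => yb.
  - by apply: hK; apply/andP.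
  - have xcb : c <= x <= b by apply/andP.
    apply: le_trans (hK x b xcb cbb) _.
    rewrite lerD2l ler_wpM2l // !ler0_norm; lra.
  - have ycb : c <= y <= b by apply/andP.
    apply: le_trans (hK b y cbb ycb) _.
    rewrite lerD2l ler_wpM2l // !ger0_norm; lra.
  - by rewrite -addrA lerDl addr_ge0 ?(ltW aa) // mulr_ge0.
(* Adding [a] times Lebesgue measure bounds the density below by [a]. An oscillation
   [w = a * a / 2 + K * d] in either direction then costs the relative error
   [2 * w / a = a + 2 * K / a * d], hence the slack [expR a] and the exponent [2 * K / a]. *)
pose V x := 1 * Ht x + a * id x.
have iV : incr V.
  by apply: incr_add; apply: incr_scale => //; apply: ltW.
have rV : reg (expR a) (2 * K / a) V.
  move=> p r x1 x2 y1 y2 cp px1 x12 x2r py1 y12 y2r r1.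
  have pr : p <= r by rewrite (le_trans px1)// (le_trans x12).
  set d := r - p; have d0 : 0 <= d by rewrite subr_ge0.
  set w := a * a / 2 + K * d.
  have Kd : 0 <= K * d by rewrite mulr_ge0.
  set s := Num.max 0 (ht p - w).
  have b1' : V x2 - V x1 <= (ht p + w + a) * (x2 - x1).
    rewrite /V /=; suff : Ht x2 - Ht x1 <= (ht p + w) * (x2 - x1) by lra.
    apply: ub => //; first exact: le_trans px1.
      exact: le_trans x2r r1.
    move=> z xz zy; have pz := le_trans px1 xz; have zr := le_trans zy x2r.
    apply: le_trans (htK z p (le_trans cp pz) (le_trans zr r1) cp (le_trans pr r1)) _.
    by rewrite /w -addrA !lerD2l ler_wpM2l // ger0_norm /d; lra.
  have b2' : (s + a) * (y2 - y1) <= V y2 - V y1.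
    rewrite /V /=; suff : s * (y2 - y1) <= Ht y2 - Ht y1 by lra.
    apply: lb => //; first exact: le_trans py1.
      exact: le_trans y2r r1.
    move=> z xz zy; have pz := le_trans py1 xz; have zr := le_trans zy y2r.
    rewrite /s ge_max ht0 ?(le_trans cp pz) ?(le_trans zr r1) //=.
    have := htK p z cp (le_trans pr r1) (le_trans cp pz) (le_trans zr r1).
    have : K * `|p - z| <= K * d by rewrite ler_wpM2l // ler0_norm /d; lra.
    by rewrite /w; lra.
  have s0 : 0 <= s by rewrite /s le_max lexx.
  have s1 : ht p - w <= s by rewrite /s le_max lexx orbT.
  have key : ht p + w + a <= expR a * expR (2 * K / a * d) * (s + a).
    rewrite -expRD; apply: (@le_trans _ _ ((1 + (a + 2 * K / a * d)) * (s + a))); last first.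
      by apply: ler_wpM2r; [exact: addr_ge0 (ltW a0)|exact: expR_ge1Dx].
    have e1 : (a + 2 * K / a * d) * a = 2 * w by rewrite /w; field; rewrite gt_eqF.
    have e2 : 0 <= (a + 2 * K / a * d).
      by rewrite addr_ge0 ?(ltW a0) // !mulr_ge0 ?invr_ge0 ?(ltW a0).
    have e3 : 0 <= (a + 2 * K / a * d) * s by rewrite mulr_ge0.
    lra.
  have L0 : 0 <= x2 - x1 by rewrite subr_ge0.
  have M0 : 0 <= y2 - y1 by rewrite subr_ge0.
  apply: le_trans (ler_wpM2r M0 b1') _.
  apply: (@le_trans _ _ (expR a * expR (2 * K / a * d) * (s + a) * (x2 - x1) * (y2 - y1))).
    by do 2 apply: ler_wpM2r => //.
  have E0 : 0 <= expR a * expR (2 * K / a * d) * (x2 - x1) by rewrite !mulr_ge0 ?expR_ge0.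
  have := ler_wpM2l E0 b2'; lra.
have Ka0 : 0 <= 2 * K / a by rewrite !mulr_ge0 ?invr_ge0 ?(ltW a0).
have [m rU] := reg_iter_pull_Kreg (expR_ge0 a) Ka0 iV rV.
(* Tail mass allowed to each of the [m] pull-backs, for a total defect of at most [a]. *)
have am0 : 0 < a / m.+1%:R by rewrite divr_gt0.
have [J HJ] := H_c am0.
exists (iter m (pull J) V); split; first exact: rU.
move=> x y cx xy y1.
have iA : incr A.
  move=> u v cu uv v1; rewrite /A; case: (leP v b) => vb; first by rewrite (le_trans uv vb).
  by case: (leP u b) => ub'; [rewrite mulr_ge0 // subr_ge0 ltW|rewrite ler_wpM2l // lerD2r].
have iB : incr B.
  move=> u v cu uv v1; rewrite /B; case: (leP v b) => vb; first by rewrite (le_trans uv vb).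
  case: (leP u b) => ub'; first by rewrite subr_ge0 incrH // ltW.
  by rewrite lerD2r incrH.
have mA : mass A <= 4 * a by rewrite /mass_on /A (ltW cb) (lt_geF b1) /= subr0.
have mB : mass B <= a by rewrite /mass_on /B (ltW cb) (lt_geF b1) /= subr0.
have E1 : (fun x => 1 * Ht x + 1 * B x) = (fun x => 1 * H x + 1 * A x).
  by apply/funext => z; rewrite /Ht /A /B; case: (leP z b) => _; ring.
have E2 := congr1 (iter m (pull J)) E1; rewrite !iter_pull_lin in E2.
have {E2} E3 z : iter m (pull J) Ht z = iter m (pull J) H z + iter m (pull J) A z - iter m (pull J) B z.
  by have := congr1 (fun f => f z) E2; rewrite /= !mul1r => <-; rewrite addrK.
have E4 z : iter m (pull J) V z = iter m (pull J) H z + iter m (pull J) A z - iter m (pull J) B z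
    + a * iter m (pull J) id z.
  by rewrite /V iter_pull_lin mul1r E3.
rewrite !E4.
have [d1 d2] := iter_pull_defect m J.
have /andP[pA1 pA2] := incr_increment (incr_iter_pull m J iA) cx xy y1.
have /andP[pB1 pB2] := incr_increment (incr_iter_pull m J iB) cx xy y1.
have /andP[pI1 pI2] := incr_increment (incr_iter_pull m J (@incr_id _ c)) cx xy y1.
have /andP[pD1 pD2] := incr_increment d1 cx xy y1.
have qA := mass_iter_pull_le m J iA.
have qB := mass_iter_pull_le m J iB.
have qI : mass (iter m (pull J) id) <= 1.
  apply: le_trans (mass_iter_pull_le m J (@incr_id _ c)) _; rewrite /mass_on.
  have := c_ge0; lra.
have qD : m%:R * (H (psi J 1) - H c) <= a.
  move: HJ; rewrite ler_pdivlMr ?ltr0n // => HJ; apply: le_trans HJ.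
  rewrite mulrC ler_wpM2l // ?ler_nat //.
  by have := incrH (lexx c) (psi1_ge fb J) (psi1_le fb J); lra.
have : 0 <= a * (iter m (pull J) id y - iter m (pull J) id x) <= a.
  by apply/andP; split; [rewrite mulr_ge0 // ltW|nra].
move=> /andP[q1 q2].
(* Below, the truncation defect and [B] cost [a] each; above, [A] costs [4 * a] and the added
   Lebesgue measure [a]. *)
by move: pA1 pA2 pB1 pB2 pD1 pD2; clear -a0 q1 q2 qA qB qD mA mB d2 => *; apply/andP; split; lra.
Qed.

Theorem invariant_reg : reg 1 Kreg H.
Proof.
move=> p r x1 x2 y1 y2 cp px1 x12 x2r py1 y12 y2r r1; rewrite mul1r.
have cx1 := le_trans cp px1; have cy1 := le_trans cp py1.
have x21 := le_trans x2r r1; have y21 := le_trans y2r r1.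
set E := expR _; set L := x2 - x1; set M := y2 - y1.
set X := H x2 - H x1; set Y := H y2 - H y1.
have E0 : 0 < E by exact: expR_gt0.
have L0 : 0 <= L by rewrite subr_ge0.
have M0 : 0 <= M by rewrite subr_ge0.
have X0 : 0 <= X by rewrite subr_ge0 incrH.
have Y0 : 0 <= Y by rewrite subr_ge0 incrH.
(* Collects the coefficients of [a] left once [(1 - a) * expR a <= 1] has removed the slack; the [1]
   makes it positive. *)
pose C := X * M + 2 * M + 5 * E * L + 1.
have XM0 : 0 <= X * M by rewrite mulr_ge0.
have EL0 : 0 <= E * L by rewrite mulr_ge0 // ltW.
have C0 : 1 <= C by rewrite /C; lra.
apply/ler_addgt0Pr => eps eps0.
pose a := Num.min (1 / 2) (eps / C).
have a0 : 0 < a by rewrite /a lt_min divr_gt0 //= ?divr_gt0 //; lra.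
have a1 : a < 1 by rewrite /a gt_min; apply/orP; left; lra.
have [U [rU aU]] := regular_approx (introT andP (conj a0 a1)).
have := rU _ _ _ _ _ _ cp px1 x12 x2r py1 y12 y2r r1.
have /andP[] := aU _ _ cx1 x12 x21; have /andP[] := aU _ _ cy1 y12 y21.
rewrite -/E -/L -/M -/X -/Y.
move: (U y2 - U y1) (U x2 - U x1) => u v u1 u2 v1 v2 uv.
have aE : (1 - a) * expR a <= 1.
  have := expR_ge1Dx (- a); rewrite -(ler_pM2r (expR_gt0 a)) -expRD addNr expR0; lra.
have s1 : (X - 2 * a) * M <= v * M by rewrite ler_wpM2r.
have s2 : expR a * E * (u * L) <= expR a * E * ((Y + 5 * a) * L).
  by rewrite ler_wpM2l ?mulr_ge0 ?expR_ge0 ?(ltW E0) // ler_wpM2r.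
have s3 : (1 - a) * ((X - 2 * a) * M) <= (1 - a) * (expR a * E * ((Y + 5 * a) * L)).
  by rewrite ler_wpM2l //; lra.
have s4 : (1 - a) * (expR a * E * ((Y + 5 * a) * L)) <= E * ((Y + 5 * a) * L).
  rewrite !mulrA -!mulrA mulrA -[leRHS]mul1r ler_wpM2r // !mulr_ge0 ?(ltW E0) //; lra.
have aC : a * C <= eps.
  have : a <= eps / C by rewrite /a ge_min lexx orbT.
  by rewrite ler_pdivlMr //; lra.
have aaM : 0 <= a * a * M by rewrite !mulr_ge0 // ltW.
rewrite /C in aC; lra.
Qed.

End InvariantRegular.

(** * Inverse branches *)

Section C2.
Variable R : realType.
Implicit Types (F : R -> R) (U : set R).

Lemma MVT_weak F x y : x <= y -> (forall z, x <= z <= y -> derivable F z 1) ->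
  exists2 z, x <= z <= y & F y - F x = (derive1 F) z * (y - x).
Proof.
rewrite le_eqVlt => /orP[/eqP <-|xy] dF.
  by exists x; rewrite ?lexx // !subrr mulr0.
have [z zxy E] : exists2 z, z \in `]x, y[%R & F y - F x = (derive1 F) z * (y - x).
  apply: (@MVT _ F (derive1 F)) => //.
    move=> z; rewrite in_itv /= => /andP[xz zy].
    by rewrite derive1E; apply: DeriveDef => //; apply: dF; rewrite !ltW.
  apply: derivable_within_continuous => z; rewrite in_itv /=; exact: dF.
by exists z => //; move: zxy; rewrite in_itv /= => /andP[? ?]; rewrite !ltW.
Qed.

Lemma C2_MVT F U x y : C2_on F U -> x <= y -> (forall z, x <= z <= y -> U z) ->
  exists2 z, x <= z <= y & F y - F x = (derive1 F) z * (y - x).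
Proof. by move=> CF xy Uxy; apply: MVT_weak => // z /Uxy /CF[]. Qed.

Lemma C2_MVT1 F U x y : C2_on F U -> x <= y -> (forall z, x <= z <= y -> U z) ->
  exists2 z, x <= z <= y & (derive1 F) y - (derive1 F) x = (derive1 (derive1 F)) z * (y - x).
Proof.
move=> CF xy Uxy; apply: (@MVT_weak (derive1 F) x y xy) => z hz.
by have [_ d1 _] := CF z (Uxy z hz); exact: d1.
Qed.

Lemma C2_lip F U x y B : C2_on F U -> (forall z, x <= z <= y -> U z) ->
  (forall z, x <= z <= y -> `|(derive1 (derive1 F)) z| <= B) ->
  forall u v, x <= u <= y -> x <= v <= y -> `|(derive1 F) u - (derive1 F) v| <= B * `|u - v|.
Proof.
move=> CF Uxy hB u v.
wlog vu : u v / v <= u.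
  move=> H hu hv; have [vu|/ltW uv] := leP v u; first exact: H.
  by rewrite distrC [`|u - v|]distrC; apply: H.
move=> /andP[xu uy] /andP[xv vy].
have sub z : v <= z <= u -> x <= z <= y.
  by move=> /andP[vz zu]; rewrite (le_trans xv vz) (le_trans zu uy).
have [z hz ->] := C2_MVT1 CF vu (fun z hz => Uxy z (sub z hz)).
by rewrite normrM ler_wpM2r // hB // sub.
Qed.

Lemma C2_continuous F U a b : C2_on F U -> (forall z, a <= z <= b -> U z) ->
  {within `[a, b], continuous F}.
Proof.
move=> CF h; apply: derivable_within_continuous => z; rewrite in_itv /= => hz.
by have [] := CF z (h z hz).
Qed.

Lemma C2_continuous1 F U a b : C2_on F U -> (forall z, a <= z <= b -> U z) ->
  {within `[a, b], continuous (derive1 F)}.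
Proof.
move=> CF h; apply: derivable_within_continuous => z; rewrite in_itv /= => hz.
by have [_ d1 _] := CF z (h z hz); exact: d1.
Qed.

Lemma C2_bound2 F U a b : a <= b -> C2_on F U -> (forall z, a <= z <= b -> U z) ->
  exists2 B, 0 <= B & forall z, a <= z <= b -> `|(derive1 (derive1 F)) z| <= B.
Proof.
move=> ab CF h.
have cF : {within `[a, b], continuous (fun z => `|(derive1 (derive1 F)) z|)}.
  apply: continuous_in_subspaceT => z; rewrite inE /= in_itv /= => hz.
  apply: (@continuous_comp _ _ _ (derive1 (derive1 F)) (fun z => `|z|)); last exact: norm_continuous.
  by have [] := CF z (h z hz).
have [z _ hz] := EVT_max ab cF.
exists (`|(derive1 (derive1 F)) z|) => // y hy; apply: hz; by rewrite in_itv.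
Qed.

Lemma C2_bound1 F U a b : a <= b -> C2_on F U -> (forall z, a <= z <= b -> U z) ->
  exists B, forall z, a <= z <= b -> (derive1 F) z <= B.
Proof.
move=> ab CF h; have [z _ hz] := EVT_max ab (C2_continuous1 CF h).
by exists ((derive1 F) z) => y hy; apply: hz; rewrite in_itv.
Qed.

Lemma IVT_between F x y v : x <= y -> {within `[x, y], continuous F} ->
  F x <= v <= F y \/ F y <= v <= F x -> exists2 z, x <= z <= y & F z = v.
Proof.
move=> xy cF hv; have : Num.min (F x) (F y) <= v <= Num.max (F x) (F y).
  by case: hv => /andP[h1 h2]; rewrite ge_min le_max h1 h2 ?orbT.
by move/(IVT xy cF) => [z]; rewrite in_itv /= => hz <-; exists z.
Qed.

(** The extension agrees with [T] on the open branch only, so its endpoint value must come from the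
    image: a value above [1] would give interior values above [1] by the intermediate value theorem,
    and one below [1] would contradict monotonicity. *)
Lemma branch_right_end F a b : a < b ->
  (forall u, a < u -> {within `[u, b], continuous F}) ->
  (forall x, a < x < b -> 0 < F x < 1) ->
  (forall x y, a < x -> x < y -> y < b -> F x < F y) ->
  (forall y, 0 < y < 1 -> exists2 x, a < x < b & F x = y) -> F b = 1.
Proof.
move=> ab cF F01 Fm Fs; apply/eqP; rewrite eq_le; apply/andP; split.
  rewrite leNgt; apply/negP => Fb.
  have hm : a < (a + b) / 2 < b by apply/andP; split; lra.
  have /andP[m1 m2] := hm.
  have [] := @IVT_between F ((a + b) / 2) b ((1 + F b) / 2).
  - exact: ltW.
  - exact: cF.
  - by left; have /andP[_ h] := F01 _ hm; apply/andP; split; lra.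
  move=> z /andP[z1 z2] Fz.
  have zb : z < b.
    by rewrite lt_neqAle z2 andbT; apply/eqP => zE; rewrite zE in Fz; lra.
  by have /andP[_ h] : 0 < F z < 1; [apply: F01; rewrite zb (lt_le_trans m1 z1)|lra].
rewrite leNgt; apply/negP => Fb.
set y := Num.max ((1 + F b) / 2) (1 / 2).
have y1 : y < 1 by rewrite /y gt_max; apply/andP; split; lra.
have y2 : F b < y by rewrite /y lt_max; apply/orP; left; lra.
have y3 : 0 < y by rewrite /y lt_max; apply/orP; right; lra.
have [x /andP[ax xb] Fx] := Fs y (introT andP (conj y3 y1)).
have [] := @IVT_between F ((x + b) / 2) b ((y + F b) / 2).
- by lra.
- by apply: cF; lra.
- right; have := Fm x ((x + b) / 2) ax.
  by move=> /(_ ltac:(lra) ltac:(lra)) h; apply/andP; split; lra.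
move=> z /andP[z1 z2] Fz.
have zb : z < b.
  by rewrite lt_neqAle z2 andbT; apply/eqP => zE; rewrite zE in Fz; lra.
by have := Fm x z ax; move=> /(_ ltac:(lra) zb); lra.
Qed.

Lemma branch_left_end F a b : a < b ->
  (forall u, u < b -> {within `[a, u], continuous F}) ->
  (forall x, a < x < b -> 0 < F x < 1) ->
  (forall x y, a < x -> x < y -> y < b -> F x < F y) ->
  (forall y, 0 < y < 1 -> exists2 x, a < x < b & F x = y) -> F a = 0.
Proof.
move=> ab cF F01 Fm Fs; apply/eqP; rewrite eq_le; apply/andP; split; last first.
  rewrite leNgt; apply/negP => Fa.
  have hm : a < (a + b) / 2 < b by apply/andP; split; lra.
  have /andP[m1 m2] := hm.
  have [] := @IVT_between F a ((a + b) / 2) (F a / 2).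
  - exact: ltW.
  - exact: cF.
  - by left; have /andP[h _] := F01 _ hm; apply/andP; split; lra.
  move=> z /andP[z1 z2] Fz.
  have za : a < z.
    by rewrite lt_neqAle z1 andbT; apply/eqP => zE; rewrite -zE in Fz; lra.
  by have /andP[h _] : 0 < F z < 1; [apply: F01; rewrite za (le_lt_trans z2 m2)|lra].
rewrite leNgt; apply/negP => Fa.
set y := Num.min (F a / 2) (1 / 2).
have y1 : 0 < y by rewrite /y lt_min; apply/andP; split; lra.
have y2 : y < F a by rewrite /y gt_min; apply/orP; left; lra.
have y3 : y < 1 by rewrite /y gt_min; apply/orP; right; lra.
have [x /andP[ax xb] Fx] := Fs y (introT andP (conj y1 y3)).
have [] := @IVT_between F a ((a + x) / 2) ((y + F a) / 2).
- by lra.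
- by apply: cF; lra.
- right; have := Fm ((a + x) / 2) x.
  by move=> /(_ ltac:(lra) ltac:(lra) xb) h; apply/andP; split; lra.
move=> z /andP[z1 z2] Fz.
have za : a < z.
  by rewrite lt_neqAle z1 andbT; apply/eqP => zE; rewrite -zE in Fz; lra.
by have := Fm z x za; move=> /(_ ltac:(lra) xb); lra.
Qed.

End C2.

(** * Inverse of an increasing full branch, and its distortion *)

Section Inverse.
Variables (R : realType) (f : R -> R) (a b : R).
Hypotheses (ab : a <= b) (fa : f a = 0) (fb : f b = 1).
Hypothesis f_lt : forall x y, a <= x -> x < y -> y <= b -> f x < f y.
Hypothesis f_onto : forall y, 0 < y < 1 -> exists2 x, a <= x <= b & f x = y.

Definition inv_branch y := xget a [set x | a <= x <= b /\ f x = y].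

Lemma inv_branchP y : 0 <= y <= 1 -> a <= inv_branch y <= b /\ f (inv_branch y) = y.
Proof.
move=> /andP[y0 y1].
suff ex : exists x, a <= x <= b /\ f x = y.
  exact: (@xgetPex _ a [set x | a <= x <= b /\ f x = y] ex).
have [y_gt0|y_le0] := ltP 0 y; last first.
  by exists a; rewrite lexx ab fa; split=> //; apply/eqP; rewrite eq_le y0 y_le0.
have [y_lt1|y_ge1] := ltP y 1; last first.
  by exists b; rewrite lexx ab fb; split=> //; apply/eqP; rewrite eq_le y1 y_ge1.
by have [x h1 h2] := f_onto (introT andP (conj y_gt0 y_lt1)); exists x.
Qed.

Lemma f_le x y : a <= x -> x <= y -> y <= b -> f x <= f y.
Proof.
move=> ax; rewrite le_eqVlt => /orP[/eqP ->//|xy] yb.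
by apply: ltW; exact: f_lt.
Qed.

Lemma f_inj x y : a <= x <= b -> a <= y <= b -> f x = f y -> x = y.
Proof.
move=> /andP[ax xb] /andP[ay yb] E; case: (ltgtP x y) => // xy.
- by have := f_lt ax xy yb; rewrite E ltxx.
- by have := f_lt ay xy xb; rewrite E ltxx.
Qed.

Lemma inv_branchK x : a <= x <= b -> inv_branch (f x) = x.
Proof.
move=> /andP[ax xb].
have [h1 h2] : a <= inv_branch (f x) <= b /\ f (inv_branch (f x)) = f x.
  by apply: inv_branchP; rewrite -fa -fb !f_le.
by apply: f_inj => //; rewrite ax.
Qed.

Lemma inv_branch0 : inv_branch 0 = a.
Proof. by rewrite -fa inv_branchK // lexx. Qed.

Lemma inv_branch1 : inv_branch 1 = b.
Proof. by rewrite -fb inv_branchK // ab lexx. Qed.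

Lemma inv_branch_lt x y : 0 <= x -> x < y -> y <= 1 -> inv_branch x < inv_branch y.
Proof.
move=> x0 xy y1.
have [/andP[h1 h2] h3] := @inv_branchP x (introT andP (conj x0 (ltW (lt_le_trans xy y1)))).
have [/andP[h4 h5] h6] := @inv_branchP y (introT andP (conj (ltW (le_lt_trans x0 xy)) y1)).
rewrite ltNge; apply/negP => h; have := f_le h4 h h2.
by rewrite h3 h6 leNgt xy.
Qed.

Lemma inv_branch_le x y : 0 <= x -> x <= y -> y <= 1 -> inv_branch x <= inv_branch y.
Proof.
move=> ax; rewrite le_eqVlt => /orP[/eqP ->//|xy] yb.
by apply: ltW; exact: inv_branch_lt.
Qed.

Lemma inv_branch_contr rho x y : 0 < rho ->
  (forall u v, a <= u -> u <= v -> v <= b -> rho * (v - u) <= f v - f u) ->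
  0 <= x -> x <= y -> y <= 1 -> inv_branch y - inv_branch x <= rho^-1 * (y - x).
Proof.
move=> rho0 hf x0 xy y1.
have [/andP[h1 h2] h3] := @inv_branchP x (introT andP (conj x0 (le_trans xy y1))).
have [/andP[h4 h5] h6] := @inv_branchP y (introT andP (conj (le_trans x0 xy) y1)).
rewrite -(ler_pM2l rho0) mulrA mulfV ?gt_eqF // mul1r -{2}h6 -{2}h3.
by apply: hf => //; exact: inv_branch_le.
Qed.

(** By the mean value theorem the slopes of the inverse have ratio [d w / d z], and [d >= 1] turns
    the Lipschitz bound into [d w <= (1 + B * |w - z|) * d z]. The slope [d] is abstract so that it
    may be the absolute value of a derivative. *)
Lemma inv_branch_dist (d : R -> R) B P Q X1 X2 Y1 Y2 : 0 <= B ->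
  (forall x y, inv_branch P <= x -> x <= y -> y <= inv_branch Q ->
    exists2 z, x <= z <= y & f y - f x = d z * (y - x)) ->
  (forall x, inv_branch P <= x <= inv_branch Q -> 1 <= d x) ->
  (forall x y, inv_branch P <= x <= inv_branch Q -> inv_branch P <= y <= inv_branch Q ->
    `|d x - d y| <= B * `|x - y|) ->
  0 <= P -> P <= X1 -> X1 <= X2 -> X2 <= Q -> P <= Y1 -> Y1 <= Y2 -> Y2 <= Q -> Q <= 1 ->
  (inv_branch X2 - inv_branch X1) * (Y2 - Y1) <=
    expR (B * (inv_branch Q - inv_branch P)) * ((inv_branch Y2 - inv_branch Y1) * (X2 - X1)).
Proof.
move=> B0 fd d1 dB P0 PX1 X12 X2Q PY1 Y12 Y2Q Q1.
have [X10 Y10] := (le_trans P0 PX1, le_trans P0 PY1).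
have [X21 Y21] := (le_trans X2Q Q1, le_trans Y2Q Q1).
have [p1 p2] := (inv_branch_le P0 PX1 (le_trans X12 X21), inv_branch_le P0 PY1 (le_trans Y12 Y21)).
have [q1 q2] := (inv_branch_le (le_trans X10 X12) X2Q Q1, inv_branch_le (le_trans Y10 Y12) Y2Q Q1).
have [x12 y12] := (inv_branch_le X10 X12 X21, inv_branch_le Y10 Y12 Y21).
have [z /andP[z1 z2] Ez] := fd _ _ p1 x12 q1.
have [w /andP[w1 w2] Ew] := fd _ _ p2 y12 q2.
move: Ez Ew.
rewrite !(inv_branchP _).2 ?X10 ?Y10 ?X21 ?Y21 ?(le_trans X10 X12) ?(le_trans Y10 Y12) ?(le_trans X12 X21) ?(le_trans Y12 Y21) //.
move=> -> ->.
have hz : inv_branch P <= z <= inv_branch Q by rewrite (le_trans p1 z1) (le_trans z2 q1).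
have hw : inv_branch P <= w <= inv_branch Q by rewrite (le_trans p2 w1) (le_trans w2 q2).
have dz := d1 _ hz; have dw := d1 _ hw.
have dzw := dB _ _ hw hz.
have key : d w <= expR (B * (inv_branch Q - inv_branch P)) * d z.
  have e1 := expR_ge1Dx (B * (inv_branch Q - inv_branch P)).
  have nzw : `|w - z| <= inv_branch Q - inv_branch P.
    move/andP: hz => [? ?]; move/andP: hw => [? ?].
    by rewrite ler_norml; apply/andP; split; lra.
  have := ler_norm (d w - d z); have := ler_wpM2l B0 nzw.
  move: e1; move: (expR _) => E e1 e2 e3.
  have t0 : 0 <= B * (inv_branch Q - inv_branch P) by apply: le_trans e2; rewrite mulr_ge0.
  nra.
have A0 : 0 <= (inv_branch X2 - inv_branch X1) * (inv_branch Y2 - inv_branch Y1).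
  by rewrite mulr_ge0 // subr_ge0.
have := ler_wpM2l A0 key; move: (expR _) => E; lra.
Qed.

End Inverse.

(** * The map *)

Section IntervalIntegral.
Variables (R : realType) (g : R -> R) (a b : R).
Hypotheses (ab : a <= b) (mg : measurable_fun `]a, b] g).
Local Notation leb := (@lebesgue_measure R).

Let mEg : measurable_fun `]a, b] (fun x => (g x)%:E).
Proof. exact/measurable_EFinP. Qed.

Lemma lebesgue_itv_oc : leb `]a, b] = (b - a)%:E.
Proof.
rewrite lebesgue_measure_itv /= lte_fin; case: ltP => // ba.
by congr EFin; apply/eqP; rewrite eq_sym subr_eq0 eq_le ab ba.
Qed.

Lemma integral_itv_ge m : 0 <= m -> (forall x, a < x <= b -> m <= g x) ->
  ((m * (b - a))%:E <= \int[leb]_(x in `]a, b]) (g x)%:E)%E.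
Proof.
move=> m0 hm; rewrite EFinM -lebesgue_itv_oc -integral_cst; last exact: measurable_itv.
exact: ge0_le_integral.
Qed.

Lemma integral_itv_le m : (forall x, a < x <= b -> 0 <= g x <= m) ->
  (\int[leb]_(x in `]a, b]) (g x)%:E <= (m * (b - a))%:E)%E.
Proof.
move=> hm; rewrite EFinM -lebesgue_itv_oc -integral_cst; last exact: measurable_itv.
apply: ge0_le_integral => //=; last by move=> x; rewrite in_itv /= => /hm /andP[h1 h2]; rewrite lee_fin.
by move=> x; rewrite in_itv /= => /hm /andP[]; rewrite lee_fin.
Qed.

End IntervalIntegral.

Definition orbitL (R : realType) (psiL : R -> R) (j : nat) (x : R) : R := iter j psiL x.
Arguments orbitL : simpl never.

Definition orbit_psi (R : realType) (psiL psiR : R -> R) (j : nat) (x : R) : R :=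
  psiR (orbitL psiL j x).

(* [psiL] and [psiR] are the inverse branches, extended to [[0, 1]]; [d] is [T'(c^+)]. *)
Record indiff_map (R : realType) (c : R) (T psiL psiR : R -> R) (kappa D d : R) : Prop := {
  im_c01 : 0 < c < 1;
  im_T : forall x, 0 <= x <= 1 -> 0 <= T x <= 1;
  im_T0 : T 0 = 0;
  im_TL : forall z, 0 < z < c -> 0 < T z < 1 /\ psiL (T z) = z;
  im_TR : forall z, c < z < 1 -> 0 < T z < 1 /\ psiR (T z) = z;
  im_L0 : psiL 0 = 0;
  im_L1 : psiL 1 = c;
  im_R0 : psiR 0 = c;
  im_R1 : psiR 1 = 1;
  im_Llt : forall x y, 0 <= x -> x < y -> y <= 1 -> psiL x < psiL y;
  im_Rlt : forall x y, 0 <= x -> x < y -> y <= 1 -> psiR x < psiR y;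
  im_d : 0 < d;
  im_b : forall eps, 0 < eps -> exists n, forall m, (n <= m)%N -> orbitL psiL m 1 < eps;
  im_fb : full_branches c (orbit_psi psiL psiR) kappa D;
  im_Lratio : forall eps, 0 < eps -> exists2 delta, 0 < delta &
    forall x, 0 < x < delta -> x <= (1 + eps) * psiL x;
  im_Rtan : forall eps, 0 < eps -> exists2 delta, 0 < delta &
    forall x, 0 < x < delta -> `|psiR x - c - x / d| <= eps * x }.

(** * From the hypotheses on [T] to the inverse branches *)

Section Branches.
Variables (R : realType) (c : R) (T TL TR g : R -> R).
Hypothesis c01 : 0 < c < 1.
Hypothesis T01 : forall x, `[0, 1] x -> `[0, 1] (T x).
Hypothesis TL_mono : {in `]0, c[%classic &, {mono T : x y / x < y}}.
Hypothesis TL_img : T @` `]0, c[ = `]0, 1[.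
Hypothesis TR_mono : {in `]c, 1[%classic &, {mono T : x y / x < y}}.
Hypothesis TR_img : T @` `]c, 1[ = `]0, 1[.
Hypothesis TRE : forall x, `]c, 1[ x -> TR x = T x.
Hypothesis TR_C2 : exists2 eta : R, 0 < eta & C2_on TR `]c - eta, 1 + eta[.
Hypothesis TR_exp : exists2 rho : R, 1 < rho & forall x, `[c, 1] x -> rho <= `|(derive1 TR) x|.
Hypothesis TLE : forall x, `]0, c[ x -> TL x = T x.
Hypothesis TL_C2 : exists2 eta : R, 0 < eta & C2_on TL `]0, c + eta[.
Hypothesis T0 : T 0 = 0.
Hypothesis TL_exp : forall eps : R, 0 < eps ->
     exists2 rho : R, 1 < rho & forall x, `[eps, c] x -> rho <= (derive1 TL) x.
Hypothesis TL_tan : (derive1 TL) x @[x --> (0:R)^'+] --> (1:R).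
Hypothesis g_cont : {within `]0, c], continuous g}.
Hypothesis g_decr : {in `]0, c]%classic &, {homo g : x y / x < y >-> y < x}}.
Hypothesis g_int : (\int[@lebesgue_measure R]_(x in `]0%R, c]) (g x)%:E < +oo)%E.
Hypothesis TL_g : forall x, `]0, c] x -> `|(derive1 (derive1 TL)) x| <= g x.

Let c_gt0 : 0 < c. Proof. by case/andP: c01. Qed.
Let c_lt1 : c < 1. Proof. by case/andP: c01. Qed.

Let TL01 x : 0 < x < c -> 0 < TL x < 1.
Proof.
move=> hx; have hx' : `]0, c[ x by rewrite /= in_itv.
rewrite (TLE hx').
have : (T @` `]0, c[) (T x) by exists x.
by rewrite TL_img /= in_itv.
Qed.

Let TR01 x : c < x < 1 -> 0 < TR x < 1.
Proof.
move=> hx; have hx' : `]c, 1[ x by rewrite /= in_itv.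
rewrite (TRE hx').
have : (T @` `]c, 1[) (T x) by exists x.
by rewrite TR_img /= in_itv.
Qed.

Let TL_onto y : 0 < y < 1 -> exists2 x, 0 < x < c & TL x = y.
Proof.
move=> hy; have : `]0, 1[ y by rewrite /= in_itv.
rewrite -TL_img => -[x xc Txy]; exists x; last by rewrite TLE.
by move: xc; rewrite /= in_itv.
Qed.

Let TR_onto y : 0 < y < 1 -> exists2 x, c < x < 1 & TR x = y.
Proof.
move=> hy; have : `]0, 1[ y by rewrite /= in_itv.
rewrite -TR_img => -[x xc Txy]; exists x; last by rewrite TRE.
by move: xc; rewrite /= in_itv.
Qed.

Let TL_lt_in x y : 0 < x -> x < y -> y < c -> TL x < TL y.
Proof.
move=> x0 xy yc.
have hx : `]0, c[ x by rewrite /= in_itv /= x0 (lt_trans xy).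
have hy : `]0, c[ y by rewrite /= in_itv /= yc (lt_trans x0).
by rewrite !TLE // TL_mono // inE.
Qed.

Let TR_lt_in x y : c < x -> x < y -> y < 1 -> TR x < TR y.
Proof.
move=> x0 xy yc.
have hx : `]c, 1[ x by rewrite /= in_itv /= x0 (lt_trans xy).
have hy : `]c, 1[ y by rewrite /= in_itv /= yc (lt_trans x0).
by rewrite !TRE // TR_mono // inE.
Qed.

Let TL_MVT x y : 0 < x -> x <= y -> y <= c ->
  exists2 z, x <= z <= y & TL y - TL x = (derive1 TL) z * (y - x).
Proof.
move=> x0 xy yc; have [eta eta0 C] := TL_C2.
apply: (C2_MVT C xy) => z /andP[h1 h2]; rewrite /= in_itv /=.
by apply/andP; split; [exact: lt_le_trans h1|lra].
Qed.

Let TR_MVT x y : c <= x -> x <= y -> y <= 1 ->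
  exists2 z, x <= z <= y & TR y - TR x = (derive1 TR) z * (y - x).
Proof.
move=> x0 xy yc; have [eta eta0 C] := TR_C2.
apply: (C2_MVT C xy) => z /andP[h1 h2]; rewrite /= in_itv /=.
by apply/andP; split; lra.
Qed.

Let dTL_gt1 x : 0 < x <= c -> 1 < (derive1 TL) x.
Proof.
move=> /andP[x0 xc]; have [rho r1 hr] := TL_exp x0.
by apply: lt_le_trans r1 _; apply: hr; rewrite /= in_itv /= lexx.
Qed.

Let TL_c : TL c = 1.
Proof.
have [eta eta0 C] := TL_C2.
apply: (@branch_right_end _ TL 0 c) => // u u0.
apply: (C2_continuous C) => z /andP[h1 h2]; rewrite /= in_itv /=.
by apply/andP; split; [exact: lt_le_trans h1|lra].
Qed.

Let TR_1 : TR 1 = 1.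
Proof.
have [eta eta0 C] := TR_C2.
apply: (@branch_right_end _ TR c 1) => // u u0.
apply: (C2_continuous C) => z /andP[h1 h2]; rewrite /= in_itv /=.
by apply/andP; split; lra.
Qed.

Let TR_c : TR c = 0.
Proof.
have [eta eta0 C] := TR_C2.
apply: (@branch_left_end _ TR c 1) => // u u0.
apply: (C2_continuous C) => z /andP[h1 h2]; rewrite /= in_itv /=.
by apply/andP; split; lra.
Qed.

(** The value of [TL] at [0] is unconstrained, whereas the inverse branch needs [0] there. *)
Let fL x := if x == 0 then 0 else TL x.

Let fL_gt0 x : 0 < x -> fL x = TL x.
Proof. by move=> x0; rewrite /fL gt_eqF. Qed.

Let fL_0 : fL 0 = 0. Proof. by rewrite /fL eqxx. Qed.
Let fL_c : fL c = 1. Proof. by rewrite fL_gt0. Qed.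

Let TL_gt0 x : 0 < x <= c -> 0 < TL x.
Proof.
move=> /andP[x0]; rewrite le_eqVlt => /orP[/eqP ->|xc]; first by rewrite TL_c.
by have /andP[] := @TL01 x (introT andP (conj x0 xc)).
Qed.

Let TL_exp1 x y : 0 < x -> x <= y -> y <= c -> y - x <= TL y - TL x.
Proof.
move=> x0 xy yc; have [z /andP[z1 z2] ->] := TL_MVT x0 xy yc.
rewrite -[leLHS]mul1r ler_wpM2r ?subr_ge0 // ltW // dTL_gt1 //.
by rewrite (lt_le_trans x0 z1) (le_trans z2).
Qed.

Let fL_exp x y : 0 <= x -> x <= y -> y <= c -> 1 * (y - x) <= fL y - fL x.
Proof.
rewrite mul1r le_eqVlt => /orP[/eqP <-|x0] xy yc; last first.
  by rewrite !fL_gt0 //; [exact: TL_exp1|exact: lt_le_trans xy].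
rewrite fL_0 !subr0; move: xy; rewrite le_eqVlt => /orP[/eqP <-|y0]; first by rewrite fL_0.
(* Positivity replaces continuity of [TL] at [0]: if [TL y < y], expansion from the point
   [(y - TL y) / 2] to [y] would force a negative value at that point. *)
rewrite fL_gt0 // leNgt; apply/negP => h.
have Ty := TL_gt0 (introT andP (conj y0 yc)).
have u0 : 0 < (y - TL y) / 2 by lra.
have := TL_exp1 u0; move=> /(_ y ltac:(lra) yc).
have : 0 < TL ((y - TL y) / 2) by apply: TL_gt0; apply/andP; split; lra.
lra.
Qed.

Let fL_lt x y : 0 <= x -> x < y -> y <= c -> fL x < fL y.
Proof. by move=> x0 xy yc; have := fL_exp x0 (ltW xy) yc; lra. Qed.

Let fL_onto y : 0 < y < 1 -> exists2 x, 0 <= x <= c & fL x = y.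
Proof.
move=> /TL_onto[x /andP[x0 xc] xy]; exists x; last by rewrite fL_gt0.
by rewrite !ltW.
Qed.

Let TR_lt x y : c <= x -> x < y -> y <= 1 -> TR x < TR y.
Proof.
rewrite le_eqVlt => /orP[/eqP cx|cx] xy; rewrite le_eqVlt => /orP[/eqP y1|y1].
- by rewrite -cx y1 TR_c TR_1.
- by rewrite -cx in xy *; rewrite TR_c; have /andP[] := @TR01 y (introT andP (conj xy y1)).
- by rewrite y1 in xy *; rewrite TR_1; have /andP[] := @TR01 x (introT andP (conj cx xy)).
- exact: TR_lt_in.
Qed.

Let TR_onto' y : 0 < y < 1 -> exists2 x, c <= x <= 1 & TR x = y.
Proof.
move=> /TR_onto[x /andP[x0 xc] xy]; exists x => //.
by rewrite !ltW.
Qed.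

(** Expansion is given for the absolute value of the derivative only; since [TR] is increasing, the
    mean value formula holds with that absolute value. *)
Let TR_MVT_abs x y : c <= x -> x <= y -> y <= 1 ->
  exists2 z, x <= z <= y & TR y - TR x = `|(derive1 TR) z| * (y - x).
Proof.
move=> cx xy y1; have [z hz E] := TR_MVT cx xy y1; exists z => //.
have T0' : 0 <= TR y - TR x.
  rewrite subr_ge0; move: xy; rewrite le_eqVlt => /orP[/eqP ->//|xy].
  by apply: ltW; exact: TR_lt.
by rewrite -[LHS]ger0_norm // E normrM [`|y - x|]ger0_norm // subr_ge0.
Qed.

Let psiL := inv_branch fL 0 c.
Let psiR := inv_branch TR c 1.

Let psiLP y : 0 <= y <= 1 -> 0 <= psiL y <= c /\ fL (psiL y) = y.
Proof. by apply: inv_branchP; rewrite ?ltW. Qed.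

Let psiRP y : 0 <= y <= 1 -> c <= psiR y <= 1 /\ TR (psiR y) = y.
Proof. by apply: inv_branchP; rewrite ?ltW. Qed.

Let psiL0 : psiL 0 = 0. Proof. by apply: inv_branch0 => //; rewrite ltW. Qed.
Let psiL1 : psiL 1 = c. Proof. by apply: inv_branch1 => //; rewrite ltW. Qed.
Let psiR0 : psiR 0 = c. Proof. by apply: inv_branch0 => //; rewrite ltW. Qed.
Let psiR1 : psiR 1 = 1. Proof. by apply: inv_branch1 => //; rewrite ltW. Qed.

Let psiL_lt x y : 0 <= x -> x < y -> y <= 1 -> psiL x < psiL y.
Proof. by apply: inv_branch_lt => //; rewrite ltW. Qed.
Let psiR_lt x y : 0 <= x -> x < y -> y <= 1 -> psiR x < psiR y.
Proof. by apply: inv_branch_lt => //; rewrite ltW. Qed.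
Let psiL_le x y : 0 <= x -> x <= y -> y <= 1 -> psiL x <= psiL y.
Proof. by apply: inv_branch_le => //; rewrite ltW. Qed.
Let psiR_le x y : 0 <= x -> x <= y -> y <= 1 -> psiR x <= psiR y.
Proof. by apply: inv_branch_le => //; rewrite ltW. Qed.

Let psiL_contr x y : 0 <= x -> x <= y -> y <= 1 -> psiL y - psiL x <= y - x.
Proof.
move=> x0 xy y1; rewrite -[leRHS]mul1r -[X in X * _]invr1.
by apply: (@inv_branch_contr _ fL 0 c) => //; rewrite ltW.
Qed.

Let psiR_contr rho x y : 1 < rho -> (forall x, `[c, 1] x -> rho <= `|(derive1 TR) x|) ->
  0 <= x -> x <= y -> y <= 1 -> psiR y - psiR x <= rho^-1 * (y - x).
Proof.
move=> r1 hr x0 xy y1.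
apply: (@inv_branch_contr _ TR c 1) => //; rewrite ?ltW //; first exact: lt_trans r1.
move=> u v cu uv v1; have [z /andP[z1 z2] ->] := TR_MVT_abs cu uv v1.
by rewrite ler_wpM2r ?subr_ge0 // hr //= in_itv /= (le_trans cu z1) (le_trans z2).
Qed.

Let b n := orbitL psiL n 1.
Let b_S n : b n.+1 = psiL (b n). Proof. by []. Qed.
Let b_1 : b 1 = c. Proof. exact: psiL1. Qed.

Let b_range n : 0 < b n <= 1.
Proof.
elim: n => [|n /andP[h1 h2]]; first by rewrite ltr01 lexx.
rewrite b_S -{1}psiL0 psiL_lt //.
by have [/andP[_ h] _] := psiLP (introT andP (conj (ltW h1) h2)); apply: le_trans h _; rewrite ltW.
Qed.

Let b_c n : 0 < b n.+1 <= c.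
Proof.
have /andP[h1 h2] := b_range n.
have /andP[-> _] := b_range n.+1.
by have [/andP[_ h] _] := psiLP (introT andP (conj (ltW h1) h2)).
Qed.

Let TL_b n : TL (b n.+1) = b n.
Proof.
have /andP[h1 h2] := b_range n.
have /andP[h3 _] := b_c n.
rewrite -fL_gt0 //.
by have [_ h] := psiLP (introT andP (conj (ltW h1) h2)).
Qed.

Let b_ltS n : b n.+1 < b n.
Proof.
have /andP[h1 h2] := b_c n; rewrite -(TL_b n).
set x := b n.+1 in h1 h2 *.
have x2 : 0 < x / 2 by lra.
have [rho r1 hr] := TL_exp x2.
have x2x : x / 2 <= x by lra.
have [z /andP[z1 z2] E] := TL_MVT x2 x2x h2.
have dz : rho <= (derive1 TL) z by apply: hr; rewrite /= in_itv /= z1 (le_trans z2).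
have := @fL_exp 0 (x / 2) (lexx _) (ltW x2); move=> /(_ ltac:(lra)).
rewrite fL_0 fL_gt0 //.
have : 0 < ((derive1 TL) z - 1) * (x / 2) by rewrite mulr_gt0 // subr_gt0 (lt_le_trans r1).
lra.
Qed.

Let b_anti m n : (m <= n)%N -> b n <= b m.
Proof.
move=> /subnK <-; elim: (n - m)%N => [|k IH] //.
by apply: le_trans IH; rewrite addSn ltW.
Qed.

(** As long as the orbit stays above [eps], uniform expansion on [[eps / 2, c]] makes each step at
    least [(rho - 1) * (eps / 2)], which cannot go on forever. *)
Let b_cvg eps : 0 < eps -> exists n, forall m, (n <= m)%N -> b m < eps.
Proof.
move=> e0; suff [n hn] : exists n, b n < eps.
  by exists n => m nm; apply: le_lt_trans hn; exact: b_anti.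
apply: contrapT => hn.
have he n : eps <= b n by rewrite leNgt; apply/negP => h; apply: hn; exists n.
have e2 : 0 < eps / 2 by lra.
have [rho r1 hr] := TL_exp e2.
have step n : b n.+1 <= b n - (rho - 1) * (eps / 2).
  have /andP[h1 h2] := b_c n; rewrite -(TL_b n); have := he n.+1.
  set x := b n.+1 in h1 h2 * => ex.
  have e2x : eps / 2 <= x by lra.
  have [z /andP[z1 z2] E] := TL_MVT e2 e2x h2.
  have dz : rho <= (derive1 TL) z by apply: hr; rewrite /= in_itv /= z1 (le_trans z2).
  have := @fL_exp 0 (eps / 2) (lexx _) (ltW e2); move=> /(_ ltac:(lra)).
  rewrite fL_0 fL_gt0 //.
  have : 0 <= ((derive1 TL) z - rho) * (x - eps / 2) by rewrite mulr_ge0 ?subr_ge0 //; lra.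
  have : 0 <= (rho - 1) * (x - eps) by rewrite mulr_ge0 ?subr_ge0 // ltW.
  lra.
have bn n : b n <= 1 - n%:R * ((rho - 1) * (eps / 2)).
  elim: n => [|n IH]; first by rewrite mul0r subr0.
  by have := step n; rewrite -[n.+1%:R]natr1; lra.
have s0 : 0 < (rho - 1) * (eps / 2) by rewrite mulr_gt0 ?subr_gt0.
set s := (_ * _) in s0 bn.
have := archi_boundP (ltW (divr_gt0 (@ltr01 R) s0)); set k := Num.bound _ => hk.
have := bn k; have /andP[] := b_range k.
move: hk; rewrite ltr_pdivrMr //; lra.
Qed.

Let dTL_bounded : exists2 Lam, 0 <= Lam & forall x, 0 < x <= c -> (derive1 TL) x <= Lam.
Proof.
have [eta eta0 C] := TL_C2.
have [del del0 hd] : exists2 del, 0 < del & forall x, 0 < x < del -> (derive1 TL) x <= 2.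
  move/cvgrPdist_lt : TL_tan => /(_ 1 ltr01) [d /= d0 hd].
  exists d => // x /andP[x0 xd].
  have := hd x; rewrite /ball /= sub0r normrN gtr0_norm // => /(_ xd x0).
  rewrite ltr_norml => /andP[]; lra.
set e := Num.min (del / 2) c.
have e0 : 0 < e by rewrite /e lt_min c_gt0 divr_gt0.
have ec : e <= c by rewrite /e ge_min lexx orbT.
have [B hB] : exists B, forall z, e <= z <= c -> (derive1 TL) z <= B.
  apply: (C2_bound1 ec C) => z /andP[h1 h2]; rewrite /= in_itv /=.
  by apply/andP; split; [exact: lt_le_trans h1|lra].
exists (Num.max 2 B); first by rewrite le_max ler0n.
move=> x /andP[x0 xc]; rewrite le_max.
have [ex|xe] := leP e x; first by rewrite hB ?orbT // ex.
rewrite hd // x0 /=; apply: lt_trans xe _.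
by rewrite /e gt_min; apply/orP; left; lra.
Qed.

Let g_ge0 x : 0 < x <= c -> 0 <= g x.
Proof. by move=> hx; apply: le_trans (TL_g _) => //=; rewrite in_itv. Qed.

Let g_anti x y : 0 < x -> x <= y -> y <= c -> g y <= g x.
Proof.
move=> x0; rewrite le_eqVlt => /orP[/eqP ->//|xy] yc.
apply: ltW; apply: g_decr => //; rewrite inE /= in_itv /=.
  by rewrite x0 (le_trans (ltW xy)).
by rewrite yc (lt_trans x0).
Qed.

Let g_meas A : measurable A -> A `<=` `]0, c] -> measurable_fun A g.
Proof.
move=> mA Ac.
apply: (@measurable_funS _ _ _ _ `]0, c]) => //.
exact: subspace_continuous_measurable_fun.
Qed.

(** A lower Riemann sum: [g] is decreasing, so its value at [b i.+1] is the least on []b i.+2, b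
    i.+1]]. *)
Let g_sum n : (\sum_(i < n) (g (b i.+1) * (b i.+1 - b i.+2))%:E <=
  \int[@lebesgue_measure R]_(x in `]b n.+1, c]) (g x)%:E)%E.
Proof.
elim: n => [|n IH].
  by rewrite big_ord0; apply: integral_ge0 => x /=; rewrite in_itv /= => /andP[h1 h2];
    rewrite lee_fin g_ge0 // h2 (lt_trans _ h1) //; case/andP: (b_c 0).
rewrite big_ord_recr /=.
have /andP[b1 b2] := b_c n.
have /andP[b3 b4] := b_c n.+1.
have bb := b_ltS n.+1.
have mg1 : measurable_fun `]b n.+2, b n.+1] g.
  apply: g_meas => // x /=; rewrite !in_itv /= => /andP[h1 h2].
  by rewrite (lt_trans b3 h1) (le_trans h2 b2).
have -> : `]b n.+2, c] = `]b n.+2, b n.+1] `|` `]b n.+1, c].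
  by rewrite -itv_bndbnd_setU // bnd_simp // ltW.
rewrite ge0_integral_setU //=.
- rewrite addeC leeD //.
  apply: integral_itv_ge => //; first exact: ltW.
    by apply: g_ge0; rewrite b1.
  move=> x /andP[h1 h2]; apply: g_anti => //; exact: lt_trans h1.
- apply/measurable_EFinP; apply: g_meas; [exact: measurableU|move=> x /= [] /=]; rewrite !in_itv /= => /andP[h1 h2].
    by rewrite (lt_trans b3 h1) (le_trans h2 b2).
  by rewrite h2 (lt_trans b1 h1).
- move=> x [] /=; rewrite !in_itv /= => /andP[h1 h2]; rewrite lee_fin g_ge0 //.
    by rewrite (lt_trans b3 h1) (le_trans h2 b2).
  by rewrite h2 (lt_trans b1 h1).
- apply/disj_setPS => x [] /=; rewrite !in_itv /= => /andP[h1 h2] /andP[h3 h4].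
  by have := lt_le_trans h3 h2; rewrite ltxx.
Qed.

(** Distortion needs the upper sum, with [g] at the left end of each interval. The derivative bound
    [Lam] makes each gap of the orbit at most [Lam] times the next one, which turns the upper sum
    into a lower sum with shifted index. *)
Let g_sum_bounded : exists2 D0, 0 <= D0 &
  forall n, \sum_(i < n) g (b i.+2) * (b i.+1 - b i.+2) <= D0.
Proof.
have [Lam L0 hL] := dTL_bounded.
set G := (\int[@lebesgue_measure R]_(x in `]0%R, c]) (g x)%:E)%E.
have G0 : (0 <= G)%E.
  by apply: integral_ge0 => x /=; rewrite in_itv /= => hx; rewrite lee_fin g_ge0.
have Gf : G = (fine G)%:E by rewrite fineK // ge0_fin_numE.
exists (Lam * fine G); first by rewrite mulr_ge0 // fine_ge0.
move=> n.
apply: (@le_trans _ _ (Lam * \sum_(i < n.+1) g (b i.+1) * (b i.+1 - b i.+2))).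
  rewrite mulr_sumr big_ord_recl /= -[leLHS]add0r; apply: lerD.
    apply: mulr_ge0 => //; apply: mulr_ge0; first exact: (g_ge0 (b_c 0)).
    by rewrite subr_ge0; exact: (ltW (b_ltS 1)).
  apply: ler_sum => i _; rewrite mulrCA; apply: ler_wpM2l; first exact: (g_ge0 (b_c i.+1)).
  have /andP[h1 h2] := b_c i.+1; have /andP[h3 h4] := b_c i.+2.
  have [z /andP[z1 z2] E] := TL_MVT h3 (ltW (b_ltS i.+2)) h2.
  rewrite !TL_b in E.
  change (b i.+1 - b i.+2 <= Lam * (b i.+2 - b i.+3)); rewrite E.
  apply: ler_wpM2r; first by rewrite subr_ge0; exact: (ltW (b_ltS i.+2)).
  by apply: hL; rewrite (lt_le_trans h3 z1) (le_trans z2).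
apply: ler_wpM2l => //; rewrite -lee_fin -Gf -sumEFin.
apply: le_trans (g_sum _) _; have /andP[h1 h2] := b_c n.+1.
apply: ge0_subset_integral => //.
- by apply/measurable_EFinP; exact: g_meas.
- move=> x /=; rewrite !in_itv /= => /andP[h3 ->]; rewrite andbT; exact: lt_trans h3.
Qed.

Let LL j x := orbitL psiL j x.

Let LL_c j : LL j c = b j.+1.
Proof. by rewrite /LL /b /orbitL iterSr psiL1. Qed.

Let LL_S j x : LL j.+1 x = psiL (LL j x). Proof. by []. Qed.

Let LL_range j x : c <= x <= 1 -> b j.+1 <= LL j x <= b j.
Proof.
move=> /andP[cx x1]; elim: j => [|j /andP[h1 h2]].
  by rewrite b_1 cx x1.
have /andP[h3 _] := b_range j.+1; have /andP[_ h4] := b_range j.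
rewrite LL_S; apply/andP; split.
  exact: (psiL_le (ltW h3) h1 (le_trans h2 h4)).
exact: (psiL_le (le_trans (ltW h3) h1) h2 h4).
Qed.

Let LL01 j x : c <= x <= 1 -> 0 <= LL j x <= 1.
Proof.
move=> /LL_range - /(_ j) /andP[h1 h2].
have /andP[h3 _] := b_range j.+1; have /andP[_ h4] := b_range j.
by rewrite (le_trans (ltW h3) h1) (le_trans h2).
Qed.

Let LL_lt j x y : c <= x -> x < y -> y <= 1 -> LL j x < LL j y.
Proof.
move=> cx xy y1; elim: j => [//|j IH]; rewrite !LL_S.
have /andP[h1 _] : 0 <= LL j x <= 1 by apply: LL01; rewrite cx (le_trans (ltW xy)).
have /andP[_ h2] : 0 <= LL j y <= 1 by apply: LL01; rewrite y1 (le_trans cx) ?ltW.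
exact: psiL_lt.
Qed.

Let LL_le j x y : c <= x -> x <= y -> y <= 1 -> LL j x <= LL j y.
Proof.
move=> cx; rewrite le_eqVlt => /orP[/eqP ->//|xy] y1.
by apply: ltW; exact: LL_lt.
Qed.

Let LL_contr j x y : c <= x -> x <= y -> y <= 1 -> LL j y - LL j x <= y - x.
Proof.
move=> cx xy y1; elim: j => [//|j IH]; rewrite !LL_S.
apply: le_trans IH; apply: psiL_contr.
- by have /andP[] : 0 <= LL j x <= 1 by apply: LL01; rewrite cx (le_trans xy).
- exact: LL_le.
- by have /andP[] : 0 <= LL j y <= 1 by apply: LL01; rewrite y1 (le_trans cx).
Qed.

(** The distortions of the [j] steps multiply. At step [i] the images lie above [b i.+2], where the
    derivative of [TL] is Lipschitz with constant [g (b i.+2)]. *)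
Let LL_dist j p r X1 X2 Y1 Y2 :
  c <= p -> p <= X1 -> X1 <= X2 -> X2 <= r -> p <= Y1 -> Y1 <= Y2 -> Y2 <= r -> r <= 1 ->
  (LL j X2 - LL j X1) * (Y2 - Y1) <=
  expR (\sum_(i < j) g (b i.+2) * (LL i.+1 r - LL i.+1 p)) * ((LL j Y2 - LL j Y1) * (X2 - X1)).
Proof.
move=> cp pX1 X12 X2r pY1 Y12 Y2r r1.
have cX1 := le_trans cp pX1; have cY1 := le_trans cp pY1.
have X21 := le_trans X2r r1; have Y21 := le_trans Y2r r1.
have pr : p <= r by rewrite (le_trans pX1) // (le_trans X12).
elim: j => [|j IH].
  by rewrite big_ord0 expR0 mul1r mulrC.
rewrite big_ord_recr /= expRD !LL_S.
have rngp : c <= p <= 1 by rewrite cp (le_trans pr).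
have rngr : c <= r <= 1 by rewrite r1 (le_trans cp).
have := @inv_branch_dist _ fL 0 c (ltW c_gt0) fL_0 fL_c fL_lt fL_onto (derive1 TL) (g (b j.+2))
  (LL j p) (LL j r) (LL j X1) (LL j X2) (LL j Y1) (LL j Y2).
rewrite -/psiL -!LL_S.
have /andP[b1 b2] := b_c j.+1.
have /andP[b3 b4] := b_c j.
have /andP[r1' r2] := LL_range j.+1 rngp.
have /andP[r3 r4] := LL_range j.+1 rngr.
have sub z : LL j.+1 p <= z <= LL j.+1 r -> b j.+2 <= z <= b j.+1.
  by move=> /andP[h1 h2]; rewrite (le_trans r1' h1) (le_trans h2 r4).
have sub0 z : LL j.+1 p <= z <= LL j.+1 r -> 0 < z <= c.
  by move=> /sub /andP[h1 h2]; rewrite (lt_le_trans b1 h1) (le_trans h2 b4).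
have /andP[p0 _] := LL01 j rngp; have /andP[_ r01] := LL01 j rngr.
have := LL_le j cp pX1 (le_trans X12 X21).
have := LL_le j cX1 X12 X21.
have := LL_le j (le_trans cX1 X12) X2r r1.
have := LL_le j cp pY1 (le_trans Y12 Y21).
have := LL_le j cY1 Y12 Y21.
have := LL_le j (le_trans cY1 Y12) Y2r r1.
move=> k1 k2 k3 k4 k5 k6.
move=> /(_ _ _ _ _ p0 k6 k5 k4 k3 k2 k1 r01) h.
have {}h : (LL j.+1 X2 - LL j.+1 X1) * (LL j Y2 - LL j Y1) <=
     expR (g (b j.+2) * (LL j.+1 r - LL j.+1 p)) *
     ((LL j.+1 Y2 - LL j.+1 Y1) * (LL j X2 - LL j X1)).
  apply: h.
  - by apply: g_ge0; rewrite b1.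
  - move=> x y px xy yr.
    have /andP[x0 _] : 0 < x <= c by apply: sub0; rewrite px (le_trans xy).
    have /andP[y0 yc] : 0 < y <= c by apply: sub0; rewrite yr (le_trans px).
    by rewrite !fL_gt0 //; exact: TL_MVT.
  - by move=> x /sub0 hx; apply/ltW/dTL_gt1.
  - have [eta eta0 C] := TL_C2.
    move=> x y /sub hx /sub hy.
    apply: (C2_lip C _ _ hx hy) => z /andP[h1 h2].
      rewrite /= in_itv /=; apply/andP; split; [exact: lt_le_trans h1|].
      by apply: le_lt_trans h2 _; apply: le_lt_trans b4 _; lra.
    apply: (le_trans (TL_g _)) => /=.
      by rewrite in_itv /= (lt_le_trans b1 h1) (le_trans h2 b4).
    by apply: g_anti => //; exact: le_trans b4.
move: (Y12); rewrite le_eqVlt => /orP[/eqP ->|Y12s]; first by rewrite !subrr !(mul0r, mulr0).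
have W0 : 0 < LL j Y2 - LL j Y1 by rewrite subr_gt0; exact: LL_lt.
rewrite -(ler_pM2r W0).
have M0 : 0 <= Y2 - Y1 by rewrite subr_ge0.
have V0 : 0 <= LL j.+1 Y2 - LL j.+1 Y1 by rewrite subr_ge0; exact: LL_le.
move: IH h W0 M0 V0; rewrite -?LL_S.
set E1 := expR (\sum_(i < j) _); set E2 := expR (g _ * _).
have E20 : 0 <= E2 by exact: expR_ge0.
move: E1 E2 E20 (LL j Y2 - LL j Y1) (LL j X2 - LL j X1) (LL j.+1 Y2 - LL j.+1 Y1) (LL j.+1 X2 - LL j.+1 X1) (Y2 - Y1) (X2 - X1).
move=> E1 E2 E20 W U V A M L IH h W0 M0 V0.
have s1 := ler_wpM2r M0 h.
have s2 : E2 * V * (U * M) <= E2 * V * (E1 * (W * L)) by rewrite ler_wpM2l // mulr_ge0.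
lra.
Qed.

Let TR_data : exists kappa, exists D, [/\ 0 <= kappa, kappa < 1, 0 <= D,
  forall x y, 0 <= x -> x <= y -> y <= 1 -> psiR y - psiR x <= kappa * (y - x) &
  forall P Q X1 X2 Y1 Y2, 0 <= P -> P <= X1 -> X1 <= X2 -> X2 <= Q ->
    P <= Y1 -> Y1 <= Y2 -> Y2 <= Q -> Q <= 1 ->
  (psiR X2 - psiR X1) * (Y2 - Y1) <=
    expR (D * (Q - P)) * ((psiR Y2 - psiR Y1) * (X2 - X1))].
Proof.
have [rho r1 hr] := TR_exp.
have [eta eta0 C] := TR_C2.
have sub z : c <= z <= 1 -> `]c - eta, 1 + eta[ z.
  by move=> /andP[h1 h2]; rewrite /= in_itv /=; apply/andP; split; lra.
have [B B0 hB] := C2_bound2 (ltW c_lt1) C sub.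
exists rho^-1, B; split => //.
- by rewrite invr_ge0; lra.
- by rewrite invf_lt1 //; lra.
- by move=> x y x0 xy y1; exact: psiR_contr.
move=> P Q X1 X2 Y1 Y2 P0 PX1 X12 X2Q PY1 Y12 Y2Q Q1.
have PQ : P <= Q by rewrite (le_trans PX1) // (le_trans X12).
have P1 := le_trans PQ Q1; have Q0 := le_trans P0 PQ.
have [/andP[p1 p2] _] := psiRP (introT andP (conj P0 P1)).
have [/andP[q1 q2] _] := psiRP (introT andP (conj Q0 Q1)).
have subP z : psiR P <= z <= psiR Q -> c <= z <= 1.
  by move=> /andP[h1 h2]; rewrite (le_trans p1 h1) (le_trans h2 q2).
have := @inv_branch_dist _ TR c 1 (ltW c_lt1) TR_c TR_1 TR_lt TR_onto' (fun z => `|(derive1 TR) z|) B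
  P Q X1 X2 Y1 Y2 B0.
rewrite -/psiR => /(_ _ _ _ P0 PX1 X12 X2Q PY1 Y12 Y2Q Q1) h.
apply: (@le_trans _ _ (expR (B * (psiR Q - psiR P)) * ((psiR Y2 - psiR Y1) * (X2 - X1)))).
  apply: h.
  - move=> x y px xy yq; apply: TR_MVT_abs => //.
      by have /andP[] : c <= x <= 1 by apply: subP; rewrite px (le_trans xy).
    by have /andP[] : c <= y <= 1 by apply: subP; rewrite yq (le_trans px).
  - move=> x /subP hx; apply: le_trans (ltW r1) _; apply: hr.
    by rewrite /= in_itv.
  - move=> x y /subP hx /subP hy; apply: le_trans (ler_dist_dist _ _) _.
    exact: (C2_lip C sub hB).
apply: ler_wpM2r.
  by rewrite mulr_ge0 // subr_ge0 // psiR_le // ?(le_trans P0) // (le_trans Y2Q).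
rewrite ler_expR ler_wpM2l //.
apply: le_trans (psiR_contr r1 hr P0 PQ Q1) _.
rewrite ler_piMl ?subr_ge0 // invf_le1; lra.
Qed.

(** Regularity asks for an exponent proportional to [r - p], not merely bounded, so the estimate is
    run twice: the crude exponent [D0] shows that [LL j r - LL j p] is at most a constant times
    [(b j - b j.+1) * (r - p)], and inserting this into the exponent gives [D1 * (r - p)]. *)
Let branches_full : exists kappa, exists D, full_branches c (orbit_psi psiL psiR) kappa D.
Proof.
have [kap [DR [k0 k1 DR0 hk hD]]] := TR_data.
have [D0 D00 hD0] := g_sum_bounded.
have c1 : 0 < 1 - c by rewrite subr_gt0.
pose D1 := D0 * expR D0 / (1 - c).
have D10 : 0 <= D1 by rewrite !mulr_ge0 ?expR_ge0 // invr_ge0 ltW.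
have crude j p r : c <= p -> p <= r -> r <= 1 ->
    \sum_(i < j) g (b i.+2) * (LL i.+1 r - LL i.+1 p) <= D0.
  move=> cp pr r1; apply: le_trans (hD0 j); apply: ler_sum => i _.
  have /andP[h1 h2] := b_c i.+1.
  apply: ler_wpM2l; first by apply: g_ge0; rewrite h1.
  have /andP[h3 h4] := @LL_range i.+1 p (introT andP (conj cp (le_trans pr r1))).
  have /andP[h5 h6] := @LL_range i.+1 r (introT andP (conj (le_trans cp pr) r1)).
  by apply: lerB.
have len j p r : c <= p -> p <= r -> r <= 1 ->
    LL j r - LL j p <= expR D0 * (b j - b j.+1) / (1 - c) * (r - p).
  move=> cp pr r1.
  have := @LL_dist j c 1 p r c 1 (lexx _) cp pr r1 (lexx _) (ltW c_lt1) (lexx _) (lexx _).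
  rewrite LL_c -/(b j) => h.
  rewrite mulrAC ler_pdivlMr //; apply: le_trans h _.
  rewrite -!mulrA; apply: ler_wpM2r.
    by rewrite mulr_ge0 ?subr_ge0 // ltW.
  by rewrite ler_expR; apply: crude => //; exact: ltW.
have fine_sum j p r : c <= p -> p <= r -> r <= 1 ->
    \sum_(i < j) g (b i.+2) * (LL i.+1 r - LL i.+1 p) <= D1 * (r - p).
  move=> cp pr r1.
  apply: (@le_trans _ _ (\sum_(i < j) (g (b i.+2) * (b i.+1 - b i.+2)) * (expR D0 / (1 - c) * (r - p)))).
    apply: ler_sum => i _.
    have /andP[h1 h2] := b_c i.+1.
    have := len i.+1 p r cp pr r1.
    have g0 : 0 <= g (b i.+2) by apply: g_ge0; rewrite h1.
    move/(ler_wpM2l g0); lra.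
  rewrite -mulr_suml /D1.
  have -> : D0 * expR D0 / (1 - c) * (r - p) = D0 * (expR D0 / (1 - c) * (r - p)) by ring.
  apply: ler_wpM2r; last exact: hD0.
  by rewrite mulr_ge0 ?subr_ge0 // divr_ge0 ?expR_ge0 // ltW.
exists kap, (DR + D1); split => //.
- exact: ltW.
- move=> j x y cx xy y1; rewrite /orbit_psi.
  have /andP[h1 _] : 0 <= LL j x <= 1 by apply: LL01; rewrite cx (le_trans (ltW xy)).
  have /andP[_ h2] : 0 <= LL j y <= 1 by apply: LL01; rewrite y1 (le_trans cx (ltW xy)).
  by apply: psiR_lt => //; exact: LL_lt.
- by move=> j x hx; rewrite /orbit_psi; have [] := psiRP (LL01 j hx).
- by move=> j; rewrite /orbit_psi -/(LL j c) LL_c.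
- move=> eps e0; have [n hn] := b_cvg e0.
  exists n => j nj; rewrite /orbit_psi -/(b j) -{1}psiR0.
  have /andP[h1 h2] := b_range j.
  apply: le_lt_trans (hk _ _ (lexx 0) (ltW h1) h2) _; rewrite subr0.
  by apply: le_lt_trans (hn j nj); rewrite ler_piMl // ltW.
- move=> j x y cx xy y1; rewrite /orbit_psi.
  have /andP[h1 _] : 0 <= LL j x <= 1 by apply: LL01; rewrite cx (le_trans xy).
  have /andP[_ h2] : 0 <= LL j y <= 1 by apply: LL01; rewrite y1 (le_trans cx xy).
  apply: le_trans (hk _ _ h1 (LL_le j cx xy y1) h2) _.
  by apply: ler_wpM2l => //; exact: LL_contr.
- exact: addr_ge0.
move=> j p r x1 x2 y1 y2 cp px1 x12 x2r py1 y12 y2r r1; rewrite mul1r /orbit_psi.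
rewrite -/(LL j x1) -/(LL j x2) -/(LL j y1) -/(LL j y2).
have cx1 := le_trans cp px1; have cy1 := le_trans cp py1.
have x21 := le_trans x2r r1; have y21 := le_trans y2r r1.
have pr : p <= r by rewrite (le_trans px1) // (le_trans x12).
have /andP[p0 _] := @LL01 j p (introT andP (conj cp (le_trans pr r1))).
have /andP[_ r01] := @LL01 j r (introT andP (conj (le_trans cp pr) r1)).
have h1 := hD _ _ _ _ _ _ p0 (LL_le j cp px1 (le_trans x12 x21)) (LL_le j cx1 x12 x21)
  (LL_le j (le_trans cx1 x12) x2r r1) (LL_le j cp py1 (le_trans y12 y21)) (LL_le j cy1 y12 y21)
  (LL_le j (le_trans cy1 y12) y2r r1) r01.
have h2 := LL_dist j cp px1 x12 x2r py1 y12 y2r r1.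
have h3 := fine_sum j p r cp pr r1.
move: (y12); rewrite le_eqVlt => /orP[/eqP ->|y12s]; first by rewrite !subrr !(mul0r, mulr0).
have W0 : 0 < LL j y2 - LL j y1 by rewrite subr_gt0; exact: LL_lt.
have M0 : 0 <= y2 - y1 by rewrite subr_ge0.
have V0 : 0 <= psiR (LL j y2) - psiR (LL j y1).
  rewrite subr_ge0; apply: psiR_le; last 1 first.
  - by have /andP[] := @LL01 j y2 (introT andP (conj (le_trans cy1 y12) y21)).
  - by have /andP[] := @LL01 j y1 (introT andP (conj cy1 (le_trans y12 y21))).
  - exact: LL_le.
have L0 : 0 <= x2 - x1 by rewrite subr_ge0.
have U0 : 0 <= LL j x2 - LL j x1 by rewrite subr_ge0; exact: LL_le.
rewrite -(ler_pM2r W0).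
have -> : expR ((DR + D1) * (r - p)) = expR (DR * (r - p)) * expR (D1 * (r - p)).
  by rewrite -expRD; congr expR; ring.
set E1 := expR (DR * _); set E2 := expR (D1 * _).
have e1 : expR (DR * (LL j r - LL j p)) <= E1.
  by rewrite ler_expR ler_wpM2l // LL_contr.
have e2 : expR (\sum_(i < j) g (b i.+2) * (LL i.+1 r - LL i.+1 p)) <= E2 by rewrite ler_expR.
have E10 : 0 <= E1 by exact: expR_ge0.
move: h1 h2 e1 e2 W0 M0 V0 L0 U0 E10.
move: (expR (\sum_(i < j) _)) (expR (DR * _)) E1 E2 => F2 F1 E1 E2.
move: (LL j y2 - LL j y1) (LL j x2 - LL j x1) (psiR (LL j y2) - _) (psiR (LL j x2) - _) (y2 - y1) (x2 - x1).
move=> W U V A M L h1 h2 e1 e2 W0 M0 V0 L0 U0 E10.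
have s1 := ler_wpM2r M0 h1.
have VU0 : 0 <= V * U * M by rewrite !mulr_ge0.
have s2 := ler_wpM2r VU0 e1.
have E1V0 : 0 <= E1 * V by rewrite mulr_ge0.
have s3 := ler_wpM2l E1V0 h2.
have EVWL : 0 <= E1 * V * W * L by rewrite !mulr_ge0 // ltW.
have s4 := ler_wpM2r EVWL e2.
lra.
Qed.

Let dR_gt0 : 0 < (derive1 TR) c.
Proof.
have [rho r1 hr] := TR_exp; have [eta eta0 C] := TR_C2.
have sub z : c <= z <= 1 -> `]c - eta, 1 + eta[ z.
  by move=> /andP[h1 h2]; rewrite /= in_itv /=; apply/andP; split; lra.
have [B B0 hB] := C2_bound2 (ltW c_lt1) C sub.
have hc : rho <= `|(derive1 TR) c| by apply: hr; rewrite /= in_itv /= lexx ltW.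
rewrite ltNge; apply/negP => d0.
rewrite ler0_norm // in hc.
(* A nonpositive derivative at [c] would be at most [- rho < - 1]; over the length [u] it varies by
   at most [B * u <= 1], so it would stay negative and [TR] would decrease. *)
pose u := Num.min (1 - c) (1 / (B + 1)).
have u0 : 0 < u by rewrite /u lt_min subr_gt0 c_lt1 divr_gt0 //; lra.
have u1 : u <= 1 - c by rewrite /u ge_min lexx.
have Bu : B * u <= 1.
  have : u <= 1 / (B + 1) by rewrite /u ge_min lexx orbT.
  rewrite ler_pdivlMr; lra.
have [z /andP[z1 z2] E] := @TR_MVT c (c + u) (lexx _) ltac:(lra) ltac:(lra).
have cc : c <= c <= 1 by rewrite lexx ltW.
have hz : c <= z <= 1 by apply/andP; split; lra.
have := C2_lip C sub hB hz cc; have zc : 0 <= z - c by lra.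
rewrite [`|z - c|]ger0_norm // => h.
have := TR_lt (lexx c) (_ : c < c + u) (_ : c + u <= 1); move=> /(_ ltac:(lra) ltac:(lra)).
have := ler_norm ((derive1 TR) z - (derive1 TR) c).
have : B * (z - c) <= B * u by rewrite ler_wpM2l //; lra.
have := TR_c; nra.
Qed.

Lemma branches_indiff_map : exists L, exists R', exists kappa, exists D,
  indiff_map c T L R' kappa D ((derive1 TR) c).
Proof.
have [kap [D fb]] := branches_full.
exists psiL, psiR, kap, D; split => //.
- move=> z hz; have hz' : `]0, c[ z by rewrite /= in_itv.
  rewrite -TLE //; split; first exact: TL01.
  case/andP: hz => z0 zc; rewrite -fL_gt0 //.
  by apply: inv_branchK => //; rewrite ?ltW.
- move=> z hz; have hz' : `]c, 1[ z by rewrite /= in_itv.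
  rewrite -TRE //; split; first exact: TR01.
  case/andP: hz => z0 zc.
  by apply: inv_branchK => //; rewrite ?ltW.
- move=> eps e0.
  have [del del0 hd] : exists2 del, 0 < del & forall x, 0 < x < del -> (derive1 TL) x <= 1 + eps.
    move/cvgrPdist_lt : TL_tan => /(_ eps e0) [d /= d0 hd].
    exists d => // x /andP[x0 xd].
    have := hd x; rewrite /ball /= sub0r normrN gtr0_norm // => /(_ xd x0).
    rewrite ltr_norml => /andP[]; lra.
  exists (Num.min del 1); first by rewrite lt_min del0 ltr01.
  move=> x; rewrite lt_min => /andP[x0 /andP[xd x1]].
  have hx : 0 <= x <= 1 by rewrite !ltW.
  have [/andP[p0 p1] p2] := psiLP hx.
  set u := psiL x in p0 p1 p2 *.
  have u0 : 0 < u.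
    by rewrite lt_neqAle p0 andbT; apply/eqP => uE; rewrite -uE fL_0 in p2; lra.
  rewrite fL_gt0 // in p2.
  have ux : u <= x by have := psiL_contr (lexx 0) (ltW x0) (ltW x1); rewrite psiL0 !subr0.
  rewrite leNgt; apply/negP => hlt.
  (* The orbit point [b n.+1], whose image [b n] is known and tiny, serves as left end for the mean
     value theorem in place of [0]. *)
  have [n hn] := @b_cvg (Num.min u (x - (1 + eps) * u)) ltac:(by rewrite lt_min u0 subr_gt0).
  have := hn n (leqnn n); rewrite lt_min => /andP[_ h1].
  have := hn n.+1 (leqnSn n); rewrite lt_min => /andP[h2 _].
  have /andP[h3 _] := b_c n.
  have [z /andP[z1 z2]] := TL_MVT h3 (ltW h2) p1; rewrite p2 TL_b => E.
  have : (derive1 TL) z <= 1 + eps.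
    by apply: hd; rewrite (lt_le_trans h3 z1) (le_lt_trans z2) // (le_lt_trans ux).
  nra.
- move=> eps e0; have [eta eta0 C] := TR_C2.
  have sub z : c <= z <= 1 -> `]c - eta, 1 + eta[ z.
    by move=> /andP[h1 h2]; rewrite /= in_itv /=; apply/andP; split; lra.
  have [B B0 hB] := C2_bound2 (ltW c_lt1) C sub.
  set d := (derive1 TR) c.
  have d0 : 0 < d by exact: dR_gt0.
  exists (Num.min 1 (eps * d / (B + 1))).
    by rewrite lt_min ltr01 divr_gt0 ?mulr_gt0 //; lra.
  move=> x; rewrite lt_min => /andP[x0 /andP[x1 xe]].
  have [rho r1 hr] := TR_exp.
  have hx : 0 <= x <= 1 by rewrite !ltW.
  have [/andP[p0 p1] p2] := psiRP hx.
  have := psiR_contr r1 hr (lexx 0) (ltW x0) (ltW x1); rewrite psiR0 subr0.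
  set v := psiR x in p0 p1 p2 * => vx.
  have {}vx : v - c <= x.
    by apply: le_trans vx _; rewrite ler_piMl ?ltW // invf_lt1 //; lra.
  have [z /andP[z1 z2]] := TR_MVT (lexx c) p0 p1; rewrite p2 TR_c subr0 => E.
  have cc : c <= c <= 1 by rewrite lexx ltW.
  have hz : c <= z <= 1 by rewrite z1 (le_trans z2).
  have := C2_lip C sub hB cc hz; rewrite -/d => h.
  have -> : v - c - x / d = (d - (derive1 TR) z) * (v - c) / d.
    by rewrite E; field; rewrite gt_eqF.
  have vc : 0 <= v - c by rewrite subr_ge0.
  rewrite !normrM [`|v - c|]ger0_norm // [`|d^-1|]gtr0_norm ?invr_gt0 //.
  rewrite ler_pdivrMr //.
  have zc : `|c - z| <= x by rewrite ler0_norm; lra.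
  have {}h : `|d - (derive1 TR) z| <= eps * d.
    apply: le_trans h _; apply: (@le_trans _ _ (B * x)); first by rewrite ler_wpM2l.
    by move: xe; rewrite ltr_pdivlMr; nra.
  have : `|d - (derive1 TR) z| * (v - c) <= eps * d * x by apply: ler_pM.
  lra.
Qed.

End Branches.

(** * The invariant measure *)

(** [T] is constrained on [[0, 1]] only, so preimages can be expected to be measurable only within
    [[0, 1]]. *)
Definition msr (R : realType) (A : set R) : Prop := measurable (A `&` `[0, 1]).

Record acim (R : realType) (T : R -> R) (m : set R -> R) : Prop := {
  acim_ge0 : forall A, msr A -> 0 <= m A;
  acim_add : forall A B, msr A -> msr B ->
    (forall z, 0 <= z <= 1 -> A z -> B z -> False) -> m (A `|` B) = m A + m B;
  acim_ext : forall A B N, msr A -> msr B -> countable N ->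
    (forall z, 0 <= z <= 1 -> ~ N z -> (A z <-> B z)) -> m A = m B;
  acim_pre : forall A, msr A -> msr (T @^-1` A);
  acim_inv : forall A, msr A -> m (T @^-1` A) = m A;
  acim_setT : m setT = 1 }.

Section Msr.
Variable R : realType.
Implicit Types A B : set R.

Lemma msr_measurable A : measurable A -> msr A.
Proof. by move=> mA; apply: measurableI. Qed.

Lemma msrI A B : msr A -> msr B -> msr (A `&` B).
Proof. by move=> mA mB; rewrite /msr setIIl; apply: measurableI. Qed.

Lemma msrU A B : msr A -> msr B -> msr (A `|` B).
Proof. by move=> mA mB; rewrite /msr setIUl; apply: measurableU. Qed.

Lemma msrC A : msr A -> msr (~` A).
Proof.
move=> mA; rewrite /msr.
have -> : ~` A `&` `[0, 1] = `[0, 1] `\` (A `&` `[0, 1]).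
  apply/seteqP; split => x /= [h1 h2]; split => //; first by case.
  by move=> Ax; apply: h2.
by apply: measurableD.
Qed.

Lemma msr_itv (i : interval R) : msr [set` i].
Proof. by apply: msr_measurable; exact: measurable_itv. Qed.

Lemma msr_le x : msr [set z : R | z <= x].
Proof.
have -> : [set z : R | z <= x] = `]-oo, x] by apply/seteqP; split => z /=; rewrite in_itv.
exact: msr_itv.
Qed.

Lemma msr_oc x y : msr [set z : R | x < z <= y].
Proof.
have -> : [set z : R | x < z <= y] = `]x, y] by apply/seteqP; split => z /=; rewrite in_itv.
exact: msr_itv.
Qed.

End Msr.

(** * The measure with density [h] and its distribution function *)

Section DensMeasure.
Variables (R : realType) (h : R -> R).
Hypothesis h_ge0 : forall x, `]0, 1[ x -> 0 <= h x.
Hypothesis h_cont : {within `]0, 1[, continuous h}.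
Hypothesis h_mass : dens_measure h `[0, 1] = 1%E.
Local Notation leb := (@lebesgue_measure R).

(** The hypotheses on [h] concern the open interval; setting the other values to [0] makes the
    density nonnegative everywhere and leaves the measure on [[0, 1]] unchanged. *)
Definition inner_density (x : R) : R := if 0 < x < 1 then h x else 0.
Local Notation h0 := inner_density.

Lemma inner_densityE x : 0 < x < 1 -> h0 x = h x.
Proof. by rewrite /inner_density => ->. Qed.

Lemma inner_density_ge0 x : 0 <= h0 x.
Proof.
by rewrite /inner_density; case: ifP => // hx; apply: h_ge0; rewrite /= in_itv.
Qed.

Lemma measurable_density : measurable_fun (`[0, 1] : set R) h.
Proof.
apply: (@measurable_fun_itv_cc _ 0 1 false true h).
exact: subspace_continuous_measurable_fun.
Qed.

Lemma measurable_inner_density : measurable_fun (`[0, 1] : set R) h0.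
Proof.
apply: (@measurable_fun_itv_cc _ 0 1 false true h0).
apply: (@eq_measurable_fun _ _ _ _ _ h).
  by move=> x; rewrite inE /= in_itv /= => hx; rewrite inner_densityE.
exact: subspace_continuous_measurable_fun.
Qed.

Lemma dens_inner A : msr A -> dens_measure h A = (\int[leb]_(x in A `&` `[0%R, 1%R]) (h0 x)%:E)%E.
Proof.
move=> mA; rewrite /dens_measure; apply: ae_eq_integral => //.
- apply/measurable_EFinP; apply: measurable_funS measurable_density => //.
- apply/measurable_EFinP; apply: measurable_funS measurable_inner_density => //.
exists [set 0; 1]; split.
- by apply: measurableU.
- apply: countable_lebesgue_measure0; apply: finite_set_countable.
  by rewrite finite_setU; split.
move=> x /= /not_implyP[[Ax]]; rewrite in_itv /= => /andP[x0 x1] hx.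
apply: contrapT => hn; apply: hx; rewrite inner_densityE //.
rewrite !lt_neqAle x0 x1 !andbT; apply/andP; split.
  by apply/eqP => E; apply: hn; left.
by apply/eqP => E; apply: hn; right.
Qed.

Let m A := fine (dens_measure h A).

Let measurable_h0_sub A : msr A -> measurable_fun (A `&` `[0, 1] : set R) (fun x => (h0 x)%:E).
Proof.
move=> mA; apply/measurable_EFinP.
by apply: measurable_funS measurable_inner_density.
Qed.

Lemma dens_ge0 A : msr A -> (0 <= dens_measure h A)%E.
Proof.
by move=> mA; rewrite dens_inner //; apply: integral_ge0 => x _; rewrite lee_fin inner_density_ge0.
Qed.

Lemma msrT : msr [set: R]. Proof. exact: msr_measurable. Qed.

Lemma dens_setT : dens_measure h [set: R] = 1%E.
Proof. by rewrite -h_mass /dens_measure setTI setIid. Qed.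

Lemma dens_le A B : msr A -> msr B -> (forall z, 0 <= z <= 1 -> A z -> B z) ->
  (dens_measure h A <= dens_measure h B)%E.
Proof.
move=> mA mB AB; rewrite !dens_inner //; apply: ge0_subset_integral => //.
- exact: measurable_h0_sub.
- by move=> x _; rewrite lee_fin inner_density_ge0.
- by move=> x /= [Ax x01]; split => //; apply: AB => //; move: x01; rewrite in_itv.
Qed.

Lemma dens_fin A : msr A -> dens_measure h A = (fine (dens_measure h A))%:E.
Proof.
move=> mA; rewrite fineK // ge0_fin_numE ?dens_ge0 //.
apply: le_lt_trans (dens_le mA msrT _) _ => //.
by rewrite dens_setT ltry.
Qed.

Lemma dens_add A B : msr A -> msr B -> (forall z, 0 <= z <= 1 -> A z -> B z -> False) ->
  m (A `|` B) = m A + m B.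
Proof.
move=> mA mB AB; rewrite /m -fineD -?dens_fin //; last 2 first.
- by rewrite dens_fin.
- by rewrite dens_fin.
rewrite !dens_inner //; last exact: msrU.
congr fine; rewrite setIUl ge0_integral_setU //.
- by rewrite -setIUl; apply: measurable_h0_sub; exact: msrU.
- by move=> x _; rewrite lee_fin inner_density_ge0.
- apply/disj_setPS => x [[Ax x01] [Bx _]]; apply: (AB x) => //.
Qed.

Lemma dens_ext A B N : msr A -> msr B -> countable N ->
  (forall z, 0 <= z <= 1 -> ~ N z -> (A z <-> B z)) -> m A = m B.
Proof.
move=> mA mB cN AB; rewrite /m !dens_inner //; congr fine.
have mN : measurable N by apply: countable_measurable => //.
have N0 : leb N = 0%E by exact: countable_lebesgue_measure0.
have restr C : msr C -> (\int[leb]_(x in C `&` `[0%R, 1%R]) (h0 x)%:E =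
    \int[leb]_(x in (C `&` `[0%R, 1%R]) `\` N) (h0 x)%:E)%E.
  move=> mC; apply: ge0_negligible_integral => //.
    exact: measurable_h0_sub.
  by move=> x _; rewrite lee_fin inner_density_ge0.
rewrite !restr //.
suff -> : (A `&` `[0, 1]) `\` N = (B `&` `[0, 1]) `\` N by [].
apply/seteqP; split => x /= [[Ax]]; rewrite in_itv /= => x01 Nx; split => //; split => //;
  by apply/(AB x x01 Nx).
Qed.

Variables (c : R) (T : R -> R).
Hypothesis c01 : 0 < c < 1.
Hypothesis T01 : forall x, `[0, 1] x -> `[0, 1] (T x).
Hypothesis TL_cont : {within `]0, c[, continuous T}.
Hypothesis TR_cont : {within `]c, 1[, continuous T}.
Hypothesis h_inv : forall A : set R, measurable A -> A `<=` `[0, 1] ->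
  dens_measure h (T @^-1` A) = dens_measure h A.

Lemma msr_preimage A : msr A -> msr (T @^-1` A).
Proof.
move=> mA; rewrite /msr.
have -> : T @^-1` A `&` `[0, 1] =
    (`]0, c[ `&` T @^-1` (A `&` `[0, 1])) `|` (`]c, 1[ `&` T @^-1` (A `&` `[0, 1]))
    `|` ([set 0; c; 1] `&` T @^-1` (A `&` `[0, 1])).
  apply/seteqP; split => x /=.
    move=> [Ax x01]; have Tx := T01 x01; move: x01; rewrite /= !in_itv /= => /andP[x0 x1].
    rewrite /= in_itv /= in Tx.
    have [xc|cx|xc] := ltgtP x c.
    - move: x0; rewrite le_eqVlt => /orP[/eqP x0|x0].
        by right; split => //; left; left.
      by left; left; rewrite x0.
    - move: x1; rewrite le_eqVlt => /orP[/eqP x1|x1].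
        by right; split => //; right.
      by left; right; rewrite x1.
    - by right; split => //; left; right.
  rewrite !in_itv /=; have /andP[c0 c1] := c01.
  move=> [[[/andP[x0 x1] [Ax _]]|[/andP[x0 x1] [Ax _]]]|[[[E|E]|E] [Ax _]]]; split => //.
  - by rewrite ltW //= ltW // (lt_trans x1).
  - by rewrite (ltW x1) andbT ltW // (lt_trans c0).
  - by rewrite E lexx ler01.
  - by rewrite E !ltW.
  - by rewrite E lexx ler01.
apply: measurableU; first apply: measurableU.
- exact: (subspace_continuous_measurable_fun _ TL_cont).
- exact: (subspace_continuous_measurable_fun _ TR_cont).
apply: countable_measurable => //; apply: finite_set_countable.
apply: finite_setIl; rewrite !finite_setU; split => //; split=> //.
Qed.

Lemma dens_acim : acim T (fun A => fine (dens_measure h A)).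
Proof.
split.
- by move=> A mA; rewrite fine_ge0 // dens_ge0.
- exact: dens_add.
- exact: dens_ext.
- exact: msr_preimage.
- move=> A mA; congr fine.
  have := h_inv mA (@subIsetr _ _ _); rewrite /dens_measure -setIA setIid => <-.
  congr (integral _ _ _); apply/seteqP; split => x /= [Ax x01]; split => //.
    by split => //; exact: T01.
  by case: Ax.
- by rewrite dens_setT.
Qed.

Definition dens_cdf (x : R) : R := fine (dens_measure h [set z | z <= x]).
Local Notation H := dens_cdf.

Lemma dens_cdf_diff x y : x <= y -> H y - H x = fine (dens_measure h [set z | x < z <= y]).
Proof.
move=> xy; rewrite /H; have -> : [set z | z <= y] = [set z | z <= x] `|` [set z | x < z <= y].
  apply/seteqP; split => z /=.
    by move=> zy; case: (leP z x) => zx; [left|right; rewrite ?zx].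
  by case=> [zx|/andP[]//]; exact: le_trans xy.
have E := @dens_add [set z | z <= x] [set z | x < z <= y] (@msr_le _ x) (@msr_oc _ x y).
rewrite /m in E; rewrite E; first ring.
by move=> z _ /= zx /andP[xz _]; have := lt_le_trans xz zx; rewrite ltxx.
Qed.

Lemma dens_cdf_le x y : x <= y -> H x <= H y.
Proof.
by move=> xy; rewrite -subr_ge0 dens_cdf_diff // fine_ge0 // dens_ge0 //; exact: msr_oc.
Qed.

Lemma dens_cdf_int x y : 0 <= x -> x <= y -> y <= 1 ->
  (H y - H x)%:E = (\int[leb]_(z in `]x, y]) (h0 z)%:E)%E.
Proof.
move=> x0 xy y1; rewrite dens_cdf_diff // -dens_fin; last exact: msr_oc.
rewrite dens_inner; last exact: msr_oc.
suff -> : [set z | x < z <= y] `&` `[0, 1] = `]x, y] by [].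
apply/seteqP; split => z /=; rewrite !in_itv /=; first by case.
by move=> /andP[h1 h2]; rewrite h1 h2 (le_trans x0 (ltW h1)) (le_trans h2).
Qed.

Let sub01 x y : 0 <= x -> y <= 1 -> measurable_fun (`]x, y] : set R) h0.
Proof.
move=> x0 y1; apply: measurable_funS measurable_inner_density => //.
move=> z /=; rewrite !in_itv /= => /andP[h1 h2].
by rewrite (le_trans x0 (ltW h1)) (le_trans h2).
Qed.

Lemma dens_cdf_ub x y M : 0 <= x -> x <= y -> y <= 1 ->
  (forall z, x <= z -> z <= y -> h0 z <= M) -> H y - H x <= M * (y - x).
Proof.
move=> x0 xy y1 hM; rewrite -lee_fin dens_cdf_int //.
apply: integral_itv_le => //; first exact: sub01.
by move=> z /andP[h1 h2]; rewrite inner_density_ge0 hM // ltW.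
Qed.

Lemma dens_cdf_lb x y M : 0 <= x -> x <= y -> y <= 1 ->
  (forall z, x <= z -> z <= y -> M <= h0 z) -> M * (y - x) <= H y - H x.
Proof.
move=> x0 xy y1 hM; have [M0|M0] := leP 0 M; last first.
  apply: (@le_trans _ _ 0); last by rewrite subr_ge0 dens_cdf_le.
  by rewrite mulr_le0_ge0 ?subr_ge0 // ltW.
rewrite -lee_fin dens_cdf_int //.
apply: integral_itv_ge => //; first exact: sub01.
by move=> z /andP[h1 h2]; rewrite hM // ltW.
Qed.

Lemma dens_cdf0 : H 0 = 0.
Proof.
transitivity (fine (dens_measure h set0)); last by rewrite /dens_measure set0I integral_set0.
apply: (@dens_ext _ set0 [set 0]).
- exact: msr_le.
- exact: msr_measurable.
- exact: finite_set_countable.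
move=> z /andP[z0 _] nz; split => //= zle; apply: nz.
by apply/eqP; rewrite eq_le zle.
Qed.

Lemma dens_cdf1 : H 1 = 1.
Proof.
transitivity (fine (dens_measure h setT)); last by rewrite dens_setT.
apply: (@dens_ext _ _ set0) => //; first exact: msr_le.
  exact: msrT.
by move=> z /andP[_ z1] _; split.
Qed.

(** Near each point, either [x] and [y] are close and continuity applies, or they are at least
    [d / 2] apart and a large slope exceeds the whole oscillation of [h]. Compactness gives one
    slope for all points. *)
Lemma inner_density_lip a b eta : 0 < a -> a <= b -> b < 1 -> 0 < eta -> exists2 K, 0 <= K &
  forall x y, a <= x <= b -> a <= y <= b -> h0 x <= h0 y + eta + K * `|x - y|.
Proof.
move=> a0 ab b1 eta0.
have sub x : a <= x <= b -> 0 < x < 1.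
  by move=> /andP[h1 h2]; rewrite (lt_le_trans a0 h1) (le_lt_trans h2 b1).
have hE x : a <= x <= b -> h0 x = h x by move=> /sub; exact: inner_densityE.
have cont x : a <= x <= b -> {for x, continuous h}.
  move=> /sub hx.
  have := h_cont; rewrite (continuous_open_subspace h (itv_open _ _)) => /(_ x); apply.
  by rewrite inE /= in_itv.
suff [K K0 hK] : exists2 K, 0 <= K &
    forall x y, a <= x <= b -> a <= y <= b -> h x <= h y + eta + K * `|x - y|.
  by exists K => // x y hx hy; rewrite !hE //; exact: hK.
have cab : {within `[a, b], continuous h}.
  by apply: continuous_in_subspaceT => x; rewrite inE /= in_itv /=; exact: cont.
have [u _ hu] := EVT_max ab cab.
have [v _ hv] := EVT_min ab cab.
have {}hu x : a <= x <= b -> h x <= h u by move=> hx; apply: hu; rewrite in_itv.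
have {}hv x : a <= x <= b -> h v <= h x by move=> hx; apply: hv; rewrite in_itv.
pose P (n : nat) (x : R) := a <= x <= b ->
  forall y, a <= y <= b -> h x <= h y + eta + n%:R * `|x - y|.
have /compact_near_coveringP cov := @segment_compact R a b.
have [|N _ hN] := cov nat \oo%classic P _.
  move=> x; rewrite /= in_itv /= => hx.
  have e2 : 0 < eta / 2 by rewrite divr_gt0.
  have := cont x hx => /cvgrPdist_lt /(_ _ e2) [d /= d0 hd].
  pose B := `|h u - h v| + 1.
  have d2 : 0 < d / 2 by rewrite divr_gt0.
  have B0 : 0 < 2 * B by rewrite mulr_gt0 // ltr_wpDl.
  have := archi_boundP (ltW (divr_gt0 B0 d2)); set n0 := Num.bound _ => hn0.
  exists (ball x (d / 2), [set n | (n0 <= n)%N]).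
    by split => /=; [exact: nbhsx_ballx|exists n0].
  move=> [x' n] /= []; rewrite /ball /= => xx' n0n hx' y hy.
  have hxx' : `|h x - h x'| < eta / 2.
    by apply: hd; rewrite /ball /=; apply: lt_trans xx' _; lra.
  have [xy|xy] := ltP `|x - y| d.
    have hxy : `|h x - h y| < eta / 2 by apply: hd.
    have : 0 <= n%:R * `|x' - y| by rewrite mulr_ge0.
    by move: hxx' hxy; rewrite !ltr_norml => /andP[? ?] /andP[? ?]; lra.
  have x'y : d / 2 <= `|x' - y|.
    have := ler_distD x' x y; lra.
  have nn : (2 * B) / (d / 2) <= n%:R.
    by apply: le_trans (ltW hn0) _; rewrite ler_nat.
  have : 2 * B <= n%:R * `|x' - y|.
    rewrite ler_pdivrMr // in nn; apply: (le_trans nn).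
    by rewrite ler_wpM2l.
  have := hu _ hx'; have := hv _ hy; have := ler_norm (h u - h v).
  have := normr_ge0 (h u - h v).
  by rewrite /B; lra.
exists N%:R => // x y hx hy.
by apply: (hN N (leqnn N) x _ hx y hy); rewrite /= in_itv.
Qed.

End DensMeasure.

Section Continuity.
Variables (R : realType) (h : R -> R).
Hypothesis h_ge0 : forall x, `]0, 1[ x -> 0 <= h x.
Hypothesis h_cont : {within `]0, 1[, continuous h}.
Hypothesis h_mass : dens_measure h `[0, 1] = 1%E.
Local Notation leb := (@lebesgue_measure R).
Local Notation h0 := (inner_density h).

(** The density may be unbounded near the ends, so this rests on absolute continuity of the integral
    of an integrable function. *)
Lemma dens_cdf_abs_cont eps : 0 < eps -> exists2 delta, 0 < delta &
  forall x y, 0 <= x -> x <= y -> y <= 1 -> y - x < delta -> dens_cdf h y - dens_cdf h x < eps.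
Proof.
move=> e0.
have h00 := inner_density_ge0 h_ge0.
pose f := (fun x => h0 x) \_ `[0, 1].
have mf : measurable_fun (`[0, 1] : set R) (EFin \o h0).
  by apply/measurable_EFinP; exact: measurable_inner_density.
have intf : leb.-integrable setT (EFin \o f).
  rewrite -restrict_EFin; apply/integrable_restrict => //=; rewrite setTI.
  apply/integrableP; split => //.
  have -> : (\int[leb]_(x in `[0%R, 1%R]) `|(EFin \o h0) x| = \int[leb]_(x in `[0%R, 1%R]) (h0 x)%:E)%E.
    by apply: eq_integral => x _ /=; rewrite ger0_norm.
  have := dens_inner h_cont (@msrT R); rewrite dens_setT // setTI => <-.
  by rewrite ltry.
have [del [del0 hd]] := integral_normr_continuous intf e0.
exists del => // x y x0 xy y1 xyd.
have hxy : (leb `]x, y] < del%:E)%E by rewrite lebesgue_itv_oc // lte_fin.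
apply: le_lt_trans (hd `]x, y]%classic (measurable_itv _) hxy).
rewrite /Rintegral.
have -> : (\int[leb]_(z in `]x, y]) (`|f z|)%:E = (dens_cdf h y - dens_cdf h x)%:E)%E.
  rewrite dens_cdf_int //; apply: eq_integral => z; rewrite inE /= in_itv /= => /andP[h1 h2].
  rewrite /f patchE ifT ?ger0_norm //.
  by rewrite inE /= in_itv /= (le_trans x0 (ltW h1)) (le_trans h2).
by [].
Qed.

End Continuity.

(** * Avoiding a neighbourhood of 0 *)

Section Link.
Variables (R : realType) (c : R) (T L Rr : R -> R) (kappa D d : R) (m : set R -> R) (H : R -> R).
Hypothesis im : indiff_map c T L Rr kappa D d.
Hypothesis am : acim T m.
Hypothesis H_diff : forall x y, x <= y -> H y - H x = m [set z | x < z <= y].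
Hypothesis H0 : H 0 = 0.
Hypothesis H1 : H 1 = 1.

Local Notation psi := (orbit_psi L Rr).
Local Notation b n := (orbitL L n 1).
Let fb := im_fb im.

Let c_gt0 : 0 < c. Proof. by case/andP: (im_c01 im). Qed.
Let c_lt1 : c < 1. Proof. by case/andP: (im_c01 im). Qed.

Lemma orbitLS n x : orbitL L n.+1 x = L (orbitL L n x). Proof. by []. Qed.

Lemma orbitL1_0 : b 0 = 1. Proof. by []. Qed.
Lemma orbitL1_1 : b 1 = c. Proof. exact: im_L1 im. Qed.

Lemma b_bounds n : 0 < b n <= 1 /\ b n.+1 < b n.
Proof.
elim: n => [|n [/andP[h1 h2] h3]]; first by rewrite ltr01 lexx orbitL1_1.
have h4 : 0 < b n.+1 by rewrite orbitLS -[ltLHS](im_L0 im); apply: (im_Llt im).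
split; first by rewrite h4 (le_trans (ltW h3)).
by rewrite !(orbitLS _.+1) [ltRHS]orbitLS; apply: (im_Llt im) => //; exact: ltW.
Qed.

Lemma b_gt0 n : 0 < b n. Proof. by have [/andP[]] := b_bounds n. Qed.
Lemma b_le1 n : b n <= 1. Proof. by have [/andP[]] := b_bounds n. Qed.
Lemma b01 n : 0 <= b n <= 1. Proof. by rewrite ltW ?b_gt0 ?b_le1. Qed.
Lemma b_decr n : b n.+1 < b n. Proof. by have [] := b_bounds n. Qed.

Lemma b_antitone i n : (i <= n)%N -> b n <= b i.
Proof.
move=> /subnK <-; elim: (n - i)%N => [|k IH] //.
by apply: le_trans IH; rewrite addSn ltW // b_decr.
Qed.

Lemma b_le_c n : b n.+1 <= c. Proof. by rewrite -orbitL1_1 b_antitone. Qed.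

Lemma orbitL_c n : orbitL L n c = b n.+1.
Proof. by rewrite /orbitL iterSr (im_L1 im). Qed.

Lemma orbitL_bounds n x : c <= x <= 1 -> b n.+1 <= orbitL L n x <= b n.
Proof.
move=> /andP[cx x1]; elim: n => [|n /andP[h1 h2]]; first by rewrite orbitL1_1 cx x1.
have Lle u v : 0 <= u -> u <= v -> v <= 1 -> L u <= L v.
  move=> u0; rewrite le_eqVlt => /orP[/eqP ->//|uv] v1.
  by apply: ltW; exact: (im_Llt im).
rewrite orbitLS; apply/andP; split.
  by apply: Lle h1 _; [exact: ltW (b_gt0 _)|exact: le_trans h2 (b_le1 _)].
by apply: Lle h2 _; [exact: le_trans (ltW (b_gt0 _)) h1|exact: b_le1].
Qed.

Lemma orbitL01 n x : c <= x <= 1 -> 0 <= orbitL L n x <= 1.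
Proof.
move=> /(orbitL_bounds n) /andP[h1 h2].
by rewrite (le_trans (ltW (b_gt0 _)) h1) (le_trans h2 (b_le1 _)).
Qed.

(* Off this countable set, neither the values of [T] at [c] and [1] nor the choice of half-open
   intervals matters. *)
Definition bad : set R := [set z | 0 <= z <= 1 /\ exists i, [set 0; c; 1] (iter i T z)].

Definition good z := 0 <= z <= 1 /\ ~ bad z.

Lemma finite_preimage (S : set R) : finite_set S -> finite_set ([set z | 0 <= z <= 1] `&` T @^-1` S).
Proof.
move=> fS; apply: (@sub_finite_set _ _ ((L @` S `|` Rr @` S) `|` [set 0; c; 1])); last first.
  rewrite !finite_setU; split; first by split; exact: finite_image.
  by do 2 (split => //).
move=> z [/andP[z0 z1] Sz].
have [zc|cz|zc] := ltgtP z c.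
- move: z0; rewrite le_eqVlt => /orP[/eqP z0|z0]; first by right; left; left.
  have [_ E] := im_TL im (introT andP (conj z0 zc)).
  by left; left; exists (T z).
- move: z1; rewrite le_eqVlt => /orP[/eqP z1|z1]; first by right; right.
  have [_ E] := im_TR im (introT andP (conj cz z1)).
  by left; right; exists (T z).
- by right; left; right.
Qed.

Lemma countable_bad : countable bad.
Proof.
have -> : bad = \bigcup_(i in [set: nat]) ([set z | 0 <= z <= 1] `&` iter i T @^-1` [set 0; c; 1]).
  apply/seteqP; split => z.
    by move=> [z01 [i hi]]; exists i.
  by move=> [i _ [z01 hi]]; split => //; exists i.
apply: bigcup_countable => // i _; apply: finite_set_countable.
elim: i => [|i IH].
  apply: finite_setIr; rewrite !finite_setU; by do 2 (split => //).
apply: sub_finite_set (finite_preimage IH) => z [z01 hz]; split => //; split.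
  exact: (im_T im).
by move: (hz : [set 0; c; 1] (iter i.+1 T z)); rewrite iterSr.
Qed.

Lemma good_T z : good z -> good (T z).
Proof.
move=> [z01 nb]; split; first exact: (im_T im).
by move=> [_ [i hi]]; apply: nb; split => //; exists i.+1; rewrite iterSr.
Qed.

Lemma good_iter i z : good z -> good (iter i T z).
Proof. by move=> gz; elim: i => [//|i IH]; exact: good_T. Qed.

Lemma good_cases z : good z -> 0 < z < c \/ c < z < 1.
Proof.
move=> [/andP[z0 z1] nb].
have nP : ~ [set 0; c; 1] z by move=> hP; apply: nb; split; [rewrite z0|exists 0%N].
have [zc|cz|zc] := ltgtP z c.
- left; rewrite lt_neqAle z0 !andbT; apply/eqP => E; apply: nP; by left; left.
- right; rewrite lt_neqAle z1 !andbT; apply/eqP => E; apply: nP; by right.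
- by exfalso; apply: nP; left; right.
Qed.

Lemma good_left z y : good z -> z <= c -> 0 <= y <= 1 -> (z <= L y) = (T z <= y).
Proof.
move=> gz zc /andP[y0 y1].
have [hz|/andP[cz _]] := good_cases gz; last by have := lt_le_trans cz zc; rewrite ltxx.
have [/andP[t0 t1] E] := im_TL im hz.
have [Ty|yT] := leP (T z) y.
  rewrite -E; move: Ty; rewrite le_eqVlt => /orP[/eqP ->|Ty]; first exact: lexx.
  by apply/ltW; apply: (im_Llt im) => //; exact: ltW.
apply/negbTE; rewrite -ltNge -E; apply: (im_Llt im) => //; exact: ltW.
Qed.

Lemma good_right z y : good z -> c <= z -> 0 <= y <= 1 -> (z <= Rr y) = (T z <= y).
Proof.
move=> gz cz /andP[y0 y1].
have [/andP[_ zc]|hz] := good_cases gz; first by have := lt_le_trans zc cz; rewrite ltxx.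
have [/andP[t0 t1] E] := im_TR im hz.
have [Ty|yT] := leP (T z) y.
  rewrite -E; move: Ty; rewrite le_eqVlt => /orP[/eqP ->|Ty]; first exact: lexx.
  by apply/ltW; apply: (im_Rlt im) => //; exact: ltW.
apply/negbTE; rewrite -ltNge -E; apply: (im_Rlt im) => //; exact: ltW.
Qed.

(** Up to [bad], the points that reach [(c, 1]] for the first time after exactly [j] steps, all
    along the left branch. *)
Definition level j := [set z : R | b j.+1 < z <= b j].

Lemma level_T j z : good z -> level j.+1 z -> level j (T z).
Proof.
move=> gz /andP[h1 h2].
have zc : z <= c by apply: le_trans h2 (b_le_c _).
apply/andP; split.
  by rewrite ltNge -(good_left gz zc (b01 _)) -orbitLS -ltNge.
by rewrite -(good_left gz zc (b01 _)) -orbitLS.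
Qed.

Lemma level_iter j z : good z -> level j z -> c < iter j T z <= 1 /\
  forall x, c <= x <= 1 -> (z <= orbitL L j x) = (iter j T z <= x).
Proof.
elim: j z => [|j IH] z gz hz.
  by move: hz; rewrite /level /= orbitL1_1 orbitL1_0 => hz; split.
have zc : z <= c by case/andP: hz => _ h2; apply: le_trans h2 (b_le_c _).
have [h1 h2] := IH _ (good_T gz) (level_T gz hz).
rewrite iterSr; split => // x hx.
by rewrite orbitLS good_left // ?orbitL01 // h2.
Qed.

Definition survives (N n : nat) : set R := [set z | forall i, (0 < i <= n)%N -> b N < iter i T z].

Lemma survives0 N z : survives N 0 z.
Proof. by move=> i; rewrite leqn0 => /andP[] /[swap] /eqP ->. Qed.

Lemma survivesS N n z : survives N n.+1 z <-> b N < T z /\ survives N n (T z).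
Proof.
split=> [h|[h1 h2] [//|[|i]] hi] //.
  split; first exact: (h 1%N).
  by move=> i /andP[i0 ni]; rewrite -iterSr; apply: h.
rewrite iterSr; apply: h2; lia.
Qed.

(** From level [j] a point passes only through lower-numbered levels, all above [b N]. The case
    [j = N] is allowed because time [0] is not tested. *)
Lemma survives_level N n j z : good z -> level j z -> (j <= N)%N ->
  survives N n z <-> survives N (n - j) (iter j T z).
Proof.
elim: j n z => [|j IH] n z gz hz jN; first by rewrite subn0.
case: n => [|n]; first by split=> _; exact: survives0.
rewrite survivesS subSS iterSr.
have hT := level_T gz hz.
rewrite (IH n _ (good_T gz) hT (ltnW jN)); split; first by case.
split => //; case/andP: hT => h _; apply: le_lt_trans h; exact: b_antitone.
Qed.

Lemma branch_level j z : good z -> psi j c < z <= psi j 1 ->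
  level j (T z) /\ forall x, c <= x <= 1 -> (z <= psi j x) = (iter j.+1 T z <= x).
Proof.
move=> gz /andP[h1 h2].
have cc : c <= c <= 1 by rewrite lexx (ltW c_lt1).
have c11 : c <= (1 : R) <= 1 by rewrite (ltW c_lt1) lexx.
have cz : c <= z by apply: ltW (le_lt_trans _ h1); have /andP[] := fb_range fb j cc.
have hl : level j (T z).
  apply/andP; split.
    by rewrite -orbitL_c ltNge -(good_right gz cz (orbitL01 j cc)) -ltNge.
  by rewrite -(good_right gz cz (orbitL01 j c11)).
split => // x hx.
rewrite /orbit_psi (good_right gz cz (orbitL01 j hx)) iterSr.
by have [_ ->] := level_iter (good_T gz) hl.
Qed.

Lemma msr_iter i A : msr A -> msr (iter i T @^-1` A).
Proof.
move=> mA; elim: i => [//|i IH].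
have -> : iter i.+1 T @^-1` A = T @^-1` (iter i T @^-1` A).
  by apply/funext => z; rewrite /preimage; congr (A _); exact: iterSr.
exact: (acim_pre am).
Qed.

Lemma msr_gt x : msr [set z : R | x < z].
Proof.
have -> : [set z : R | x < z] = ~` [set z | z <= x].
  by apply/seteqP; split => z /=; rewrite ltNge => /negP.
by apply: msrC; exact: msr_le.
Qed.

Lemma msr_survives N n : msr (survives N n).
Proof.
elim: n => [|n IH].
  have -> : survives N 0 = setT by apply/seteqP; split => // z _; exact: survives0.
  exact: msrT.
have -> : survives N n.+1 = T @^-1` ([set z | b N < z] `&` survives N n).
  by apply/seteqP; split => z; rewrite survivesS.
by apply: (acim_pre am); apply: msrI; [exact: msr_gt|].
Qed.

Lemma m_eq A B : msr A -> msr B -> (forall z, good z -> (A z <-> B z)) -> m A = m B.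
Proof.
move=> mA mB AB; apply: (acim_ext am mA mB countable_bad) => z z01 nz; exact: AB.
Qed.

Lemma m_set0 : m set0 = 0.
Proof.
have h : msr (@set0 R) by apply: msr_measurable.
by have := acim_add am h h (fun _ _ h _ => h); rewrite setU0; lra.
Qed.

Lemma m_le A B : msr A -> msr B -> (forall z, good z -> A z -> B z) -> m A <= m B.
Proof.
move=> mA mB AB.
have mAB : msr (A `&` B) by exact: msrI.
have mBA : msr (B `&` ~` A) by apply: msrI => //; exact: msrC.
have -> : m A = m (A `&` B) by apply: m_eq => // z gz; split=> [Az|[]//]; split => //; exact: AB.
have -> : m B = m ((A `&` B) `|` (B `&` ~` A)).
  apply: m_eq => //; first exact: msrU.
  move=> z _; split=> [Bz|[[]|[]]//]; have [Az|nA] := pselect (A z); [by left|by right].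
rewrite (acim_add am mAB mBA); last by move=> z _ [? _] [_].
by rewrite lerDl (acim_ge0 am).
Qed.

Lemma m_le1 A : msr A -> m A <= 1.
Proof. by move=> mA; rewrite -(acim_setT am); apply: m_le => //; exact: msrT. Qed.

(** The sequence [be] is arbitrary because the lemma serves both the levels, cut at [b j], and the
    branches, cut at [psi j 1]. *)
Lemma m_partition (be : nat -> R) i A N : msr A -> be 0%N = 1 -> (forall j, be j.+1 <= be j) ->
  m (A `&` iter i T @^-1` [set w | be N < w <= 1]) =
  \sum_(j < N) m (A `&` iter i T @^-1` [set w | be j.+1 < w <= be j]).
Proof.
move=> mA be0 beS; elim: N => [|N IH].
  rewrite big_ord0 be0 -[RHS]m_set0; congr m; apply/seteqP; split => // z [_ /andP[h1 h2]].
  by have := lt_le_trans h1 h2; rewrite ltxx.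
have be1 k : be k <= 1.
  by elim: k => [|k IHk]; [rewrite be0|exact: le_trans IHk].
rewrite big_ord_recr /= -IH -(acim_add am).
- apply: m_eq; [by apply: msrI => //; apply: msr_iter; exact: msr_oc| |].
    by apply: msrU; apply: msrI => //; apply: msr_iter; exact: msr_oc.
  move=> z gz; split.
    move=> [Az /andP[h1 h2]]; have [h|h] := leP (iter i T z) (be N).
      by right; split => //=; rewrite h1 h.
    by left; split => //=; rewrite h h2.
  case=> [] [Az /andP[h1 h2]]; split => //=.
    by rewrite (le_lt_trans (beS N) h1) h2.
  by rewrite h1 (le_trans h2).
- by apply: msrI => //; apply: msr_iter; exact: msr_oc.
- by apply: msrI => //; apply: msr_iter; exact: msr_oc.
move=> z _ [_ /andP[h1 _]] [_ /andP[_ h2]]; by have := lt_le_trans h1 h2; rewrite ltxx.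
Qed.

Local Notation surv := (survival c psi).

Lemma surv_congr N n (V W : R -> R) k : (forall x, c <= x <= 1 -> V x = W x + k) -> surv N n V = surv N n W.
Proof.
move=> VW; apply/eqP; rewrite eq_le; apply/andP; split.
  apply: (surv_le fb) => x y cx xy y1; rewrite !VW ?cx ?y1 ?(le_trans cx xy) ?(le_trans xy y1) //; lra.
apply: (surv_le fb) => x y cx xy y1; rewrite !VW ?cx ?y1 ?(le_trans cx xy) ?(le_trans xy y1) //; lra.
Qed.

(** The induction follows the itinerary: [i] is the time elapsed and [C] records the branches
    already taken. Restricting to the next branch only changes [C], and the recursion of [survival]
    is reproduced exactly. *)
Lemma m_surv N n i C : msr C ->
  m (C `&` iter i T @^-1` ([set w | c < w <= 1] `&` survives N n)) =
  surv N n (fun x => m (C `&` iter i T @^-1` [set w | c < w <= x])).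
Proof.
elim/ltn_ind: n i C => -[|n] IH i C mC.
  rewrite surv0 /mass_on.
  have -> : C `&` iter i T @^-1` [set w | c < w <= c] = set0.
    apply/seteqP; split => // z [_ /andP[h1 h2]].
    by have := lt_le_trans h1 h2; rewrite ltxx.
  rewrite m_set0 subr0; congr m; apply/seteqP; split => z [Cz].
    by case.
  by split => //; split => //; exact: survives0.
have mS := msr_survives N n.+1.
set A := C `&` iter i T @^-1` survives N n.+1.
have mA : msr A by apply: msrI => //; exact: msr_iter.
(* Avoiding the target at the next step means [T w > b N], that is, [w > psi N 1]: exactly the first
   [N] branches remain. *)
transitivity (m (A `&` iter i T @^-1` [set w | psi N 1 < w <= 1])).
  apply: m_eq.
  - by apply: msrI => //; apply: msr_iter; apply: msrI => //; exact: msr_oc.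
  - by apply: msrI => //; apply: msr_iter; exact: msr_oc.
  move=> z gz; have gw := good_iter i gz; split.
    move=> [Cz [/andP[cw w1] Sw]]; split; first by split.
    rewrite /preimage /= w1 andbT.
    have /survivesS[bT _] := Sw.
    rewrite ltNge /orbit_psi (good_right gw (ltW cw) (b01 _)).
    by rewrite -ltNge.
  move=> [[Cz Sw] /andP[h1 w1]]; split => //; split => //.
  rewrite /= w1 andbT; apply: le_lt_trans h1; exact: (psi1_ge fb).
have tile j : psi j c = psi j.+1 1 by exact: (fb_tile fb).
rewrite (@m_partition (fun j => psi j 1)) //; last 2 first.
- exact: (fb_first fb).
- move=> j; rewrite -tile; apply: (psi_le fb) => //; exact: ltW.
rewrite survS; apply: eq_bigr => j _.
set C' := C `&` iter i T @^-1` [set w | psi j c < w <= psi j 1].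
have mC' : msr C' by apply: msrI => //; apply: msr_iter; exact: msr_oc.
transitivity (m (C' `&` iter (j.+1 + i) T @^-1` ([set w | c < w <= 1] `&` survives N (n - j)))).
  apply: m_eq.
  - by apply: msrI => //; apply: msr_iter; exact: msr_oc.
  - apply: msrI => //; apply: msr_iter; apply: msrI; [exact: msr_oc|exact: msr_survives].
  move=> z gz; have gw := good_iter i gz.
  have key : psi j c < iter i T z <= psi j 1 ->
     (survives N n.+1 (iter i T z) <-> survives N (n - j) (iter (j.+1 + i) T z)) /\
     c < iter (j.+1 + i) T z <= 1.
    move=> hw; have [hl hx] := branch_level gw hw.
    have [hc _] := level_iter (good_T gw) hl.
    rewrite iterD iterSr; split => //.
    rewrite survivesS (survives_level n (good_T gw) hl (ltnW (ltn_ord j))).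
    split; [by case|move=> ?; split => //].
    case/andP: hl => h _; apply: le_lt_trans h; exact: b_antitone.
  split.
    move=> [[Cz Sw]]; rewrite /preimage /= -tile => hw.
    have [k1 k2] := key hw; split; first by split.
    by split => //; apply/k1.
  move=> [[Cz hw] [_ Sw]]; have [k1 k2] := key hw; split; last by rewrite /preimage /= -tile.
  by split => //; apply/k1.
rewrite IH //; last by rewrite ltnS leq_subr.
(* Within the branch, the distribution function differs from the composition with [psi j] by the
   mass to the left of the branch, a constant that [survival] ignores. *)
apply: (@surv_congr _ _ _ _ (- m (C `&` iter i T @^-1` [set w | c < w <= psi j c]))) => x hx /=.
have /andP[cx x1] := hx.
have pc : c <= psi j c by have /andP[] := fb_range fb j (introT andP (conj (lexx c) (ltW c_lt1))).
have pcx : psi j c <= psi j x by apply: (psi_le fb).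
have px1 : psi j x <= psi j 1 by apply: (psi_le fb).
have -> : C `&` iter i T @^-1` [set w | c < w <= psi j x] =
  (C `&` iter i T @^-1` [set w | c < w <= psi j c]) `|` (C `&` iter i T @^-1` [set w | psi j c < w <= psi j x]).
  apply/seteqP; split => z.
    move=> [Cz /andP[h1 h2]]; have [h|h] := leP (iter i T z) (psi j c).
      by left; split => //=; rewrite h1.
    by right; split => //=; rewrite h.
  case=> [] [Cz /andP[h1 h2]]; split => //=.
    by rewrite h1 (le_trans h2).
  by rewrite (le_lt_trans pc h1).
rewrite (acim_add am); last first.
- by move=> z _ [_ /andP[_ h2]] [_ /andP[h1 _]]; have := lt_le_trans h1 h2; rewrite ltxx.
- by apply: msrI => //; apply: msr_iter; exact: msr_oc.
- by apply: msrI => //; apply: msr_iter; exact: msr_oc.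
rewrite addrAC subrr add0r.
apply: m_eq.
- by apply: msrI => //; apply: msr_iter; exact: msr_oc.
- by apply: msrI => //; apply: msr_iter; exact: msr_oc.
move=> z gz; have gw := good_iter i gz; split.
  move=> [[Cz hw]]; rewrite /preimage /= => /andP[_ h2]; split => //=.
  have [hl hx'] := branch_level gw hw.
  by case/andP: hw => -> _; rewrite hx' // -iterD.
move=> [Cz /andP[h1 h2]].
have hw : psi j c < iter i T z <= psi j 1 by rewrite h1 (le_trans h2).
have [hl hx'] := branch_level gw hw.
split; first by split.
have E : iter (j.+1 + i) T z = iter j T (T (iter i T z)) by rewrite iterD iterSr.
change (is_true (c < iter (j.+1 + i) T z <= x)); rewrite E.
have := hx' x hx; rewrite iterSr h2 => <-; rewrite andbT.
by have [/andP[]] := level_iter (good_T gw) hl.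
Qed.

Definition Fsurv N n := m (survives N n).

Lemma m_level_surv N n i : (i <= N)%N ->
  m (level i `&` survives N (n + i)) = surv N n (fun x => H (orbitL L i x)).
Proof.
move=> iN; have mU : msr (level i) by exact: msr_oc.
transitivity (m (level i `&` iter i T @^-1` ([set w | c < w <= 1] `&` survives N n))).
  apply: m_eq.
  - by apply: msrI => //; exact: msr_survives.
  - by apply: msrI => //; apply: msr_iter; apply: msrI; [exact: msr_oc|exact: msr_survives].
  move=> z gz; split.
    move=> [hz Sz]; split => //; have [h1 _] := level_iter gz hz; split => //.
    by move: Sz; rewrite (survives_level _ gz hz iN) addnK.
  by move=> [hz [_ Sz]]; split => //; rewrite (survives_level _ gz hz iN) addnK.
rewrite m_surv //; apply: (@surv_congr _ _ _ _ (- H (b i.+1))) => x hx.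
have /andP[p1 p2] := orbitL_bounds i hx.
rewrite H_diff //; apply: m_eq.
- by apply: msrI => //; apply: msr_iter; exact: msr_oc.
- exact: msr_oc.
move=> z gz; split.
  move=> [hz /andP[h1 h2]]; have [k1 k2] := level_iter gz hz.
  by rewrite /= k2 //; rewrite h2 andbT; case/andP: hz.
move=> /andP[h1 h2]; have hz : level i z by rewrite /level /= h1 (le_trans h2).
have [/andP[k1 k1'] k2] := level_iter gz hz; split => //=.
by rewrite /preimage /= k1 -k2.
Qed.

(** Invariance shifts the constraints one step back: [Fsurv N n.+1] is the measure of avoiding the
    target at times [0] to [n], so the difference is carried by the points inside it at time [0]. *)
Lemma Fsurv_step N n : Fsurv N n - Fsurv N n.+1 = m ([set z | z <= b N] `&` survives N n).
Proof.
have mS := msr_survives N n.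
have -> : Fsurv N n.+1 = m ([set z | b N < z] `&` survives N n).
  rewrite -(acim_inv am); last by apply: msrI => //; exact: msr_gt.
  congr m; apply/seteqP; split => z; first by move=> /survivesS.
  by move=> h; apply/survivesS.
apply/eqP; rewrite subr_eq -(acim_add am).
- apply/eqP; apply: m_eq => //.
    by apply: msrU; apply: msrI => //; [exact: msr_le|exact: msr_gt].
  move=> z _; split=> [Sz|[[]|[]]//].
  by have [h|h] := leP z (b N); [left|right].
- by apply: msrI => //; exact: msr_le.
- by apply: msrI => //; exact: msr_gt.
by move=> z _ [/= h1 _] [/= h2 _]; have := le_lt_trans h1 h2; rewrite ltxx.
Qed.

(** [0 < N] puts [b N] at or below [c], so [T] acts by its left branch and leaving [[0, b N]] in one
    step requires [b N.+1 < z]. *)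
Lemma exit_level N n z : (0 < N)%N -> good z -> z <= b N -> survives N n.+1 z -> level N z.
Proof.
move=> N0 gz zb /survivesS[bT _]; rewrite /level /= zb andbT orbitLS.
have zc : z <= c by apply: le_trans zb _; rewrite -(prednK N0); exact: b_le_c.
by rewrite ltNge (good_left gz zc (b01 _)) -ltNge.
Qed.

Lemma Fsurv_stepN N n : (0 < N)%N ->
  Fsurv N (n + N) - Fsurv N (n + N).+1 = surv N n (fun x => H (orbitL L N x)).
Proof.
move=> N0; rewrite Fsurv_step -m_level_surv //.
have mS := msr_survives N (n + N).
apply: m_eq.
- by apply: msrI => //; exact: msr_le.
- by apply: msrI => //; exact: msr_oc.
move=> z gz; split=> [[zb Sz]|[/andP[_ zb] Sz]]; split => //.
by move: Sz; rewrite -(prednK N0) addnS (prednK N0) => Sz; exact: (exit_level N0 gz zb Sz).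
Qed.

(** The bound by the exit mass starts with the second decrement: the first one, with no constraint
    yet, is the whole mass of [[0, b N]]. *)
Lemma Fsurv_step_le N n : (0 < N)%N ->
  0 <= Fsurv N n - Fsurv N n.+1 /\ Fsurv N n.+1 - Fsurv N n.+2 <= H (b N) - H (b N.+1).
Proof.
move=> N0; split.
  rewrite Fsurv_step (acim_ge0 am) //; apply: msrI; [exact: msr_le|exact: msr_survives].
rewrite Fsurv_step H_diff; last by rewrite ltW ?b_decr.
apply: m_le; [by apply: msrI; [exact: msr_le|exact: msr_survives]|exact: msr_oc|].
by move=> z gz [zb Sz]; exact: (exit_level N0 gz zb Sz).
Qed.

Lemma cdf_level N : m [set z | z <= b N] = H (b N).
Proof.
rewrite -[RHS]subr0 -H0 H_diff ?(ltW (b_gt0 _)) //; apply: m_eq.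
- exact: msr_le.
- exact: msr_oc.
move=> z gz; split=> [/= zb|/andP[]//]; rewrite zb andbT.
by have [/andP[]//|/andP[h _]] := good_cases gz; exact: lt_trans h.
Qed.

Lemma Fsurv0 N : Fsurv N 0 = 1.
Proof.
rewrite -(acim_setT am) /Fsurv; congr m; apply/seteqP; split => // z _; exact: survives0.
Qed.

Lemma Fsurv1 N : 1 - H (b N) <= Fsurv N 1.
Proof.
have := Fsurv_step N 0; rewrite Fsurv0 => E.
suff : m ([set z | z <= b N] `&` survives N 0) <= H (b N) by lra.
rewrite -cdf_level; apply: m_le; [|exact: msr_le|by move=> z _ []].
by apply: msrI; [exact: msr_le|exact: msr_survives].
Qed.

Let m_split N A : msr A -> m A = m ([set z | z <= b N] `&` A) + \sum_(i < N) m (level i `&` A).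
Proof.
move=> mA; have := @m_partition (fun j => b j) 0 A N mA orbitL1_0 (fun j => ltW (b_decr j)) => /= P.
transitivity (m ([set z | z <= b N] `&` A) + m (A `&` [set z | b N < z <= 1])); last first.
  congr (_ + _); transitivity (\sum_(j < N) m (A `&` [set w | b j.+1 < w <= b j])); first exact: P.
  by apply: eq_bigr => i _; rewrite setIC.
have m1 : msr ([set z | z <= b N] `&` A) by apply: msrI => //; exact: msr_le.
have m2 : msr (A `&` [set z | b N < z <= 1]) by apply: msrI => //; exact: msr_oc.
rewrite -(acim_add am m1 m2); last first.
  by move=> z _ [/= h1 _] [_ /= /andP[h2 _]]; have := le_lt_trans h1 h2; rewrite ltxx.
apply: m_eq => //; first exact: msrU.
move=> z gz; split=> [Az|[[]|[]]//].
have [h|h] := leP z (b N); [by left|right; split => //=; rewrite h /=].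
by have [[/andP[]]] := gz.
Qed.

(** Decompose by the level at time [0]: level [i] reaches [(c, 1]] after [i] steps. Asking for
    avoidance up to [n + i] instead of [n] gives this lower bound; as [i < N], starting from time
    [n + N] gives the upper bound [Fsurv_le]. *)
Lemma Fsurv_ge N n : \sum_(i < N) surv N n (fun x => H (orbitL L i x)) <= Fsurv N n.
Proof.
rewrite /Fsurv (m_split N); last exact: msr_survives.
rewrite -[leLHS]add0r; apply: lerD.
  by rewrite (acim_ge0 am) //; apply: msrI; [exact: msr_le|exact: msr_survives].
apply: ler_sum => i _; rewrite -m_level_surv ?(ltnW (ltn_ord i)) //.
apply: m_le; [by apply: msrI; [exact: msr_oc|exact: msr_survives]..|].
move=> z _ [hz Sz]; split => // k /andP[k0 kn]; apply: Sz; rewrite k0 /=.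
exact: leq_trans (leq_addr _ _).
Qed.

Lemma Fsurv_le N n : Fsurv N (n + N) <= H (b N) + \sum_(i < N) surv N n (fun x => H (orbitL L i x)).
Proof.
rewrite /Fsurv (m_split N); last exact: msr_survives.
apply: lerD.
  rewrite -cdf_level; apply: m_le; [|exact: msr_le|by move=> z _ []].
  by apply: msrI; [exact: msr_le|exact: msr_survives].
apply: ler_sum => i _; rewrite -m_level_surv ?(ltnW (ltn_ord i)) //.
apply: m_le; [by apply: msrI; [exact: msr_oc|exact: msr_survives]..|].
move=> z _ [hz Sz]; split => // k /andP[k0 kn]; apply: Sz; rewrite k0 /=.
by apply: leq_trans kn _; rewrite leq_add2l ltnW.
Qed.

Lemma H_invariant x y : 0 <= x -> x <= y -> y <= 1 ->
  H y - H x = (H (L y) - H (L x)) + (H (Rr y) - H (Rr x)).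
Proof.
move=> x0 xy y1.
have hx : 0 <= x <= 1 by rewrite x0 (le_trans xy).
have hy : 0 <= y <= 1 by rewrite y1 (le_trans x0).
have L01 u : 0 <= u <= 1 -> 0 <= L u <= c.
  move=> /andP[u0 u1]; rewrite -{1}(im_L0 im) -(im_L1 im).
  apply/andP; split; [move: u0|move: u1]; rewrite le_eqVlt => /orP[/eqP E|E].
  - by rewrite -E.
  - by apply/ltW/(im_Llt im).
  - by rewrite E.
  - by apply/ltW/(im_Llt im).
have R01 u : 0 <= u <= 1 -> c <= Rr u <= 1.
  move=> /andP[u0 u1]; rewrite -{1}(im_R0 im) -[X in _ && (_ <= X)](im_R1 im).
  apply/andP; split; [move: u0|move: u1]; rewrite le_eqVlt => /orP[/eqP E|E].
  - by rewrite -E.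
  - by apply/ltW/(im_Rlt im).
  - by rewrite E.
  - by apply/ltW/(im_Rlt im).
have Lxy : L x <= L y.
  by move: xy; rewrite le_eqVlt => /orP[/eqP ->//|xy]; apply/ltW/(im_Llt im).
have Rxy : Rr x <= Rr y.
  by move: xy; rewrite le_eqVlt => /orP[/eqP ->//|xy]; apply/ltW/(im_Rlt im).
rewrite !H_diff // -(acim_inv am); last exact: msr_oc.
rewrite -(acim_add am); [|exact: msr_oc|exact: msr_oc|]; last first.
  move=> z _ /andP[_ h1] /andP[h2 _].
  have /andP[_ h3] := L01 _ hy; have /andP[h4 _] := R01 _ hx.
  have := le_lt_trans (le_trans h1 (le_trans h3 h4)) h2; by rewrite ltxx.
apply: m_eq.
- by apply: (acim_pre am); exact: msr_oc.
- by apply: msrU; exact: msr_oc.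
move=> z gz; rewrite /preimage /=; split.
  move=> /andP[h1 h2].
  have [/andP[z0 zc]|/andP[cz z1]] := good_cases gz.
    left; rewrite /= ltNge !(good_left gz (ltW zc)) // -ltNge h1 h2 //.
  right; rewrite /= ltNge !(good_right gz (ltW cz)) // -ltNge h1 h2 //.
case=> /= /andP[h1 h2].
  have /andP[_ h3] := L01 _ hy; have zc := le_trans h2 h3.
  by rewrite ltNge -!(good_left gz zc) // -ltNge h1 h2.
have /andP[h3 _] := R01 _ hx; have cz := le_trans h3 (ltW h1).
by rewrite ltNge -!(good_right gz cz) // -ltNge h1 h2.
Qed.

End Link.

(** * Asymptotics *)

Section Elementary.
Variable R : realType.
Implicit Types x y t : R.

Lemma bernoulli_ge x k : 0 <= x <= 1 -> 1 - k%:R * x <= (1 - x) ^+ k.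
Proof.
move=> /andP[x0 x1]; elim: k => [|k IH]; first by rewrite mul0r subr0 expr0.
have p0 : 0 <= (1 - x) ^+ k by rewrite exprn_ge0 // subr_ge0.
have p1 : (1 - x) ^+ k <= 1 by rewrite exprn_ile1 //; lra.
rewrite exprS -[k.+1%:R]natr1; nra.
Qed.

Lemma expR_lip x y : 0 <= x -> 0 <= y -> `|expR (- x) - expR (- y)| <= `|x - y|.
Proof.
wlog xy : x y / x <= y.
  move=> H x0 y0; have [xy|/ltW yx] := leP x y; first exact: H.
  by rewrite distrC [`|x - y|]distrC; apply: H.
move=> x0 y0.
have e1 : expR (- y) <= expR (- x) by rewrite ler_expR lerN2.
rewrite ger0_norm ?subr_ge0 // ler0_norm ?subr_le0 //.
have -> : - y = - x + - (y - x) by ring.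
rewrite expRD.
have := expR_ge1Dx (- (y - x)).
have e3 : expR (- x) <= 1 by rewrite -[leRHS]expR0 ler_expR; lra.
have e4 := expR_ge0 (- x).
have e5 : expR (- (y - x)) <= 1 by rewrite -[leRHS]expR0 ler_expR; lra.
nra.
Qed.

Lemma pow_exp x k : 0 <= x <= 2^-1 ->
  expR (- (k%:R * x * (1 + 2 * x))) <= (1 - x) ^+ k <= expR (- (k%:R * x)).
Proof.
move=> /andP[x0 x1].
(* [expR (- y) <= 1 / (1 + y)] reduces this to [(1 - x) * (1 + y) >= 1], and the product is
   [1 + x ^ 2 * (1 - 2 * x)]. *)
have b1 : expR (- (x * (1 + 2 * x))) <= 1 - x.
  set y := x * (1 + 2 * x); have y0 : 0 <= y by rewrite /y mulr_ge0 //; lra.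
  have y1 : 0 < 1 + y by lra.
  rewrite -(ler_pM2r y1); apply: (@le_trans _ _ 1); last first.
    have : 0 <= x * x * (1 - 2 * x) by rewrite !mulr_ge0 //; lra.
    by rewrite /y; lra.
  have E : expR (- y) * expR y = 1 by rewrite -expRD addNr expR0.
  rewrite -[leRHS]E; apply: ler_wpM2l; [exact: expR_ge0|exact: expR_ge1Dx].
have b2 : 1 - x <= expR (- x) by exact: expR_ge1Dx.
apply/andP; split.
  have -> : - (k%:R * x * (1 + 2 * x)) = k%:R * (- (x * (1 + 2 * x))) by ring.
  by rewrite expRM_natl; apply: lerXn2r; rewrite ?nnegrE ?expR_ge0 //; lra.
rewrite -mulrN expRM_natl; apply: lerXn2r; rewrite ?nnegrE ?expR_ge0 //; lra.
Qed.

End Elementary.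

(** * Exit rate, geometric law of survival, and limit laws *)

Section Asymptotics.
Variables (R : realType) (c : R) (T L Rr : R -> R) (kappa D d : R) (m : set R -> R) (H h : R -> R).
Hypothesis im : indiff_map c T L Rr kappa D d.
Hypothesis am : acim T m.
Hypothesis H_diff : forall x y, x <= y -> H y - H x = m [set z | x < z <= y].
Hypothesis H0 : H 0 = 0.
Hypothesis H1 : H 1 = 1.
Hypothesis H_cont : forall eps, 0 < eps -> exists2 delta, 0 < delta &
  forall x y, 0 <= x -> x <= y -> y <= 1 -> y - x < delta -> H y - H x < eps.
Hypothesis h_ge0 : forall x, 0 <= h x.
Hypothesis H_ub : forall x y M, 0 <= x -> x <= y -> y <= 1 ->
  (forall z, x <= z -> z <= y -> h z <= M) -> H y - H x <= M * (y - x).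
Hypothesis H_lb : forall x y M, 0 <= x -> x <= y -> y <= 1 ->
  (forall z, x <= z -> z <= y -> M <= h z) -> M * (y - x) <= H y - H x.
Hypothesis h_mod : forall a b eta, 0 < a -> a <= b -> b < 1 -> 0 < eta -> exists2 K, 0 <= K &
  forall x y, a <= x <= b -> a <= y <= b -> h x <= h y + eta + K * `|x - y|.

Local Notation psi := (orbit_psi L Rr).
Local Notation b n := (orbitL L n 1).
Local Notation surv := (survival c psi).
Local Notation Kreg := (Kreg kappa D).
Let fb := im_fb im.
Let c_gt0 : 0 < c. Proof. by case/andP: (im_c01 im). Qed.
Let c_lt1 : c < 1. Proof. by case/andP: (im_c01 im). Qed.

Let H_le x y : x <= y -> H x <= H y.
Proof.
by move=> xy; rewrite -subr_ge0 H_diff // (acim_ge0 am) //; exact: msr_oc.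
Qed.

Let b_small eps : 0 < eps -> exists n, forall k, (n <= k)%N -> b k < eps.
Proof. exact: (im_b im). Qed.

Let Hb_small eps : 0 < eps -> exists n, forall k, (n <= k)%N -> H (b k) < eps.
Proof.
move=> e0; have [del del0 hd] := H_cont e0.
have [n hn] := b_small del0; exists n => k nk.
have := hd 0 (b k) (lexx _) (ltW (b_gt0 im k)) (b_le1 im k); rewrite !subr0 H0 subr0; apply.
exact: hn.
Qed.

(* Invariance iterated: the first returns up to time [J], plus what is still on the left branch. *)
Let H_return J x y : c <= x -> x <= y -> y <= 1 ->
  H y - H x = (pullback psi J H y - pullback psi J H x) + (H (orbitL L J y) - H (orbitL L J x)).
Proof.
move=> cx xy y1; elim: J => [|J IH]; first by rewrite /pullback !big_ord0 subrr add0r.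
rewrite IH /pullback !big_ord_recr /=.
have hx : c <= x <= 1 by rewrite cx (le_trans xy).
have hy : c <= y <= 1 by rewrite y1 (le_trans cx).
have /andP[ox _] := orbitL01 im J hx; have /andP[_ oy] := orbitL01 im J hy.
have xy' : orbitL L J x <= orbitL L J y.
  elim: J {IH ox oy} => [//|J IHJ]; rewrite !orbitLS.
  have /andP[ox _] := orbitL01 im J hx; have /andP[_ oy] := orbitL01 im J hy.
  by move: IHJ; rewrite le_eqVlt => /orP[/eqP ->//|lt]; apply/ltW/(im_Llt im).
rewrite (H_invariant im am H_diff ox xy' oy) !orbitLS /orbit_psi; ring.
Qed.

Let orbitL_mono J x y : c <= x -> x <= y -> y <= 1 -> orbitL L J x <= orbitL L J y.
Proof.
move=> cx xy y1; elim: J => [//|J IH]; rewrite !orbitLS.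
have /andP[ox _] := orbitL01 im J (introT andP (conj cx (le_trans xy y1))).
have /andP[_ oy] := orbitL01 im J (introT andP (conj (le_trans cx xy) y1)).
by move: IH; rewrite le_eqVlt => /orP[/eqP ->//|lt]; apply/ltW/(im_Llt im).
Qed.

Lemma H_incr : increasing_on c H. Proof. by move=> x y _ xy _; exact: H_le. Qed.

Lemma incr_orbit i : increasing_on c (fun x => H (orbitL L i x)).
Proof. by move=> x y cx xy y1; apply: H_le; exact: orbitL_mono. Qed.

Lemma h_near_c eta : 0 < eta -> exists2 delta, 0 < delta &
  forall y, c <= y < c + delta -> y < 1 /\ h c - eta <= h y <= h c + eta.
Proof.
move=> e0; pose b' := (c + 1) / 2.
have [K K0 hK] : exists2 K, 0 <= K &
  forall x y, c <= x <= b' -> c <= y <= b' -> h x <= h y + eta / 2 + K * `|x - y|.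
  by apply: h_mod; rewrite /b' ?divr_gt0 //; have := c_lt1; lra.
exists (Num.min ((1 - c) / 2) (eta / 2 / (K + 1))).
  by rewrite lt_min !divr_gt0 ?subr_gt0 //; lra.
move=> y /andP[cy]; rewrite -ltrBlDl lt_min => /andP[y1 y2].
have cc : c <= c <= b' by rewrite /b' lexx /=; have := c_lt1; lra.
have cyb : c <= y <= b' by rewrite cy /b'; lra.
have := hK _ _ cc cyb; have := hK _ _ cyb cc.
rewrite [`|y - c|]ger0_norm ?subr_ge0 // [`|c - y|]ler0_norm ?subr_le0 // opprB.
have : K * (y - c) <= eta / 2.
  rewrite ltr_pdivlMr in y2; last by lra.
  have : 0 <= y - c by rewrite subr_ge0.
  lra.
by have := c_lt1; move=> ? ? ? ?; split; [lra|apply/andP; split; lra].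
Qed.

Lemma H_reg : regular_on c 1 Kreg H.
Proof.
apply: (invariant_reg fb (h := h)) => //.
- exact: H_incr.
- move=> J x y cx xy y1; have := H_return J cx xy y1.
  have := H_le (orbitL_mono J cx xy y1); lra.
- move=> eps e0; have [del del0 hd] := H_cont e0.
  have [J hJ] := fb_shrink fb del0; exists J; apply: ltW; apply: hd.
  + exact: ltW.
  + exact: (psi1_ge fb).
  + exact: (psi1_le fb).
  + exact: hJ.
- move=> eps e0; have [del del0 hd] := H_cont e0.
  exists (1 - Num.min (del / 2) ((1 - c) / 2)).
  set t := Num.min _ _.
  have t0 : 0 < t by rewrite /t lt_min !divr_gt0 ?subr_gt0.
  have t1 : t <= (1 - c) / 2 by rewrite /t ge_min lexx orbT.
  have t2 : t <= del / 2 by rewrite /t ge_min lexx.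
  split; first by have := c_lt1; move=> ?; apply/andP; split; lra.
  by apply/ltW/hd => //; have := c_gt0; lra.
- by move=> x y M cx; apply: H_ub; exact: le_trans (ltW c_gt0) cx.
- by move=> x y M cx; apply: H_lb; exact: le_trans (ltW c_gt0) cx.
move=> b' eta b1 e0; have [cb|bc] := leP c b'; first exact: h_mod.
exists 0 => // x y /andP[h1 h2]; have := le_lt_trans (le_trans h1 h2) bc; by rewrite ltxx.
Qed.

(** [orbitL L i] is not itself a return branch. Iterated invariance writes these increments as the
    sum of those of [H \o psi k] over [i <= k < J], each regular, plus a remainder of at most
    [H (b J)]. *)
Lemma H_orbit_reg i : regular_on c 1 Kreg (fun x => H (orbitL L i x)).
Proof.
move=> p r x1 x2 y1 y2 cp px1 x12 x2r py1 y12 y2r r1; rewrite mul1r.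
have cx1 := le_trans cp px1; have cy1 := le_trans cp py1.
have x21 := le_trans x2r r1; have y21 := le_trans y2r r1.
set E := expR _.
have E0 : 0 <= E by exact: expR_ge0.
have L0 : 0 <= x2 - x1 by rewrite subr_ge0.
have M0 : 0 <= y2 - y1 by rewrite subr_ge0.
have L1 : x2 - x1 <= 1 by have := c_gt0; lra.
have M1 : y2 - y1 <= 1 by have := c_gt0; lra.
apply/ler_addgt0Pr => eps e0.
have [n hn] := Hb_small e0.
pose J := (n + i)%N.
have iJ : (i <= J)%N by rewrite leq_addl.
pose V x := pullback psi J H x - pullback psi i H x.
have rV : regular_on c 1 Kreg V.
  have -> : V = (fun x => \sum_(k < n) (H \o psi (i + k)) x).
    apply/funext => x; rewrite /V /J addnC /pullback big_split_ord /= addrAC subrr add0r.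
    by [].
  elim: n {hn J iJ V} => [|n IH].
    by move=> *; rewrite !big_ord0 !subrr !(mul0r, mulr0).
  have -> : (fun x => \sum_(k < n.+1) (H \o psi (i + k)) x) =
     (fun x => \sum_(k < n) (H \o psi (i + k)) x + (H \o psi (i + n)) x).
    by apply/funext => x; rewrite big_ord_recr.
  apply: reg_add => //.
  apply: (@reg_le _ _ 1 1 (kappa * Kreg + D)) => //.
  - have := Kreg_contr fb (lexx 0); rewrite addr0 mulr0 addr0; have := fb_kappa_ge0 fb; lra.
  - by apply: (incr_comp fb); exact: H_incr.
  - by apply: (reg_comp fb) => //; [exact: Kreg_ge0 fb|exact: H_incr|exact: H_reg].
have key x y : c <= x -> x <= y -> y <= 1 ->
    V y - V x <= H (orbitL L i y) - H (orbitL L i x) <= V y - V x + eps.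
  move=> cx xy yl; have := H_return J cx xy yl; have := H_return i cx xy yl.
  have o1 := H_le (orbitL_mono J cx xy yl).
  have : H (orbitL L J y) - H (orbitL L J x) <= eps.
    have := hn J (leq_addr _ _); have /andP[_ h2] := orbitL_bounds im J (introT andP (conj (le_trans cx xy) yl)).
    have := H_le h2.
    have /andP[h3 _] := orbitL01 im J (introT andP (conj cx (le_trans xy yl))).
    have := H_le h3; rewrite H0; lra.
  by rewrite /V => *; apply/andP; split; lra.
have := rV _ _ _ _ _ _ cp px1 x12 x2r py1 y12 y2r r1; rewrite mul1r -/E.
have /andP[k1 k2] := key _ _ cx1 x12 x21; have /andP[k3 k4] := key _ _ cy1 y12 y21.
move: (H _ - _) (H _ - _) k1 k2 k3 k4 => u v k1 k2 k3 k4 hV.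
apply: (@le_trans _ _ ((V x2 - V x1) * (y2 - y1) + eps * (y2 - y1))).
  by rewrite -mulrDl ler_wpM2r.
apply: lerD; last by rewrite ler_piMr // ltW.
apply: (le_trans hV); apply: ler_wpM2l => //; exact: ler_wpM2r.
Qed.

(* Measure of the points that leave [[0, b_N]] in one step. *)
Definition exit_mass N := H (b N) - H (b N.+1).
Local Notation th := exit_mass.

(** Invariance on [[0, b N]], whose preimage consists of [[0, b N.+1]] and [[c, Rr (b N)]] up to
    null sets. *)
Lemma thE N : th N = H (Rr (b N)) - H c.
Proof.
have := H_invariant im am H_diff (lexx 0) (ltW (b_gt0 im N)) (b_le1 im N).
rewrite H0 (im_L0 im) (im_R0 im) H0 /th orbitLS; lra.
Qed.

Lemma mass_orbit i : mass_on c (fun x => H (orbitL L i x)) = th i.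
Proof. by rewrite /mass_on (orbitL_c im) /th. Qed.

Lemma th_ge0 N : 0 <= th N.
Proof. by rewrite subr_ge0; apply: H_le; apply/ltW/(b_decr im). Qed.

Lemma th_sum M N : \sum_(i < N) th (M + i) = H (b M) - H (b (M + N)).
Proof.
elim: N => [|N IH]; first by rewrite big_ord0 addn0 subrr.
by rewrite big_ord_recr /= IH /th addnS; lra.
Qed.

(** If [[c, 1]] had no mass, nothing could leave any [[0, b n]], so each would have full measure,
    although their measures tend to [0]. *)
Lemma mass_H_gt0 : 0 < mass_on c H.
Proof.
rewrite lt_neqAle (mass_ge0 c_lt1 H_incr) andbT; apply/eqP => /esym mH.
have hb n : H (b n) = 1.
  elim: n => [//|n IH].
  have := th_ge0 n; rewrite thE.
  have Rb : Rr (b n) <= 1.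
    have := b_le1 im n; rewrite le_eqVlt => /orP[/eqP ->|lt]; first by rewrite (im_R1 im).
    by rewrite -[leRHS](im_R1 im); apply/ltW/(im_Rlt im) => //; exact: (ltW (b_gt0 im n)).
  have := H_le Rb; have := thE n; rewrite /th IH; move: mH; rewrite /mass_on; lra.
have [n hn] := Hb_small (@ltr01 R).
by have := hn n (leqnn n); rewrite hb ltxx.
Qed.

(** Regularity bounds the increments of [H] below by [be] times the length, while [h c = 0] would
    bound them above by half of this close to [c]. *)
Lemma density_gt0 : 0 < h c.
Proof.
rewrite lt_neqAle h_ge0 andbT; apply/eqP => /esym hc.
pose be := expR (- Kreg) * mass_on c H / (1 - c).
have be0 : 0 < be by rewrite divr_gt0 ?subr_gt0 // mulr_gt0 ?expR_gt0 ?mass_H_gt0.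
have be2 : 0 < be / 2 by rewrite divr_gt0.
have [del del0 hd] := h_near_c be2.
pose y := c + Num.min (del / 2) ((1 - c) / 2).
set t := Num.min _ _ in y.
have t0 : 0 < t by rewrite /t lt_min !divr_gt0 ?subr_gt0.
have t1 : t <= (1 - c) / 2 by rewrite /t ge_min lexx orbT.
have t2 : t <= del / 2 by rewrite /t ge_min lexx.
have cy : c <= y by rewrite /y; lra.
have y1 : y <= 1 by rewrite /y; have := c_lt1; lra.
have lo := reg_ge (ltW c_gt0) c_lt1 (Kreg_ge0 fb) H_incr H_reg (lexx c) cy y1.
have : H y - H c <= be / 2 * (y - c).
  apply: H_ub => //; first exact: ltW.
  move=> z cz zy; have hz : c <= z < c + del by rewrite cz /=; rewrite /y in zy; lra.
  by have [_ /andP[_]] := hd z hz; rewrite hc add0r.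
have -> : y - c = t by rewrite /y; ring.
move: lo; have -> : y - c = t by rewrite /y; ring.
have -> : expR (- Kreg) * (mass_on c H * t) = be * t * (1 - c).
  by rewrite /be; field; rewrite subr_eq0 gt_eqF.
rewrite ler_pM2r ?subr_gt0 // => lo up.
have := le_trans lo up; rewrite ler_pM2r //; lra.
Qed.

Local Notation F := (Fsurv T L m).

Lemma th_antitone i j : (i <= j)%N -> th j <= th i.
Proof.
move=> ij; rewrite !thE lerD2r; apply: H_le.
have := b_antitone im ij; rewrite le_eqVlt => /orP[/eqP ->//|lt].
by apply/ltW/(im_Rlt im) => //; [exact: (ltW (b_gt0 im j))|exact: (b_le1 im)].
Qed.

Lemma N_th_small eps : 0 < eps -> exists n, forall N, (n <= N)%N -> N.+1%:R * th N <= eps.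
Proof.
move=> e0; have e2 : 0 < eps / 2 by rewrite divr_gt0.
have [n hn] := Hb_small e2; exists (2 * n)%N => N nN.
pose k := (N - n)%N.
(* For [N >= 2 * n] the indices from [n] to [N] make up at least half of [N.+1]. *)
have hk : (N.+1 <= 2 * k.+1)%N by rewrite /k; clear -nN; lia.
have : k.+1%:R * th N <= eps / 2.
  apply: le_trans (ltW (hn n (leqnn n))).
  apply: (@le_trans _ _ (\sum_(i < k.+1) th (n + i))).
    have -> : k.+1%:R * th N = \sum_(i < k.+1) th N by rewrite sumr_const card_ord mulr_natl.
    apply: ler_sum => i _; apply: th_antitone; have := ltn_ord i; rewrite /k; clear -nN; lia.
  rewrite th_sum; have := H_le (ltW (b_gt0 im (n + k.+1))); rewrite H0; lra.
move=> h1; apply: (@le_trans _ _ ((2 * k.+1)%:R * th N)).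
  by rewrite ler_wpM2r ?th_ge0 // ler_nat.
by rewrite natrM; lra.
Qed.

Lemma F_step N n : (0 < N)%N -> 0 <= F N n - F N n.+1.
Proof. by move=> N0; have [] := Fsurv_step_le im am H_diff n N0. Qed.

Lemma F_stepS N n : (0 < N)%N -> F N n.+1 - F N n.+2 <= th N.
Proof. by move=> N0; have [] := Fsurv_step_le im am H_diff n N0. Qed.

Lemma F_0 N : F N 0 = 1. Proof. exact: (Fsurv0 L am). Qed.

Lemma F_le1 N n : (0 < N)%N -> F N n <= 1.
Proof.
move=> N0; elim: n => [|n IH]; first by rewrite F_0.
by have := F_step n N0; lra.
Qed.

Lemma F_drop N n k : (0 < N)%N -> F N n - F N (n + k) <= H (b N) + k%:R * th N.
Proof.
move=> N0.
have Hb0 : 0 <= H (b N) by rewrite -H0; apply/H_le/ltW/(b_gt0 im).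
have drop1 i j : F N i.+1 - F N (i.+1 + j) <= j%:R * th N.
  elim: j => [|j IH]; first by rewrite addn0 subrr mul0r.
  rewrite addnS -[j.+1%:R]natr1; have := F_stepS (i + j) N0; rewrite -addSn; lra.
case: n => [|n]; last by have := drop1 n k; lra.
case: k => [|k]; first by rewrite addn0 subrr mul0r addr0.
have := drop1 0%N k; rewrite add1n add0n F_0.
have := Fsurv1 im am H_diff H0 N; have := th_ge0 N; rewrite -[k.+1%:R]natr1; lra.
Qed.

Lemma F_lower N n : (0 < N)%N -> 1 - F N n <= H (b N) + n%:R * th N.
Proof. by move=> N0; have := F_drop 0 n N0; rewrite add0n F_0. Qed.

(** [A] and [B] compare [F] with [wref], [C1] and [C2] compare the decrements divided by [th N] with
    it; eliminating [wref] compares them with each other. [F_drop] pays for the time shifts, which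
    are at most [N + M]. *)
Lemma F_difference eta : 0 < eta -> exists (k0 : nat -> nat) (e : nat -> R) n1, forall N, (n1 <= N)%N ->
  [/\ (0 < N)%N, 0 <= e N <= eta, (k0 N)%:R * th N + H (b N) <= e N, th N <= e N &
   forall k, (k0 N <= k)%N -> th N * (F N k - e N) <= F N k - F N k.+1 <= th N * (F N k + e N)].
Proof.
move=> e0; pose eta' := eta / 5.
have e'0 : 0 < eta' by rewrite divr_gt0.
have [M [N0 equi]] := surv_equidistribution fb e'0.
have eM : 0 < eta' / M.+2%:R by rewrite divr_gt0.
have [n1 hn1] := Hb_small e'0.
have [n2 hn2] := N_th_small eM.
(* The error [e N] allows for two equidistribution errors, two masses of the target and one time
   shift, each at most [eta / 5]. The shift is controlled through [(N + M).+1 <= N.+1 * M.+2],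
   whence the divisor in [eM]. *)
exists (fun N => (N + M)%N), (fun N => 2 * eta' + 2 * H (b N) + (N + M).+1%:R * th N).
exists (maxn N0 (maxn n1 n2)).+1 => N hN.
have := ltnW hN; rewrite !geq_max => /and3P[NN0 Nn1 Nn2].
have N_gt0 : (0 < N)%N by apply: leq_trans hN.
have Hb0 : 0 <= H (b N) by rewrite -H0; apply/H_le/ltW/(b_gt0 im).
have Hb1 := hn1 N Nn1.
have th0 := th_ge0 N.
have NM : (N + M).+1%:R * th N <= eta'.
  have := hn2 N Nn2; rewrite ler_pdivlMr ?ltr0n // => hh.
  apply: le_trans hh; rewrite mulrAC ler_wpM2r // -natrM ler_nat; nia.
have kth : (N + M)%:R * th N <= (N + M).+1%:R * th N by rewrite ler_wpM2r // ler_nat.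
have e_ge : th N <= (N + M).+1%:R * th N by rewrite ler_peMl // ler1n.
have nm0 : 0 <= (N + M)%:R * th N by rewrite mulr_ge0.
have -> : 0 <= 2 * eta' + 2 * H (b N) + (N + M).+1%:R * th N <= eta.
  by apply/andP; split; [lra|rewrite /eta' in e'0 Hb1 NM *; lra].
split => //; [lra|lra|].
have equiN := equi N NN0.
pose w n := wref c psi N n.
have w0 n : 0 <= w n := wref_ge0 fb N n.
have w1 n : w n <= 1 := wref_le1 fb N n.
have sumth : \sum_(i < N) th i = 1 - H (b N).
  by have := th_sum 0 N; rewrite /= add0n H1 => <-; apply: eq_bigr => i _.
have Hb_le1 : H (b N) <= 1 by rewrite -[leRHS]H1; apply: H_le; exact: (b_le1 im).
have A n : w n - eta' - H (b N) <= F N n.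
  apply: le_trans (Fsurv_ge im am H_diff N n).
  apply: (@le_trans _ _ (\sum_(i < N) th i * (w n - eta'))).
    rewrite -mulr_suml sumth; have := w0 n; have := w1 n.
    have : H (b N) * (w n - eta') <= H (b N) by rewrite ler_piMr //; have := w1 n; lra.
    lra.
  apply: ler_sum => i _; rewrite -mass_orbit.
  by have [] := equiN n _ (incr_orbit i) (H_orbit_reg i).
have B n : F N (n + M + N) <= w n + eta' + H (b N).
  apply: le_trans (Fsurv_le im am H_diff H0 N (n + M)) _.
  have : \sum_(i < N) surv N (n + M) (fun x => H (orbitL L i x)) <= \sum_(i < N) th i * (w n + eta').
    apply: ler_sum => i _; rewrite -mass_orbit.
    by have [] := equiN n _ (incr_orbit i) (H_orbit_reg i).
  rewrite -mulr_suml sumth.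
  have : 0 <= H (b N) * (w n + eta') by rewrite mulr_ge0 // addr_ge0 // ltW.
  lra.
have C1 n : th N * (w n - eta') <= F N (n + N) - F N (n + N).+1.
  rewrite (Fsurv_stepN im am H_diff n N_gt0) -mass_orbit.
  by have [] := equiN n _ (incr_orbit N) (H_orbit_reg N).
have C2 n : F N (n + M + N) - F N (n + M + N).+1 <= th N * (w n + eta').
  rewrite (Fsurv_stepN im am H_diff (n + M) N_gt0) -mass_orbit.
  by have [] := equiN n _ (incr_orbit N) (H_orbit_reg N).
move=> k hk; apply/andP; split.
  have := C1 (k - N)%N; rewrite subnK ?(leq_trans (leq_addr M N) hk) //.
  apply: le_trans; apply: ler_wpM2l => //.
  have := B (k - N)%N; rewrite addnAC subnK ?(leq_trans (leq_addr M N) hk) //.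
  have := F_drop k M N_gt0.
  have : M%:R * th N <= (N + M).+1%:R * th N by rewrite ler_wpM2r // ler_nat leqW // leq_addl.
  lra.
have := C2 (k - (N + M))%N; rewrite -addnA (addnC M) subnK //.
move=> hh; apply: (le_trans hh); apply: ler_wpM2l => //.
have := A (k - (N + M))%N.
have := F_drop (k - (N + M)) (N + M) N_gt0; rewrite subnK //; lra.
Qed.

(** The map [u -> (1 - th N) * u + th N * e N] fixes [e N], so the errors of the difference equation
    do not accumulate with [k]. Before [k0 N] both sequences are within [e N] of [1]. *)
Theorem F_geometric eta : 0 < eta -> exists n1, forall N, (n1 <= N)%N ->
  forall k, `|F N k - (1 - th N) ^+ k| <= eta.
Proof.
move=> e0; have e4 : 0 < Num.min (eta / 4) (1 / 2).
  by rewrite lt_min divr_gt0 //= divr_gt0.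
have [k0 [e [n1 hn1]]] := F_difference e4.
exists n1 => N hN; have [N0 /andP[en0 en1] ke te step] := hn1 N hN.
have eta4 : e N <= eta / 4 by apply: le_trans en1 _; rewrite ge_min lexx.
have th0 := th_ge0 N.
have th1 : th N <= 1.
  apply: le_trans te _; apply: le_trans en1 _; rewrite ge_min; apply/orP; right; lra.
have Hb0 : 0 <= H (b N) by rewrite -H0; apply/H_le/ltW/(b_gt0 im).
have t01 : 0 <= 1 - th N by rewrite subr_ge0.
have p0 k : 0 <= (1 - th N) ^+ k by rewrite exprn_ge0.
have p1 k : (1 - th N) ^+ k <= 1 by rewrite exprn_ile1 // gerBl.
move=> k; have [kk|kk] := leqP (k0 N) k; last first.
  have h1 := F_lower k N0; have h2 := F_le1 k N0.
  have h3 : 1 - k%:R * th N <= (1 - th N) ^+ k by apply: bernoulli_ge; rewrite th0.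
  have h4 : k%:R * th N <= (k0 N)%:R * th N by rewrite ler_wpM2r // ler_nat ltnW.
  have := p1 k; rewrite ler_norml => h5; apply/andP; split; lra.
rewrite -(subnK kk); move: (k - k0 N)%N => l.
have up : F N (l + k0 N) <= (1 - th N) ^+ l + e N.
  elim: l => [|l IH]; first by rewrite add0n expr0; have := F_le1 (k0 N) N0; lra.
  have /andP[h1 _] := step (l + k0 N)%N (leq_addl _ _).
  have := ler_wpM2l t01 IH; rewrite exprS addSn; lra.
have lo : (1 - th N) ^+ l * F N (k0 N) - e N <= F N (l + k0 N).
  elim: l {up} => [|l IH]; first by rewrite add0n expr0; lra.
  have /andP[_ h1] := step (l + k0 N)%N (leq_addl _ _).
  have := ler_wpM2l t01 IH; rewrite exprS addSn; lra.
have h1 := F_lower (k0 N) N0.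
have h2 : (1 - th N) ^+ l - e N <= (1 - th N) ^+ l * F N (k0 N).
  have : (1 - th N) ^+ l * (1 - F N (k0 N)) <= 1 - F N (k0 N).
    by rewrite ler_piMl // subr_ge0 F_le1.
  lra.
have h3 : 1 - (k0 N)%:R * th N <= (1 - th N) ^+ k0 N by apply: bernoulli_ge; rewrite th0.
have h4 : (1 - th N) ^+ (l + k0 N) <= (1 - th N) ^+ l by rewrite exprD ler_piMr.
have h5 : (1 - th N) ^+ l - e N <= (1 - th N) ^+ (l + k0 N).
  rewrite exprD; have : (1 - th N) ^+ l * (1 - (1 - th N) ^+ k0 N) <= 1 - (1 - th N) ^+ k0 N.
    by rewrite ler_piMl // subr_ge0.
  lra.
rewrite ler_norml; apply/andP; split; lra.
Qed.

Definition hitting_rate := h c / d.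
Local Notation al := hitting_rate.

Lemma al_gt0 : 0 < al. Proof. by rewrite divr_gt0 ?density_gt0 // (im_d im). Qed.

Lemma th_asymp eta : 0 < eta -> exists n1, forall N, (n1 <= N)%N ->
  (1 - eta) * (al * b N) <= th N <= (1 + eta) * (al * b N).
Proof.
move=> e0; have hc := density_gt0; have d0 := im_d im; have al0 := al_gt0.
(* Two relative errors [e] are multiplied, one from the density and one from the slope of [Rr];
   [e <= 1] gives [(1 + e) ^ 2 <= 1 + 3 * e]. *)
pose e := Num.min 1 (eta / 3).
have e1 : 0 < e by rewrite lt_min ltr01 divr_gt0.
have e_le1 : e <= 1 by rewrite ge_min lexx.
have e_le : e <= eta / 3 by rewrite ge_min lexx orbT.
have [del1 del10 hd1] := h_near_c (mulr_gt0 e1 hc).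
have [del2 del20 hd2] := im_Rtan im (divr_gt0 e1 d0).
have [n1 hn1] := b_small del20.
have [n2 hn2] := b_small (divr_gt0 (mulr_gt0 del10 d0) (ltac:(lra) : 0 < 1 + e)).
exists (maxn n1 n2) => N; rewrite geq_max => /andP[Nn1 Nn2].
have b0 := b_gt0 im N.
have bd2 := hn1 N Nn1.
have := hn2 N Nn2; rewrite ltr_pdivlMr; last by lra.
move=> bd1.
have := hd2 (b N) (introT andP (conj b0 bd2)); rewrite ler_norml => /andP[v1 v2].
rewrite thE; set v := Rr (b N) in v1 v2 *.
have vlo : (1 - e) * (b N / d) <= v - c.
  have -> : (1 - e) * (b N / d) = b N / d - e / d * b N by ring.
  lra.
have vup : v - c <= (1 + e) * (b N / d).
  have -> : (1 + e) * (b N / d) = b N / d + e / d * b N by ring.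
  lra.
have cv : c <= v.
  by rewrite /v -(im_R0 im); apply/ltW/(im_Rlt im) => //; exact: (b_le1 im).
have vdel : v < c + del1.
  suff : v - c < del1 by lra.
  apply: le_lt_trans vup _; rewrite mulrA ltr_pdivrMr //; lra.
have v1' : v <= 1.
  have [hv _] := hd1 v (introT andP (conj cv vdel)); exact: ltW.
have Hup : H v - H c <= (h c + e * h c) * (v - c).
  apply: H_ub => //; first exact: ltW.
  move=> z cz zv; have [_ /andP[_ //]] := hd1 z (introT andP (conj cz (le_lt_trans zv vdel))).
have Hlo : (h c - e * h c) * (v - c) <= H v - H c.
  apply: H_lb => //; first exact: ltW.
  move=> z cz zv; have [_ /andP[//]] := hd1 z (introT andP (conj cz (le_lt_trans zv vdel))).
have E : al * b N = h c * (b N / d) by rewrite /al; ring.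
have bd0 : 0 < b N / d by rewrite divr_gt0.
rewrite E; set u := b N / d in vlo vup bd0 *.
have hu0 : 0 < h c * u by rewrite mulr_gt0.
apply/andP; split.
  apply: le_trans Hlo; apply: (@le_trans _ _ ((h c - e * h c) * ((1 - e) * u))); last first.
    by apply: ler_wpM2l => //; rewrite subr_ge0 ler_piMl // ltW.
  have : 0 <= (h c * u) * (e * e + (eta - 2 * e)) by rewrite mulr_ge0 ?(ltW hu0) //; nra.
  lra.
apply: (le_trans Hup); apply: (@le_trans _ _ ((h c + e * h c) * ((1 + e) * u))).
  by apply: ler_wpM2l => //; rewrite addr_ge0 // ?mulr_ge0 // ltW.
have : 0 <= (h c * u) * (eta - 2 * e - e * e) by rewrite mulr_ge0 ?(ltW hu0) //; nra.
lra.
Qed.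

Lemma b_ratio eta : 0 < eta -> exists n1, forall N, (n1 <= N)%N -> b N <= (1 + eta) * b N.+1.
Proof.
move=> e0; have [del del0 hd] := im_Lratio im e0.
have [n1 hn1] := b_small del0; exists n1 => N hN; rewrite orbitLS; apply: hd.
by rewrite (b_gt0 im) hn1.
Qed.

Lemma th_comparable eta : 0 < eta -> exists n1, forall N a, (n1 <= N)%N -> b N.+1 < a <= b N ->
  [/\ 0 < al * a, (1 - eta) * (al * a) <= th N <= (1 + eta) * (al * a) &
    (1 - eta) * (al * a) <= th N.+1 <= (1 + eta) * (al * a)].
Proof.
move=> e0; pose e := Num.min 1 (eta / 3).
have e1 : 0 < e by rewrite lt_min ltr01 divr_gt0.
have e_le1 : e <= 1 by rewrite ge_min lexx.
have e_le : e <= eta / 3 by rewrite ge_min lexx orbT.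
have [n1 hn1] := th_asymp e1; have [n2 hn2] := b_ratio e1.
exists (maxn n1 n2) => N a; rewrite geq_max => /andP[Nn1 Nn2] /andP[ba ab].
have /andP[t1 t2] := hn1 N Nn1.
have /andP[t3 t4] := hn1 N.+1 (leqW Nn1).
have r := hn2 N Nn2.
have al0 := al_gt0; have b0 := b_gt0 im N.+1; have a0 : 0 < a := lt_trans b0 ba.
have x1 : al * b N.+1 <= al * a by rewrite ler_wpM2l // ltW.
have x2 : al * a <= al * b N by rewrite ler_wpM2l // ltW.
have x3 : al * b N <= (1 + e) * (al * b N.+1) by rewrite mulrCA ler_wpM2l // ltW.
have x0 : 0 < al * b N.+1 by rewrite mulr_gt0.
split; first exact: mulr_gt0.
  move: (al * b N) (al * b N.+1) (al * a) x0 x1 x2 x3 t1 t2 => p q s x0 x1 x2 x3 t1 t2.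
  by apply/andP; split; nra.
move: (al * b N) (al * b N.+1) (al * a) x0 x1 x2 x3 t3 t4 => p q s x0 x1 x2 x3 t3 t4.
apply/andP; split; last by nra.
apply: le_trans t3; have [eta1|eta1] := leP 1 eta.
  apply: (@le_trans _ _ 0).
    by rewrite mulr_le0_ge0 //; [lra|apply: ltW; apply: lt_le_trans x1].
  by rewrite mulr_ge0 ?(ltW x0) //; lra.
apply: (@le_trans _ _ ((1 - eta) * ((1 + e) * q))).
  by apply: ler_wpM2l; [lra|exact: le_trans x3].
rewrite mulrA; apply: ler_wpM2r; first exact: ltW.
have : 0 <= eta * e by rewrite mulr_ge0 // ltW.
lra.
Qed.

(** Successive exit masses have ratio tending to [1], so each of the next [K] is at least half of
    [th N], while their sum is at most [H (b N.+1)]; [K >= 2 / eps] is enough. *)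
Lemma th_ratio eps : 0 < eps -> exists n1, forall N, (n1 <= N)%N -> th N <= eps * H (b N.+1).
Proof.
move=> e0.
have := archi_boundP (ltW (divr_gt0 (ltr0n R 2) e0)); set K := Num.bound _ => hK.
have K0 : 0 < K%:R :> R by apply: le_lt_trans hK; rewrite divr_ge0 // ltW.
pose eta : R := 1 / (2 * K%:R).
have eta0 : 0 < eta by rewrite divr_gt0 // mulr_gt0.
have e4 : 0 < eta / 2 by rewrite divr_gt0.
have [n1 hn1] := th_comparable e4.
exists n1 => N hN.
have K1 : 1 <= K%:R :> R by rewrite ler1n; move: K0; rewrite ltr0n.
have eta1 : eta <= 1 / 2.
  by rewrite /eta ler_pdivrMr ?mulr_gt0 //; lra.
have step j : th (N + j) * (1 - eta) <= th (N + j).+1.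
  have [s0 /andP[_ h1] /andP[h2 _]] := hn1 (N + j)%N (b (N + j)) (leq_trans hN (leq_addr _ _))
    (introT andP (conj (b_decr im _) (lexx _))).
  apply: le_trans h2; move: (al * _) s0 h1 => s s0 h1.
  have h3 : (1 - eta) * th (N + j) <= (1 - eta) * ((1 + eta / 2) * s).
    by apply: ler_wpM2l => //; lra.
  have : 0 <= s * (eta * eta) by rewrite !mulr_ge0 // ltW.
  lra.
have low j : (1 - j%:R * eta) * th N <= th (N + j).
  elim: j => [|j IH]; first by rewrite addn0 mul0r subr0 mul1r.
  rewrite addnS; apply: le_trans (step j).
  have := ler_wpM2r (_ : 0 <= 1 - eta) IH; move=> /(_ ltac:(lra)).
  have : 0 <= j%:R * eta * eta * th N by rewrite !mulr_ge0 ?th_ge0 // ltW.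
  rewrite -[j.+1%:R]natr1; lra.
have sum_ge : \sum_(i < K) (th N / 2) <= H (b N.+1).
  apply: (@le_trans _ _ (\sum_(i < K) th (N.+1 + i))).
    apply: ler_sum => i _; rewrite addSn -addnS; apply: le_trans (low i.+1).
    rewrite mulrC; apply: ler_wpM2r; first exact: th_ge0.
    have : i.+1%:R * eta <= K%:R * eta by rewrite ler_wpM2r ?(ltW eta0) // ler_nat.
    have -> : K%:R * eta = 1 / 2 by rewrite /eta; field; rewrite gt_eqF.
    lra.
  rewrite th_sum; have := H_le (ltW (b_gt0 im (N.+1 + K))); rewrite H0; lra.
have h1 : K%:R * (th N / 2) <= H (b N.+1) by move: sum_ge; rewrite sumr_const card_ord mulr_natl.
have h2 : 2 <= eps * K%:R by move: hK; rewrite ltr_pdivrMr // mulrC => /ltW.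
have : th N <= eps * (K%:R * (th N / 2)) by have := th_ge0 N; nra.
move=> h3; apply: (le_trans h3); exact: (ler_wpM2l (ltW e0) h1).
Qed.

Definition hits (A : set R) (q : nat) := [set x : R | exists n, (0 < n <= q)%N /\ A (iter n T x)].

Lemma msr_hits A q : msr A -> msr (hits A q).
Proof.
move=> mA; elim: q => [|q IH].
  have -> : hits A 0 = set0 by apply/seteqP; split => // x [n [/andP[n0 n1] _]]; have := leq_trans n0 n1.
  exact: msr_measurable.
have -> : hits A q.+1 = hits A q `|` iter q.+1 T @^-1` A.
  apply/seteqP; split => x.
    move=> [n [/andP[n0 nq] An]]; have [E|ne] := eqVneq n q.+1.
      by right; rewrite /preimage -E.
    by left; exists n; rewrite n0 -ltnS ltn_neqAle ne nq.
  case=> [[n [hn An]]|Ax]; first by exists n; case/andP: hn => -> /leqW ->.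
  by exists q.+1; rewrite ltnS leqnn.
by apply: msrU => //; exact: (msr_iter am).
Qed.

Let iter01 n z : 0 <= z <= 1 -> 0 <= iter n T z <= 1.
Proof. by move=> hz; elim: n => [//|n IH]; exact: (im_T im). Qed.

Lemma m_hits_le A q N : msr A -> (forall z, 0 <= z <= 1 -> A z -> z <= b N) ->
  m (hits A q) <= 1 - F N q.
Proof.
move=> mA hA.
have m1 := msr_hits q mA; have m2 := msr_survives im am N q.
suff : m (hits A q) + F N q <= 1 by lra.
rewrite -(acim_add am m1 m2).
  by apply: (m_le1 im am); exact: msrU.
move=> z z01 [n [hn An]] hS.
have := hA _ (iter01 n z01) An; rewrite leNgt; apply/negP; rewrite negbK; exact: hS.
Qed.

Lemma m_hits_ge A q N : msr A -> (forall z, 0 <= z <= 1 -> z <= b N -> A z) ->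
  1 - F N q <= m (hits A q).
Proof.
move=> mA hA.
have m1 := msr_hits q mA; have m2 := msr_survives im am N q.
have E : 1 = m (hits A q) + m (~` hits A q).
  rewrite -(acim_add am m1 (msrC m1)); last by move=> z _ h1 h2; exact: h2.
  by rewrite setUv (acim_setT am).
suff : m (~` hits A q) <= F N q by lra.
apply: (m_le im am) => //; first exact: msrC.
move=> z [z01 _] hz i hi; rewrite ltNge; apply/negP => hle; apply: hz; exists i; split => //.
by apply: hA => //; exact: iter01.
Qed.

Lemma level_exists a : 0 < a <= 1 -> exists N, b N.+1 < a <= b N.
Proof.
move=> /andP[a0 a1]; have [n hn] := b_small a0.
have ex : exists n, b n < a by exists n; exact: hn.
have := ex_minnP ex => -[[|N] hN hmin]; first by have := lt_le_trans hN a1; rewrite ltxx.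
exists N; rewrite hN /= leNgt; apply/negP => h'; have := hmin N h'; by rewrite ltnn.
Qed.

Lemma level_large n : exists2 del, 0 < del &
  forall a N, a < del -> b N.+1 < a -> (n <= N)%N.
Proof.
exists (b n); first exact: (b_gt0 im).
move=> a N an Na; rewrite leqNgt; apply/negP => Nn.
have := b_antitone im Nn; have := lt_trans Na an; lra.
Qed.

Lemma hits_exponential t eps : 0 <= t -> 0 < eps -> exists2 del, 0 < del &
  forall (A : set R) a q, 0 < a -> a < del -> a <= 1 -> msr A ->
    (forall z, 0 <= z <= 1 -> A z -> z <= a) ->
    (forall z, 0 <= z <= 1 -> z < a -> A z) ->
    q%:R * (al * a) <= t -> t < q.+1%:R * (al * a) ->
  `|m (hits A q) - (1 - expR (- t))| <= eps.
Proof.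
(* Error budget: [eta] from the geometric law, and at most [5 * (eta * t) + 2 * eta] from comparing
   the power of [1 - th] with [expR (- t)]. *)
move=> t0 e0; pose eta := Num.min (1 / 2) (eps / (5 * (1 + t))).
have t1 : 0 < 1 + t by lra.
have eta0 : 0 < eta by rewrite lt_min !divr_gt0 // mulr_gt0.
have eta1 : eta <= 1 / 2 by rewrite ge_min lexx.
have eta2 : 5 * (1 + t) * eta <= eps.
  have : eta <= eps / (5 * (1 + t)) by rewrite ge_min lexx orbT.
  by rewrite ler_pdivlMr ?mulr_gt0 // mulrC.
have [n1 hn1] := th_comparable eta0.
have [n2 hn2] := F_geometric eta0.
have [n3 hn3] := N_th_small eta0.
have [del del0 hd] := level_large (maxn n1 (maxn n2 n3)).
exists del => // A a q a0 adel a1 mA hA1 hA2 hq1 hq2.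
have [N hN] := level_exists (introT andP (conj a0 a1)).
have /andP[bN1 bN2] := hN.
have := hd _ _ adel bN1; rewrite !geq_max => /and3P[Nn1 Nn2 Nn3].
have [s0 c1 c2] := hn1 N a Nn1 hN.
set s := al * a in s0 c1 c2 hq1 hq2.
have est j : (N <= j)%N -> (1 - eta) * s <= th j <= (1 + eta) * s ->
    `|F j q - expR (- t)| <= eps.
  move=> Nj /andP[x1 x2].
  have := hn2 j (leq_trans Nn2 Nj) q.
  have th_small : th j <= eta.
    apply: le_trans (hn3 j (leq_trans Nn3 Nj)).
    by rewrite ler_peMl ?th_ge0 // ler1n.
  have th0 := th_ge0 j.
  have half : 0 <= th j <= 2^-1 by rewrite th0 /=; lra.
  have /andP[p1 p2] := pow_exp q half.
  set x := th j in x1 x2 th_small th0 half p1 p2 *.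
  have q0 : 0 <= q%:R :> R by [].
  have qx1 : q%:R * x <= (1 + eta) * t.
    apply: (@le_trans _ _ (q%:R * ((1 + eta) * s))); first by rewrite ler_wpM2l.
    by rewrite mulrCA ler_wpM2l //; lra.
  have sx : s <= 2 * x.
    have : 0 <= (1 / 2 - eta) * s by rewrite mulr_ge0 ?(ltW s0) // subr_ge0.
    lra.
  have qx2 : t - eta * t - s <= q%:R * x.
    apply: (@le_trans _ _ (q%:R * ((1 - eta) * s))); last by rewrite ler_wpM2l.
    have : t - s <= q%:R * s by rewrite -[q.+1%:R]natr1 in hq2; lra.
    have eta10 : 0 <= 1 - eta by lra.
    move/(ler_wpM2l eta10).
    have : 0 <= eta * s by rewrite mulr_ge0 // ltW.
    lra.
  have q00 : 0 <= q%:R * x by rewrite mulr_ge0.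
  have k1 := expR_lip q00 t0.
  have q01 : 0 <= q%:R * x * (1 + 2 * x) by rewrite mulr_ge0 //; lra.
  have k2 := expR_lip q01 t0.
  have et0 : 0 <= eta * t by rewrite mulr_ge0 // ltW.
  have d1 : `|q%:R * x - t| <= eta * t + 2 * eta by rewrite ler_norml; apply/andP; split; lra.
  have d3 : 0 <= q%:R * x * (2 * x) <= 4 * (eta * t).
    rewrite mulr_ge0 ?mulr_ge0 //=.
    apply: (@le_trans _ _ (2 * t * (2 * eta))); last by lra.
    apply: ler_pM => //; [by rewrite mulr_ge0| |by lra].
    apply: (le_trans qx1); have : eta * t <= 1 / 2 * t by rewrite ler_wpM2r.
    lra.
  have d2 : `|q%:R * x * (1 + 2 * x) - t| <= 5 * (eta * t) + 2 * eta.
    have -> : q%:R * x * (1 + 2 * x) - t = q%:R * x - t + q%:R * x * (2 * x) by ring.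
    move: d1; rewrite !ler_norml => /andP[? ?]; case/andP: d3 => ? ?.
    by apply/andP; split; lra.
  move: (le_trans k1 d1) (le_trans k2 d2) => {}k1 {}k2.
  rewrite -/x; move: k1 k2 p1 p2; rewrite !ler_norml.
  move: (expR _) (expR _) (expR _) ((1 - x) ^+ q) => e1 e2 e3 p /andP[? ?] /andP[? ?] ? ? /andP[? ?].
  by apply/andP; split; lra.
have E1 := est N (leqnn N) c1; have E2 := est N.+1 (leqnSn N) c2.
have M1 : m (hits A q) <= 1 - F N q.
  by apply: m_hits_le => // z z01 Az; apply: le_trans bN2; exact: hA1.
have M2 : 1 - F N.+1 q <= m (hits A q).
  by apply: m_hits_ge => // z z01 zb; apply: hA2 => //; exact: le_lt_trans bN1.
move: E1 E2; rewrite !ler_norml => /andP[? ?] /andP[? ?].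
by apply/andP; split; lra.
Qed.

(** The linear bound [H (b N) + q * th N] on [1 - F N q] is enough here: [th N] is negligible
    against [m A], while [q * m A <= t]. *)
Lemma hits_small t eps : 0 < t -> 0 < eps -> exists2 del, 0 < del &
  forall (A : set R) a q, 0 < a -> a < del -> a <= 1 -> msr A ->
    (forall z, 0 <= z <= 1 -> A z -> z <= a) ->
    (forall z, 0 <= z <= 1 -> z < a -> A z) ->
    q%:R * m A <= t -> m (hits A q) <= eps.
Proof.
move=> t0 e0; have e2 : 0 < eps / 2 by rewrite divr_gt0.
have et : 0 < eps / 2 / t by rewrite divr_gt0.
have [n1 hn1] := Hb_small e2.
have [n2 hn2] := th_ratio et.
have [del del0 hd] := level_large (maxn 1 (maxn n1 n2)).
exists del => // A a q a0 adel a1 mA hA1 hA2 hq.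
have [N hN] := level_exists (introT andP (conj a0 a1)).
have /andP[bN1 bN2] := hN.
have := hd _ _ adel bN1; rewrite !geq_max => /and3P[N0 Nn1 Nn2].
have mge : H (b N.+1) <= m A.
  rewrite -(cdf_level im am H_diff H0 N.+1); apply: (m_le im am) => //; first exact: msr_le.
  by move=> z [z01 _] zb; apply: hA2 => //; exact: le_lt_trans bN1.
have M1 : m (hits A q) <= 1 - F N q.
  by apply: m_hits_le => // z z01 Az; apply: le_trans bN2; exact: hA1.
apply: (le_trans M1).
apply: le_trans (F_lower q N0) _.
have h1 := hn1 N Nn1.
have h2 := hn2 N Nn2.
have : q%:R * th N <= eps / 2.
  apply: (@le_trans _ _ (q%:R * (eps / 2 / t * m A))).
    apply: ler_wpM2l => //; apply: (le_trans h2); exact: (ler_wpM2l (ltW et) mge).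
  rewrite mulrCA; apply: (@le_trans _ _ (eps / 2 / t * t)); first exact: (ler_wpM2l (ltW et) hq).
  by rewrite divfK // gt_eqF.
lra.
Qed.

Lemma m_gt0 A a : 0 < a -> a <= 1 -> msr A -> (forall z, 0 <= z <= 1 -> z < a -> A z) -> 0 < m A.
Proof.
move=> a0 a1 mA hA.
have e2 : 0 < (1 : R) / 2 by rewrite divr_gt0.
have [n hn] := b_small a0.
have [n2 hn2] := th_asymp e2.
pose N := maxn n n2.
have /andP[h1 _] := hn2 N (leq_maxr _ _).
have tN : 0 < th N.
  apply: lt_le_trans h1; apply: mulr_gt0; first by lra.
  exact: (mulr_gt0 al_gt0 (b_gt0 im N)).
have hb : H (b N) <= m A.
  rewrite -(cdf_level im am H_diff H0 N); apply: (m_le im am) => //; first exact: msr_le.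
  by move=> z [z01 _] zb; apply: hA => //; apply: le_lt_trans zb _; apply: hn; exact: leq_maxl.
apply: lt_le_trans hb; apply: (lt_le_trans tN); rewrite /th.
have := H_le (ltW (b_gt0 im N.+1)); rewrite H0; lra.
Qed.

End Asymptotics.

(** * Hitting times *)

Section HittingTime.
Variables (R : realType) (T : R -> R).

Lemma hitting_time_ge0 (E : set R) x : (0 <= hitting_time T E x)%E.
Proof. by apply: le_ereal_inf_tmp => _ [n _ <-]; rewrite lee_fin. Qed.

(** No hit up to time [q] forces the hitting time, possibly [+oo], to be at least [q.+1], and
    [q.+1 * a] already exceeds [t]. *)
Lemma hitting_time_le (E : set R) x a t q : 0 < a -> q%:R * a <= t -> t < q.+1%:R * a ->
  (a%:E * hitting_time T E x <= t%:E)%E <-> hits T E q x.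
Proof.
move=> a0 hq1 hq2; split; last first.
  move=> [n [/andP[n0 nq] En]].
  apply: (@le_trans _ _ (a%:E * (n%:R)%:E)%E).
    rewrite lee_pmul2l //; apply: ereal_inf_lbound; by exists n.
  rewrite -EFinM lee_fin mulrC; apply: le_trans hq1.
  by rewrite ler_wpM2r ?(ltW a0) // ler_nat.
move=> hle; apply: contrapT => nh.
have : (q.+1%:R%:E <= hitting_time T E x)%E.
  apply: le_ereal_inf_tmp => _ [n [n0 En] <-]; rewrite lee_fin ler_nat ltnNge.
  by apply/negP => nq; apply: nh; exists n; rewrite n0.
rewrite -(@lee_pmul2l _ a%:E) // => h.
have := le_trans h hle; rewrite -EFinM lee_fin mulrC leNgt.
by rewrite hq2.
Qed.

Lemma hitting_time_neg (E : set R) x a t : 0 <= a -> t < 0 ->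
  ~ (a%:E * hitting_time T E x <= t%:E)%E.
Proof.
move=> a0 t0 h; have := le_trans (mule_ge0 (_ : 0 <= a%:E)%E (hitting_time_ge0 E x)) h.
by rewrite !lee_fin => /(_ a0); rewrite leNgt t0.
Qed.

Lemma floor_mul (a t : R) : 0 < a -> 0 <= t -> exists q : nat, q%:R * a <= t /\ t < q.+1%:R * a.
Proof.
move=> a0 t0; have ta : 0 <= t / a by rewrite divr_ge0 // ltW.
have /andP[h1 h2] := truncn_itv ta.
by exists (Num.truncn (t / a)); rewrite -ler_pdivlMr // -ltr_pdivrMr.
Qed.

End HittingTime.

(** * An interval containing the fixed point lies between [[0, len)] and [[0, len]] *)

Section IntervalAtZero.
Variables (R : realType) (E : interval R).
Hypotheses (E0 : 0 \in E) (E1 : [set` E] `<=` `[0, 1]).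
Local Notation leb := (@lebesgue_measure R).

Lemma interval_length : leb [set` E] = (fine (leb [set` E]))%:E.
Proof.
rewrite fineK // ge0_fin_numE //; apply: (@le_lt_trans _ _ (leb `[0, 1])).
  by apply: le_measure; rewrite ?inE.
by rewrite lebesgue_measure_itv /= lte_fin ltr01 -EFinB ltry.
Qed.

Local Notation len := (fine (leb [set` E])).

Lemma len_le1 : len <= 1.
Proof.
rewrite -lee_fin -interval_length; apply: (@le_trans _ _ (leb `[0, 1])).
  by apply: le_measure; rewrite ?inE.
by rewrite lebesgue_measure_itv /= lte_fin ltr01 -EFinB subr0.
Qed.

Let mem_le x y : [set` E] x -> 0 <= y <= x -> [set` E] y.
Proof.
move=> Ex hy; have := @interval_is_interval R E; apply; first exact: E0.
  exact: Ex.
exact: hy.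
Qed.

Lemma interval_le_len x : [set` E] x -> x <= len.
Proof.
move=> Ex; have x0 : 0 <= x by have := E1 Ex; rewrite /= in_itv /= => /andP[].
rewrite -lee_fin -interval_length.
have -> : x%:E = leb `[0, x].
  rewrite lebesgue_measure_itv /= lte_fin; case: ltP => h; first by rewrite -EFinB subr0.
  by congr EFin; apply/eqP; rewrite eq_le h x0.
apply: le_measure; rewrite ?inE //= => y /=; rewrite in_itv /=; exact: mem_le.
Qed.

Lemma interval_lt_len x : 0 <= x < len -> [set` E] x.
Proof.
move=> /andP[x0 xl]; apply: contrapT => nE.
suff : len <= x by rewrite leNgt xl.
rewrite -lee_fin -interval_length.
have -> : x%:E = leb `[0, x].
  rewrite lebesgue_measure_itv /= lte_fin; case: ltP => h; first by rewrite -EFinB subr0.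
  by congr EFin; apply/eqP; rewrite eq_le h x0.
apply: le_measure; rewrite ?inE //= => y Ey /=.
have := E1 Ey; rewrite /= !in_itv /= => /andP[y0 _]; rewrite y0 /= leNgt.
apply/negP => xy; apply: nE; apply: (mem_le Ey); by rewrite x0 ltW.
Qed.

End IntervalAtZero.

Unset Implicit Arguments.

Lemma cvg_EFin_eps (R : realType) (f : nat -> \bar R) (u : nat -> R) (l : R) :
  (forall k, f k = (u k)%:E) ->
  (forall eps, 0 < eps -> exists N, forall k, (N <= k)%N -> `|u k - l| <= eps) ->
  f k @[k --> \oo] --> l%:E.
Proof.
move=> fu hu; apply/fine_cvgP; split; first by exists 0%N => // k _ /=; rewrite fu.
apply/cvgrPdist_le => eps e0; have [N hN] := hu eps e0.
by exists N => // k /= Nk; rewrite fu distrC; exact: hN.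
Qed.

Theorem mainTheorem4 (R : realType) (c : R) (T TL TR h g : R -> R)
    (E : nat -> interval R) :
  0 < c < 1 ->
  (* T : X -> X *)
  (forall x, `[0, 1] x -> `[0, 1] (T x)) ->
  (* increasing homeomorphic branches onto (0,1) *)
  {in `]0, c[%classic &, {mono T : x y / x < y}} ->
  {within `]0, c[, continuous T} ->
  T @` `]0, c[ = `]0, 1[ ->
  {in `]c, 1[%classic &, {mono T : x y / x < y}} ->
  {within `]c, 1[, continuous T} ->
  T @` `]c, 1[ = `]0, 1[ ->
  (* right branch: uniformly expanding C^2 extension TR to [c,1] *)
  (forall x, `]c, 1[ x -> TR x = T x) ->
  (exists2 eta : R, 0 < eta & C2_on TR `]c - eta, 1 + eta[) ->
  (exists2 rho : R, 1 < rho & forall x, `[c, 1] x -> rho <= `|(derive1 TR) x|) ->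
  (* left branch: C^2 extension TL to (0,c] *)
  (forall x, `]0, c[ x -> TL x = T x) ->
  (exists2 eta : R, 0 < eta & C2_on TL `]0, c + eta[) ->
  T 0 = 0 ->
  (forall eps : R, 0 < eps ->
     exists2 rho : R, 1 < rho & forall x, `[eps, c] x -> rho <= (derive1 TL) x) ->
  (derive1 TL) x @[x --> (0:R)^'+] --> (1:R) ->
  (exists2 delta : R, 0 < delta &
     {in `]0, delta[%classic &, {homo (derive1 TL) : x y / x < y}}) ->
  (* integrable bound on T'' *)
  {within `]0, c], continuous g} ->
  {in `]0, c]%classic &, {homo g : x y / x < y >-> y < x}} ->
  (\int[@lebesgue_measure R]_(x in `]0%R, c]) (g x)%:E < +oo)%E ->
  (forall x, `]0, c] x -> `|(derive1 (derive1 TL)) x| <= g x) ->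
  (* mu << lambda : T-invariant probability on [0,1] with continuous density h *)
  (forall x, `]0, 1[ x -> 0 <= h x) ->
  {within `]0, 1[, continuous h} ->
  dens_measure h `[0, 1] = 1%E ->
  (forall A : set R, measurable A -> A `<=` `[0, 1] ->
     dens_measure h (T @^-1` A) = dens_measure h A) ->
  (* intervals E_k containing 0, in X, of positive length tending to 0 *)
  (forall k, 0 \in E k) ->
  (forall k, [set` E k] `<=` `[0, 1]) ->
  (forall k, (0 < @lebesgue_measure R [set` E k])%E) ->
  @lebesgue_measure R [set` E k] @[k --> \oo] --> 0%E ->
  (* (1) convergence to infinity in mu-measure *)
  (forall t : R, 0 < t ->
     dens_measure h [set x | (dens_measure h [set` E k]
                                * hitting_time T [set` E k] x <= t%:E)%E]
       @[k --> \oo] --> 0%E)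
  /\
  (* (2) convergence in law to a standard exponential *)
  (forall t : R,
     dens_measure h [set x | ((h c / (derive1 TR) c)%:E * @lebesgue_measure R [set` E k]
                                * hitting_time T [set` E k] x <= t%:E)%E]
       @[k --> \oo] --> (if 0 <= t then 1 - expR (- t) else 0)%:E).
Proof.
move=> c01 T01 TL_mono TL_cont TL_img TR_mono TR_cont TR_img TRE TR_C2 TR_exp TLE TL_C2 T0
  TL_exp TL_tan _ g_cont g_decr g_int TL_g h_ge0 h_cont h_mass h_inv E0 E01 E_pos E_cvg.
have [L [Rr [kappa [D im]]]] := branches_indiff_map c01 T01 TL_mono TL_img TR_mono TR_img TRE
  TR_C2 TR_exp TLE TL_C2 T0 TL_exp TL_tan g_cont g_decr g_int TL_g.
pose m A := fine (dens_measure h A).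
pose H := dens_cdf h.
pose h0 := inner_density h.
have am : acim T m := dens_acim h_ge0 h_cont h_mass c01 T01 TL_cont TR_cont h_inv.
have H_diff x y : x <= y -> H y - H x = m [set z | x < z <= y].
  exact: dens_cdf_diff.
have H0 : H 0 = 0 by exact: dens_cdf0.
have H1 : H 1 = 1 by exact: dens_cdf1.
have H_cont := dens_cdf_abs_cont h_ge0 h_cont h_mass.
have h0_ge0 := inner_density_ge0 h_ge0.
have H_ub := dens_cdf_ub h_ge0 h_cont h_mass.
have H_lb := dens_cdf_lb h_ge0 h_cont h_mass.
have h_mod := inner_density_lip h_cont.
have hc : h0 c = h c by exact: inner_densityE.
have Esmall del : 0 < del -> exists N, forall k, (N <= k)%N ->
    fine (@lebesgue_measure R [set` E k]) < del.
  move=> del0.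
  have hcv : (fine \o (fun k => @lebesgue_measure R [set` E k])) k @[k --> \oo] --> (0 : R).
    exact: fine_cvg E_cvg.
  move/cvgrPdist_lt : hcv => /(_ _ del0) [N _ hN].
  exists N => k Nk; have := hN k Nk; rewrite /= sub0r normrN; apply: le_lt_trans.
  exact: ler_norm.
pose a k := fine (@lebesgue_measure R [set` E k]).
have aE k : @lebesgue_measure R [set` E k] = (a k)%:E := interval_length (E01 k).
have a0 k : 0 < a k by have := E_pos k; rewrite aE lte_fin.
have a1 k : a k <= 1 := len_le1 (E01 k).
have mE k : msr [set` E k] by exact: msr_itv.
have E_le k z : 0 <= z <= 1 -> [set` E k] z -> z <= a k by move=> _; exact: interval_le_len.
have E_lt k z : 0 <= z <= 1 -> z < a k -> [set` E k] z.
  by move=> /andP[z0 _] za; apply: interval_lt_len => //; rewrite z0.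
have dE A : msr A -> dens_measure h A = (m A)%:E by exact: dens_fin.
split.
  move=> t t0.
  pose mu k := m [set` E k].
  have mu0 k : 0 < mu k.
    exact: (m_gt0 im am H_diff H0 H1 H_cont h0_ge0 H_ub H_lb h_mod (a0 k) (a1 k) (mE k) (E_lt k)).
  (* An integer threshold replaces the real one: the event becomes [hits], a finite union of
     preimages, to which the measure estimates apply. *)
  have /choice[q hq] k := floor_mul (mu0 k) (ltW t0).
  apply: (@cvg_EFin_eps _ _ (fun k => m (hits T [set` E k] (q k)))).
    move=> k; rewrite -dE; last exact: (msr_hits am).
    congr (dens_measure h _); apply/seteqP; split => x /=; rewrite dE //;
      by move/(hitting_time_le _ _ _ (mu0 k) (hq k).1 (hq k).2).
  move=> eps e0.
  have [del del0 hd] := hits_small im am H_diff H0 H1 H_cont h0_ge0 H_ub H_lb h_mod t0 e0.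
  have [N hN] := Esmall del del0; exists N => k Nk; rewrite subr0 ger0_norm.
    exact: (hd _ (a k) (q k) (a0 k) (hN k Nk) (a1 k) (mE k) (E_le k) (E_lt k) (hq k).1).
  by apply: (acim_ge0 am); exact: (msr_hits am).
move=> t.
pose al := h c / (derive1 TR) c.
have al0 : 0 < al.
  have := al_gt0 im am H_diff H0 H1 H_cont h0_ge0 H_ub H_lb h_mod.
  by rewrite /hitting_rate -/h0 hc.
have s0 k : 0 < al * a k by rewrite mulr_gt0.
have set_eq k : [set x | ((h c / (derive1 TR) c)%:E * @lebesgue_measure R [set` E k]
     * hitting_time T [set` E k] x <= t%:E)%E] =
   [set x | ((al * a k)%:E * hitting_time T [set` E k] x <= t%:E)%E].
  by rewrite aE -EFinM.
have [t0|t0] := leP 0 t; last first.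
  apply: (@cvg_EFin_eps _ _ (fun k => 0)).
    move=> k; rewrite set_eq.
    have -> : [set x | ((al * a k)%:E * hitting_time T [set` E k] x <= t%:E)%E] = set0.
      apply/seteqP; split => // x /= hx.
      by move: hx; apply: hitting_time_neg => //; exact: ltW.
    by rewrite /dens_measure set0I integral_set0.
  by move=> eps e0; exists 0%N => k _; rewrite subrr normr0 ltW.
have /choice[q hq] k := floor_mul (s0 k) t0.
apply: (@cvg_EFin_eps _ _ (fun k => m (hits T [set` E k] (q k)))).
  move=> k; rewrite -dE; last exact: (msr_hits am).
  rewrite set_eq; congr (dens_measure h _); apply/seteqP; split => x /=;
    by move/(hitting_time_le _ _ _ (s0 k) (hq k).1 (hq k).2).
move=> eps e0.
have [del del0 hd] := hits_exponential im am H_diff H0 H1 H_cont h0_ge0 H_ub H_lb h_mod t0 e0.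
have [N hN] := Esmall del del0; exists N => k Nk.
apply: (hd _ (a k) (q k) (a0 k) (hN k Nk) (a1 k) (mE k) (E_le k) (E_lt k)).
  by rewrite /hitting_rate -/h0 hc; exact: (hq k).1.
by rewrite /hitting_rate -/h0 hc; exact: (hq k).2.
Qed.
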